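(* Let $n\ge 2$ and $1<p<\infty$. There exists a constant $C_{p,n}>0$, depending only on $p$ and $n$, such that for every finite nonempty set $U$ of unit vectors in $\mathbb{R}^n$, $$\|\mathscr{H}_U\|_{p\to p}\ \ge\ C_{p,n}\sqrt{\log \#U},$$ where $\#U$ is the cardinality of $U$.
   Context: Logarithms are to base 2. For a unit vector $v\in\mathbb{S}^{n-1}\subset\mathbb{R}^n$, the directional Hilbert transform is defined on Schwartz functions $f$ on $\mathbb{R}^n$ by $$\mathscr{H}_v f(x)=\frac1\pi\lim_{\epsilon\to0^+}\int_{|t|>\epsilon} f(x-tv)\,\frac{dt}{t},\qquad x\in\mathbb{R}^n.$$ For a finite set $U$ of unit vectors, the maximal directional Hilbert transform is $\mathscr{H}_U f(x)=\max_{v\in U}|\mathscr{H}_v f(x)|$, initially for Schwartz $f$. For $1<p<\infty$, $\mathscr{H}_U$ is bounded in $L^p(\mathbb{R}^n)$, and $\|\mathscr{H}_U\|_{p\to p}$ denotes its operator norm on $L^p(\mathbb{R}^n)$, i.e. the supremum of $\|\mathscr{H}_Uf\|_p/\|f\|_p$ over nonzero Schwartz functions $f$. *)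

(* Defs.v *)
From HB Require Import structures.
From mathcomp Require Import all_boot all_order all_algebra.
From mathcomp Require Import finmap.
From mathcomp Require Import all_classical all_reals all_analysis.
From mathcomp.real_closed Require Import complex.

Set Implicit Arguments.
Unset Strict Implicit.
Unset Printing Implicit Defensive.
Import Order.TTheory GRing.Theory Num.Theory.
Import numFieldNormedType.Exports.

Local Open Scope classical_set_scope.
Local Open Scope ring_scope.

Section LebesgueMeasureRn.
Context {R : realType}.
Local Notation mR := (measurableTypeR R).

Definition cons_pair n (z : n.-tuple mR * mR) : n.+1.-tuple mR :=
  [tuple of z.2 :: z.1].

Lemma measurable_cons_pair n :
  measurable_fun [set: n.-tuple mR * mR] (@cons_pair n).
Proof. exact: measurable_cons. Qed.

Section ConsMeasure.
Variables (n : nat) (m : {measure set (n.-tuple mR) -> \bar R}).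

(* The product of m with the Lebesgue measure of the line, on (n + 1)-tuples;
   the library has binary product measures only. *)
Definition cons_measure : set (n.+1.-tuple mR) -> \bar R :=
  pushforward (m \x lebesgue_measure)%E (@cons_pair n).

Let cm_measure := measure_function_pushforward__canonical__measure_function_Measure
  (m \x lebesgue_measure)%E (@measurable_cons_pair n).

Let cons_measure0 : cons_measure set0 = 0%E.
Proof. exact: (@measure0 _ _ _ cm_measure). Qed.

Let cons_measure_ge0 A : (0 <= cons_measure A)%E.
Proof. exact: (@measure_ge0 _ _ _ cm_measure). Qed.

Let cons_measure_sigma_additive : semi_sigma_additive cons_measure.
Proof. exact: (@measure_semi_sigma_additive _ _ _ cm_measure). Qed.

HB.instance Definition _ := isMeasure.Build _ _ _ cons_measure
  cons_measure0 cons_measure_ge0 cons_measure_sigma_additive.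

End ConsMeasure.

Fixpoint lebesgue_Rn n : {measure set (n.-tuple mR) -> \bar R} :=
  if n is k.+1 then cons_measure (lebesgue_Rn k) else dirac [tuple].

Lemma lebesgue_Rn_box n (A : 'I_n -> set mR) : (forall i, measurable (A i)) ->
  lebesgue_Rn n [set t | forall i, A i (tnth t i)] =
  (\prod_(i < n) lebesgue_measure (A i))%E.
Proof.
elim: n A => [|n IHn] A mA.
  rewrite big_ord0 /= diracE mem_set //=.
  by case.
rewrite big_ord_recl /= /cons_measure /pushforward.
set B := [set t : n.-tuple mR | forall i, A (lift ord0 i) (tnth t i)].
have -> : @cons_pair n @^-1` [set t | forall i, A i (tnth t i)] = B `*` A ord0.
  apply/seteqP; split => [[t x] /= h|[t x] [/= hB hA] i].
    split => [i /=|/=]; last by have := h ord0; rewrite tnth0.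
    by have := h (lift ord0 i); rewrite tnthS.
  by case: (unliftP ord0 i) => [j|] ->; rewrite ?tnthS ?tnth0.
have mB : measurable B.
  rewrite (_ : B = \bigcap_i
      ((fun t : n.-tuple mR => tnth t i) @^-1` A (lift ord0 i))).
    apply: fin_bigcap_measurable => // i _.
    by rewrite -[X in measurable X]setTI; exact: measurable_tnth.
  by apply/seteqP; split => [t h i _|t h i]; exact: h.
rewrite product_measure1E // muleC; congr (_ * _)%E.
exact: (IHn (fun i => A (lift ord0 i))).
Qed.

End LebesgueMeasureRn.

Section DirectionalHilbert.
Context {R : realType} {n : nat}.
Local Notation Rn := 'rV[R]_n.

(* The library norm of 'rV[R]_n is the sup norm. *)
Definition enorm (x : Rn) : R := Num.sqrt (\sum_(i < n) x 0 i ^+ 2).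

Definition cabs (z : R[i]) : R :=
  Num.sqrt (complex.Re z ^+ 2 + complex.Im z ^+ 2).

Definition partials (s : seq 'I_n) (g : Rn -> R) : Rn -> R :=
  foldr (fun i h => 'D_(delta_mx 0 i) h) g s.

Definition smooth (g : Rn -> R) : Prop :=
  forall s : seq 'I_n, continuous (partials s g) /\
    forall (i : 'I_n) x, derivable (partials s g) x (delta_mx 0 i).

Definition schwartz_real (g : Rn -> R) : Prop :=
  smooth g /\ forall (N : nat) (s : seq 'I_n),
    exists M : R, forall x, enorm x ^+ N * `|partials s g x| <= M.

Definition schwartz (f : Rn -> R[i]) : Prop :=
  schwartz_real (fun x => complex.Re (f x)) /\
  schwartz_real (fun x => complex.Im (f x)).

Definition hilbert_real (v : Rn) (g : Rn -> R) (x : Rn) : R :=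
  pi^-1 * lim (\int[lebesgue_measure]_(t in [set t : R | eps < `|t|])
                 (g (x - t *: v) / t) @[eps --> 0^'+]).

(* Integral and limit of a complex-valued function are taken componentwise. *)
Definition hilbert (v : Rn) (f : Rn -> R[i]) (x : Rn) : R[i] :=
  Complex (hilbert_real v (fun y => complex.Re (f y)) x)
          (hilbert_real v (fun y => complex.Im (f y)) x).

(* The values are nonnegative: for nonempty U the initial 0 has no effect. *)
Definition max_hilbert (U : {fset Rn}) (f : Rn -> R[i]) (x : Rn) : R :=
  \big[Num.max/0]_(v <- U) cabs (hilbert v f x).

(* Derivatives live on row vectors, the product sigma-algebra on tuples. *)
Definition Lp_norm (p : R) (g : Rn -> R) : \bar R :=
  'N[lebesgue_Rn n]_(p%:E)[(fun t => (g (\row_i tnth t i))%:E)]%E.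

Definition max_hilbert_opnorm (p : R) (U : {fset Rn}) : \bar R :=
  ereal_sup [set r : \bar R | exists f : Rn -> R[i],
    [/\ schwartz f, f <> (fun=> 0) &
        r = (Lp_norm p (max_hilbert U f) / Lp_norm p (fun x => cabs (f x)))%E]
  ].

End DirectionalHilbert.

Definition log2 {R : realType} (x : R) : R := ln x / ln 2.

(* Main.v *)
(* A sign change v.xi > 0 > v'.xi is a cut between v and v'.  For a generic
   2-plane, half of the directions in U (up to sign) are linearly ordered by
   slope, and every cut of this order is realised by some frequency xi; this
   gives 2^m directions, m >= c log #U, at the leaves of a binary tree whose
   node (k, i) carries a frequency xi_{k,i} separating its two subtrees.

   The test function is the Gaussian g times F, where
     F = sum_k sum_i w_{k,i} cos(lambda_k xi_{k,i}.x)
   with lambda_k increasing very fast.  The weights w_{k,.}(x) are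
   nonnegative and sum to 1 at each level; w_{k,i} is distributed over the
   children of (k, i) in proportions q and 1 - q, where q is a polynomial in
   sin(lambda_k xi_{k,i}.x) approximating the indicator of {sin > 0}.

   H_v (g w cos(lambda xi.x)) is close to kappa sgn(v.xi) g w sin(lambda xi.x).
   So the average of H_{v_l} (g F) over the leaves l with weights w_{m,l} is a
   lower bound for the maximal function, and since the mass at a node follows
   the sign of its sine, each level adds to its Gaussian mean a fixed multiple
   of the mean of sum_i w_{k,i}^2.  That sum stays close to 1 because
   q (1 - q) has mean O(1/m); hence ||H_U (g F)||_p >= c m.  On the other hand
   the levels are bounded by 1 and behave like martingale differences, so
   ||g F||_p <= C sqrt m. *)
From HB Require Import structures.
From mathcomp Require Import all_boot all_order all_algebra.
From mathcomp Require Import finmap.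
From mathcomp Require Import all_classical all_reals all_analysis.
From mathcomp Require Import measurable_realfun zify ring lra.
From mathcomp.real_closed Require Import complex.
Require Import Defs.

Set Implicit Arguments.
Unset Strict Implicit.
Unset Printing Implicit Defensive.
Import Order.TTheory GRing.Theory Num.Theory.
Import numFieldNormedType.Exports.
Local Open Scope classical_set_scope.
Local Open Scope ring_scope.

(** * Gaussian integrals on the line *)

Section line.
Context {R : realType}.
Local Notation mu := (@lebesgue_measure R).
Implicit Types (a b c t u v x y : R) (f g : R -> R).

(** Everything stays a Gaussian times a trigonometric polynomial; this is why the indicator of {sin
    > 0} is replaced by a polynomial. Gaussian means and Hilbert transforms are then explicit, and
    the scales lambda_k need no formula: once the earlier levels are fixed, each requirement on the
    next level holds for every large scale, so one scale meets them all. The error in the Hilbert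
    transform is bounded only by e (1 + |x|), which lies in no L^p. The lower bound therefore
    integrates the pointwise estimate against exp (- (p - 1) |x|^2) and returns to the L^p norm by y
    - 1 <= y^p. This weight turns g into g^p, so lower and upper bound use the same Gaussian mean.
    The upper bound replaces p by an even exponent 2 (r + 1) and follows m + F^2 instead of F^2: the
    floor m makes each level cost a factor 1 + O(1/m) only, and m levels a bounded one. The order of
    choices makes the constant depend on p and n only: e and the other constants come before U, then
    m, then q, and the scales last. *)

Lemma is_derive_continuous (f' : R -> R) f :
  (forall t, is_derive t 1 f (f' t)) -> continuous f.
Proof.
move=> df t; apply/differentiable_continuous/derivable1_diffP.
exact: (@ex_derive _ _ _ _ _ _ _ (df t)).
Qed.

Lemma gauss_normal_fun a b t : 0 < a ->
  expR (- (a * (t - b) ^+ 2)) = normal_fun b (Num.sqrt (2 * a)^-1) t.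
Proof.
move=> a0; rewrite /normal_fun sqr_sqrtr ?invr_ge0 ?mulr_ge0 ?(ltW a0)//.
congr expR; rewrite -mulr_natr mulNr; congr (- _).
have a1 : a != 0 by rewrite gt_eqF.
by field.
Qed.

Lemma continuous_gauss a b : continuous (fun t => expR (- (a * (t - b) ^+ 2))).
Proof.
apply: (@is_derive_continuous (fun t => - (a * (2 * (t - b))) * expR (- (a * (t - b) ^+ 2)))) => t.
by apply: is_derive_eq; rewrite /GRing.scale/=; ring.
Qed.

Definition gauss_mass a : R := fine (\int[mu]_t (expR (- (a * t ^+ 2)))%:E)%E.

Lemma integral_gauss_center a b : 0 < a ->
  (\int[mu]_t (expR (- (a * (t - b) ^+ 2)))%:E)%E
  = ((normal_peak (Num.sqrt (2 * a)^-1))^-1)%:E.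
Proof.
move=> a0; under eq_integral do rewrite gauss_normal_fun//.
set s := Num.sqrt _.
have s0 : s != 0 by rewrite gt_eqF// sqrtr_gt0 invr_gt0 mulr_gt0.
have pk0 : normal_peak s != 0 by rewrite gt_eqF// normal_peak_gt0.
have := integral_normal_pdf b s; rewrite normal_pdfE//.
under [X in X = _ -> _]eq_integral do rewrite EFinM.
rewrite ge0_integralZl//=; last 3 first.
- by apply/measurable_EFinP; exact: measurable_normal_fun.
- by move=> x _; rewrite lee_fin expR_ge0.
- by rewrite lee_fin normal_peak_ge0.
set I := (\int[_]_(_ in _) _)%E => h.
have I0 : (0 <= I)%E by apply: integral_ge0 => x _; rewrite lee_fin expR_ge0.
move: h I0; case: I => [r||]//=.
- rewrite -EFinM => -[h] _; congr (_%:E).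
  by rewrite -[LHS](mulKf pk0) h mulr1.
- by rewrite gt0_muley ?lte_fin ?normal_peak_gt0.
Qed.

Lemma gauss_massE a : 0 < a ->
  gauss_mass a = (normal_peak (Num.sqrt (2 * a)^-1))^-1.
Proof.
move=> a0; rewrite /gauss_mass -[RHS]/(fine (_%:E)) -(integral_gauss_center 0)//.
by under [in RHS]eq_integral do rewrite subr0.
Qed.

Lemma gauss_mass_gt0 a : 0 < a -> 0 < gauss_mass a.
Proof.
move=> a0; rewrite gauss_massE// invr_gt0 normal_peak_gt0//.
by rewrite gt_eqF// sqrtr_gt0 invr_gt0 mulr_gt0.
Qed.

Lemma integral_gauss a b : 0 < a ->
  (\int[mu]_t (expR (- (a * (t - b) ^+ 2)))%:E)%E = (gauss_mass a)%:E.
Proof. by move=> a0; rewrite gauss_massE// integral_gauss_center. Qed.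

Lemma integrable_gauss a b : 0 < a ->
  mu.-integrable setT (fun t => (expR (- (a * (t - b) ^+ 2)))%:E).
Proof.
move=> a0; apply/integrableP; split.
  by apply/measurable_EFinP; apply: continuous_measurable_fun; exact: continuous_gauss.
under eq_integral do rewrite /= ger0_norm ?expR_ge0//.
by rewrite integral_gauss// ltry.
Qed.

(** Half of the exponent absorbs the linear factor, by [1 + z <= expR z] at [z = a / 2 * u ^+ 2];
    the other half is still integrable. *)
Lemma gauss_dominates a (u : R) : 0 < a ->
  (1 + `|u|) * expR (- (a * u ^+ 2)) <= (2 + 2 / a) * expR (- (a / 2 * u ^+ 2)).
Proof.
move=> a0.
have -> : expR (- (a * u ^+ 2)) = expR (- (a / 2 * u ^+ 2)) * expR (- (a / 2 * u ^+ 2)).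
  by rewrite -expRD; congr expR; field.
rewrite mulrA ler_wpM2r ?expR_ge0// expRN ler_pdivrMr ?expR_gt0//.
apply: (@le_trans _ _ ((2 + 2 / a) * (1 + a / 2 * u ^+ 2))).
  have h : `|u| <= 1 + u ^+ 2.
    rewrite -[u ^+ 2]real_normK ?num_real//; move: (`|u|) (normr_ge0 u) => x x0.
    nra.
  have -> : (2 + 2 / a) * (1 + a / 2 * u ^+ 2)
      = 2 + u ^+ 2 + (2 / a + a * u ^+ 2) by field; rewrite gt_eqF.
  have : 0 <= 2 / a + a * u ^+ 2.
    by apply: addr_ge0; [rewrite divr_ge0// ltW | rewrite mulr_ge0 ?sqr_ge0 ?ltW].
  lra.
apply: ler_wpM2l; first by apply: addr_ge0 => //; rewrite divr_ge0// ltW.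
exact: expR_ge1Dx.
Qed.

Lemma integrable_gauss_bound a b c g : 0 < a -> measurable_fun setT g ->
  (forall t, `|g t| <= c * ((1 + `|t - b|) * expR (- (a * (t - b) ^+ 2)))) ->
  mu.-integrable setT (EFin \o g).
Proof.
move=> a0 mg gb.
have a20 : 0 < a / 2 by rewrite divr_gt0.
have := @integrableZl _ _ _ mu _ measurableT (`|c| * (2 + 2 / a)) _ (integrable_gauss b a20).
apply: le_integrable => //; first exact/measurable_EFinP.
move=> t _ /=; rewrite lee_fin (le_trans (gb _))//.
rewrite ler_normr; apply/orP; left.
apply: (le_trans (ler_wpM2r _ (ler_norm _))).
  by rewrite mulr_ge0 ?expR_ge0// addr_ge0.
rewrite -[leRHS]mulrA; apply: ler_wpM2l => //; exact: gauss_dominates.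
Qed.

(** The special integrals below are identified by the differential equations that they satisfy in a
    parameter; this rule produces those equations. *)
Lemma is_derive_under_integral (f df : R -> R -> R) (G : R -> R) (a u v : R) :
  u < a < v ->
  (forall x, u < x < v -> mu.-integrable setT (EFin \o f x)) ->
  (forall x t, is_derive x 1 (f ^~ t) (df x t)) ->
  mu.-integrable setT (EFin \o G) ->
  (forall x t, u < x < v -> `|df x t| <= G t) ->
  is_derive a 1 (fun x => \int[mu]_t f x t) (\int[mu]_t df a t).
Proof.
move=> auv intf dfP intG dfG.
have dE x t : ((f ^~ t)^`())%classic x = df x t.
  by rewrite derive1E; apply: derive_val.
have Ia : `]u, v[%classic a by rewrite /= in_itv.
have itvP x : `]u, v[%classic x -> u < x < v by rewrite /= in_itv.
have G0 t : 0 <= G t by apply: le_trans (dfG a t auv).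
have h := @cvg_differentiation_under_integral _ _ _ mu f setT measurableT a u v Ia
  (fun x hx => intf x (itvP x hx)) (fun x t _ _ => @ex_derive _ _ _ _ _ _ _ (dfP x t))
  G G0 intG.
have {}h := h (fun x t hx _ => (eq_ind_r (fun z => `|z| <= G t) (dfG x t (itvP x hx)) (dE x t))).
have E : \int[mu]_y partial1of2 f a y = \int[mu]_t df a t.
  by apply: eq_Rintegral => t _; rewrite /partial1of2 dE.
move: h; rewrite E => h.
have h' : h^-1 *: ((fun x => \int[mu]_t f x t) (h *: 1 + a) - \int[mu]_t f a t)
   @[h --> 0^'] --> \int[mu]_t df a t.
  by under eq_fun do rewrite scaler1.
apply: DeriveDef; first by apply/cvg_ex; exists (\int[mu]_t df a t).
exact/cvg_lim.
Qed.


(** The fundamental theorem on [[- (n + 1), n + 1]]: the decay of [F] removes the boundary terms,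
    and dominated convergence passes to the whole line. *)
Lemma integral_derivative0 (F f : R -> R) (C : R) :
  (forall t, is_derive t 1 F (f t)) -> continuous f ->
  (forall t, `|F t| * (1 + `|t|) <= C) ->
  mu.-integrable setT (EFin \o f) -> \int[mu]_t f t = 0.
Proof.
move=> dF cf FC intf.
have cF : continuous F by exact: is_derive_continuous dF.
have F_cvg0 (s : R) : `|s| = 1 -> F (s * n.+1%:R) @[n --> \oo] --> (0 : R).
  move=> s1; apply: norm_cvg0.
  apply: (@squeeze_cvgr _ _ _ _ (cst 0) (fun n => C * n.+1%:R^-1)).
  - apply: nearW => n /=; rewrite normr_ge0/= ler_pdivlMr//.
    apply: le_trans (FC (s * n.+1%:R)); rewrite ler_wpM2l// normrM s1 mul1r.
    by rewrite ger0_norm// lerDr.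
  - exact: cvg_cst.
  - rewrite -[X in _ --> X](mulr0 C); apply: cvgM; first exact: cvg_cst.
    exact: cvg_harmonic.
pose D n : set R := `[- n.+1%:R, n.+1%:R]%classic.
have FTC n : (\int[mu]_(t in D n) (f t)%:E)%E = (F n.+1%:R - F (- n.+1%:R))%:E.
  rewrite (@continuous_FTC2 _ f F) ?EFinB//.
  - by rewrite ltrNl (@lt_trans _ _ 0)// ?oppr_lt0 ?ltr0n.
  - exact: continuous_subspaceT.
  - split => [t _||]; first exact: (@ex_derive _ _ _ _ _ _ _ (dF t)).
    + by apply: cvg_at_right_filter; exact: cF.
    + by apply: cvg_at_left_filter; exact: cF.
  - by move=> t _; rewrite derive1E; apply: derive_val.
have mf : measurable_fun setT (EFin \o f) by exact: measurable_int intf.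
have mfD n : measurable_fun setT ((EFin \o f) \_ (D n)).
  apply: (measurable_restrictT _ _).1; first exact: measurable_itv.
  exact: measurable_funTS.
have fD_cvg : {ae mu, forall t, setT t ->
    ((EFin \o f) \_ (D n)) t @[n --> \oo] --> (EFin \o f) t}.
  apply: aeW => t _; apply: cvg_near_cst; near=> n.
  rewrite patchE ifT//; apply/mem_set; rewrite /D/= in_itv/= -ler_norml.
  by apply: (@le_trans _ _ n%:R); [near: n; exact: nbhs_infty_ger | rewrite ler_nat].
have fD_le : {ae mu, forall t n, setT t ->
    (`|((EFin \o f) \_ (D n)) t| <= (abse \o (EFin \o f)) t)%E}.
  by apply: aeW => t n _; rewrite patchE; case: ifP => //= _; rewrite normr0 lee_fin.
have [_ _] := @dominated_convergence _ _ _ mu setT measurableT _ _ _ mfD mf fD_cvg (integrable_abse intf) fD_le.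
set u := (X in X @ _ --> _ -> _).
have -> : u = fun n => (F n.+1%:R - F (- n.+1%:R))%:E.
  by apply/funext => n; rewrite -FTC integral_mkcond.
move=> ucvg.
have : (F n.+1%:R - F (- n.+1%:R))%:E @[n --> \oo] --> (0 : R)%:E.
  apply/fine_cvgP; split; first exact: nearW.
  rewrite -[X in _ --> X](subrr (0 : R)); apply: (@cvgB _ R^o).
    by under eq_fun do rewrite -[X in F X]mul1r; apply: F_cvg0; rewrite normr1.
  by under eq_fun do rewrite -[X in F X]mulN1r; apply: F_cvg0; rewrite normrN1.
move=> /(cvg_unique _ ucvg) E; rewrite /Rintegral -[RHS]/(fine 0%:E) -E//.
Unshelve. all: by end_near. Qed.

End line.

(** * Fourier transform of the Gaussian on the line *)

Section gauss_fourier.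
Context {R : realType}.
Local Notation mu := (@lebesgue_measure R).
Implicit Types (a b c t u v x y : R) (f g : R -> R).

(** For integrands divided by [t]: their value at 0 is a mere convention, and the factor [t] cancels
    elsewhere. *)
Lemma ae_eq_Rintegral_neq0 f g : mu.-integrable setT (EFin \o f) ->
  measurable_fun setT g -> (forall t, t != 0 -> f t = g t) ->
  \int[mu]_t f t = \int[mu]_t g t.
Proof.
move=> intf mg fg; congr fine; apply: ae_eq_integral => //.
- exact: measurable_int intf.
- exact/measurable_EFinP.
- exists [set 0]; split; [exact: measurable_set1|exact: lebesgue_measure_set1|].
  move=> t /= h; apply/eqP; apply/negPn/negP => t0; apply: h => _.
  by rewrite fg.
Qed.

Lemma gauss_decay a b t : 0 < a ->
  expR (- (a * (t - b) ^+ 2)) * (1 + `|t|) <= (1 + `|b|) * (2 + 2 / a).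
Proof.
move=> a0; have tb : `|t| <= `|t - b| + `|b| by rewrite -{1}(subrK b t) ler_normD.
have h := gauss_dominates (t - b) a0.
have h1 : expR (- (a / 2 * (t - b) ^+ 2)) <= 1.
  rewrite -[leRHS]expR0 ler_expR oppr_le0 mulr_ge0 ?sqr_ge0//.
  by rewrite divr_ge0 ?ltW.
have e0 := expR_ge0 (- (a * (t - b) ^+ 2)).
have c0 : 0 <= 2 + 2 / a by rewrite addr_ge0// divr_ge0// ltW.
have n0 := normr_ge0 b; have n1 := normr_ge0 (t - b).
apply: (@le_trans _ _ ((1 + `|b|) * ((1 + `|t - b|) * expR (- (a * (t - b) ^+ 2))))).
  rewrite [leRHS]mulrA [leRHS]mulrC; apply: ler_wpM2l => //; nra.
apply: ler_wpM2l; first by rewrite addr_ge0.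
by apply: (le_trans h); rewrite -[leRHS]mulr1; apply: ler_wpM2l.
Qed.

Lemma integrable_gauss_cos a b (w : R -> R) c : 0 < a -> continuous w ->
  (forall t, `|w t| <= c * (1 + `|t - b|)) ->
  mu.-integrable setT (EFin \o (fun t => expR (- (a * (t - b) ^+ 2)) * w t)).
Proof.
move=> a0 cw wc; apply: (@integrable_gauss_bound _ a b c) => //.
  apply: measurable_funM; apply: continuous_measurable_fun => //.
  exact: continuous_gauss.
move=> t; rewrite normrM ger0_norm ?expR_ge0// [leRHS]mulrA [leRHS]mulrC.
by rewrite ler_wpM2l ?expR_ge0.
Qed.

Lemma norm_cos_le1 x : `|cos x| <= 1.
Proof. by rewrite ler_norml cos_geN1 cos_le1. Qed.

Lemma norm_sin_le1 x : `|sin x| <= 1.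
Proof. by rewrite ler_norml sin_geN1 sin_le1. Qed.

(** As a function of the frequency the integral satisfies [J' = - (z / (2 * a)) * J], because the
    derivative in [t] of the Gaussian times the sine has integral 0. Hence
    [J z * expR (z ^+ 2 / (4 * a))] is constant. *)
Lemma gauss_fourier a b x y : 0 < a ->
  \int[mu]_t (expR (- (a * (t - b) ^+ 2)) * cos (x - y * (t - b)))
  = gauss_mass a * cos x * expR (- (y ^+ 2 / (4 * a))).
Proof.
move=> a0.
pose g t := expR (- (a * (t - b) ^+ 2)).
pose J z := \int[mu]_t (g t * cos (x - z * (t - b))).
pose J1 z := \int[mu]_t (g t * ((t - b) * sin (x - z * (t - b)))).
have ccos z : continuous (fun t => cos (x - z * (t - b))).
  apply: (@is_derive_continuous _ (fun t => z * sin (x - z * (t - b)))) => t.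
  by apply: is_derive_eq; rewrite /GRing.scale/=; ring.
have csin z : continuous (fun t => (t - b) * sin (x - z * (t - b))).
  apply: (@is_derive_continuous _ (fun t => sin (x - z * (t - b)) - z * (t - b) * cos (x - z * (t - b)))) => t.
  by apply: is_derive_eq; rewrite /GRing.scale/=; ring.
have intcos z : mu.-integrable setT (EFin \o (fun t => g t * cos (x - z * (t - b)))).
  apply: (@integrable_gauss_cos a b _ 1) => // t.
  by rewrite mul1r (le_trans (norm_cos_le1 _))// lerDl.
have intsin z : mu.-integrable setT (EFin \o (fun t => g t * ((t - b) * sin (x - z * (t - b))))).
  apply: (@integrable_gauss_cos a b _ 1) => // t.
  rewrite mul1r normrM; apply: (@le_trans _ _ (`|t - b| * 1)).
    by rewrite ler_wpM2l// norm_sin_le1.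
  by rewrite mulr1 lerDr.
have dJ (z : R) : is_derive z 1 J (J1 z).
  apply: (@is_derive_under_integral _ (fun z t => g t * cos (x - z * (t - b)))
    (fun z t => g t * ((t - b) * sin (x - z * (t - b))))
    (fun t => g t * `|t - b|) z (z - 1) (z + 1)).
  - by rewrite ltrBlDr !ltrDl ltr01.
  - by move=> ? _; exact: intcos.
  - move=> w t; apply: is_derive_eq; rewrite /GRing.scale/=; ring.
  - apply: (@integrable_gauss_cos a b _ 1) => // t.
      apply: (@continuous_comp _ _ _ (fun t => t - b) Num.norm); last exact: norm_continuous.
      by apply: (@cvgB _ R^o); [exact: cvg_id|exact: cvg_cst].
    by rewrite mul1r normr_id lerDr.
  - move=> w t _; rewrite normrM ger0_norm ?expR_ge0// ler_wpM2l ?expR_ge0// normrM.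
    by rewrite -[leRHS]mulr1 ler_wpM2l// norm_sin_le1.
have J1E z : J1 z = - (z / (2 * a)) * J z.
  pose f t := - (2 * a) * (g t * ((t - b) * sin (x - z * (t - b))))
     + (- z) * (g t * cos (x - z * (t - b))).
  have dF t : is_derive t 1 (fun t => g t * sin (x - z * (t - b))) (f t).
    by apply: is_derive_eq; rewrite /GRing.scale/= /f /g; ring.
  have /(_ ((1 + `|b|) * (2 + 2 / a))) := integral_derivative0 dF.
  have -> : \int[mu]_t f t = - (2 * a) * J1 z + (- z) * J z.
    rewrite RintegralD//.
    - by rewrite RintegralZl// RintegralZl.
    - exact: (@integrableZl _ _ _ mu _ measurableT (- (2 * a)) _ (intsin z)).
    - exact: (@integrableZl _ _ _ mu _ measurableT (- z) _ (intcos z)).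
  move=> h; have {}h : - (2 * a) * J1 z + - z * J z = 0.
    apply: h.
    - move=> t; apply: (@cvgD _ R^o); apply: (@cvgM _ R^o); try exact: cvg_cst.
        by apply: (@cvgM _ R^o); [exact: continuous_gauss | exact: csin].
      by apply: (@cvgM _ R^o); [exact: continuous_gauss | exact: ccos].
    - move=> t; rewrite normrM (ger0_norm (expR_ge0 _)).
      apply: le_trans (gauss_decay b t a0).
      rewrite ler_wpM2r ?addr_ge0// -[leRHS]mulr1 ler_wpM2l ?expR_ge0//.
      exact: norm_sin_le1.
    - apply: (@integrableD _ _ _ mu setT measurableT (EFin \o (fun t => - (2 * a) * (g t * ((t - b) * sin (x - z * (t - b)))))) (EFin \o (fun t => - z * (g t * cos (x - z * (t - b)))))).
      + exact: (@integrableZl _ _ _ mu _ measurableT (- (2 * a)) _ (intsin z)).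
      + exact: (@integrableZl _ _ _ mu _ measurableT (- z) _ (intcos z)).
  have a1 : a != 0 by rewrite gt_eqF.
  have -> : J1 z = - (2 * a)^-1 * (- (2 * a) * J1 z + - z * J z) - z / (2 * a) * J z by field.
  by rewrite h mulr0 sub0r mulNr.
pose H z := J z * expR (z ^+ 2 / (4 * a)).
have dH (z : R) : is_derive z 1 H 0.
  have := dJ z; rewrite J1E => dJz.
  apply: is_derive_eq; rewrite /GRing.scale/=.
  by field; rewrite gt_eqF.
have /(_ y 0) := @is_derive_0_is_cst _ H; rewrite /H => /(_ dH).
rewrite expr0n mul0r expR0 mulr1 => E.
have -> : gauss_mass a * cos x = J 0.
  rewrite /J; under eq_Rintegral do rewrite mul0r subr0.
  rewrite RintegralZr//; last exact: integrable_gauss.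
  by rewrite /Rintegral integral_gauss.
by rewrite -E expRN mulfK// gt_eqF ?expR_gt0.
Qed.

End gauss_fourier.

(** * The Hilbert transform of a modulated Gaussian along a line *)

Section hilbert_kernel.
Context {R : realType}.
Local Notation mu := (@lebesgue_measure R).
Implicit Types (a b c t u v x y : R) (f g : R -> R).

Lemma measurable_inv : measurable_fun [set: R] (@GRing.inv R).
Proof.
have -> : @GRing.inv R = fun t => t * (t ^+ 2) `^ (-1).
  apply/funext => t; rewrite powR_inv1 ?sqr_ge0//.
  by have [->|t0] := eqVneq t 0; [rewrite invr0 mul0r | field].
apply: measurable_funM => //.
by apply: (measurableT_comp (measurable_powR _)); exact: measurable_funX.
Qed.

(** The profile of exp (- |x|^2) on the line x - t v, relative to its value at x, for a unit vector
    v and b = x.v. *)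
Definition tilt b t : R := expR (2 * b * t - t ^+ 2).

Lemma tiltE b t : tilt b t = expR (b ^+ 2) * expR (- (1 * (t - b) ^+ 2)).
Proof. by rewrite /tilt -expRD; congr expR; ring. Qed.

(* The subtracted term is odd in t after division by t, so it does not change
   the principal value, but it removes the singularity at 0. *)
Definition pv_kernel b y x t : R :=
  (tilt b t * cos (x - y * t) - tilt 0 t * cos x) / t.

Definition pv_gauss b y x : R := \int[mu]_t pv_kernel b y x t.

(** From [0 <= (2 * b - t) ^+ 2]. Uniformity over [b] is what differentiation in [b] under the
    integral requires. *)
Lemma tilt_le b c t : `|b| <= c ->
  tilt b t <= expR (2 * c ^+ 2) * expR (- (2^-1 * (t - 0) ^+ 2)).
Proof.
move=> bc; rewrite /tilt -expRD ler_expR subr0.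
have h : b ^+ 2 <= c ^+ 2 by rewrite -[b ^+ 2]real_normK ?num_real// lerXn2r ?nnegrE// (le_trans _ bc).
have := sqr_ge0 (2 * b - t); nra.
Qed.

Lemma tilt_ge0 b t : 0 <= tilt b t. Proof. exact: expR_ge0. Qed.

Lemma continuous_tilt_trig b x y : continuous (fun t => tilt b t * cos (x - y * t)).
Proof.
apply: (@is_derive_continuous _ (fun t => tilt b t * ((2 * b - 2 * t) * cos (x - y * t) + y * sin (x - y * t)))) => t.
by rewrite /tilt; apply: is_derive_eq; rewrite /GRing.scale/=; ring.
Qed.

Lemma measurable_pv_kernel b y x : measurable_fun setT (pv_kernel b y x).
Proof.
apply: measurable_funM; last exact: measurable_inv.
apply: measurable_funB; apply: continuous_measurable_fun.
  exact: continuous_tilt_trig.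
have := @continuous_tilt_trig 0 x 0; rewrite (_ : (fun t => _) = (fun t => tilt 0 t * cos x))//.
by apply/funext => t; rewrite mul0r subr0.
Qed.

(** The parameters [(s * b, s * y)] join the subtracted term, at [s = 0], to the main one, at
    [s = 1]. The derivative in [s] carries a factor [t], which the mean value theorem plays against
    the denominator. *)
Lemma pv_kernel_bound b y x t : `|pv_kernel b y x t| <=
  (2 * `|b| + `|y|) * (expR (2 * b ^+ 2) * expR (- (2^-1 * (t - 0) ^+ 2))).
Proof.
have c0 : 0 <= (2 * `|b| + `|y|) * (expR (2 * b ^+ 2) * expR (- (2^-1 * (t - 0) ^+ 2))).
  by rewrite !mulr_ge0 ?expR_ge0// addr_ge0// mulr_ge0.
rewrite /pv_kernel; have [->|t0] := eqVneq t 0; first by rewrite invr0 mulr0 normr0 subrr expr0n/= mulr0 oppr0 expR0 mulr1 mulr_ge0 ?expR_ge0 ?addr_ge0 ?mulr_ge0.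
pose phi (s : R) := tilt (s * b) t * cos (x - s * y * t).
pose dphi (s : R) := t * (tilt (s * b) t * (2 * b * cos (x - s * y * t) + y * sin (x - s * y * t))).
have dphiP (s : R) : is_derive s 1 phi (dphi s).
  by rewrite /phi /tilt; apply: is_derive_eq; rewrite /dphi /tilt /GRing.scale/=; ring.
have [|s s01] := @MVT _ phi dphi 0 1 ltr01 (fun s _ => dphiP s).
  by apply: continuous_subspaceT; exact: is_derive_continuous dphiP.
rewrite subr0 mulr1 {1 2}/phi !mul1r !mul0r subr0 => ->.
rewrite /dphi mulrC mulKf// mulrC normrM (ger0_norm (tilt_ge0 _ _)).
move: s01; rewrite in_itv/= => /andP[s0 s1].
apply: ler_pM => //; first exact: tilt_ge0.
  apply: (le_trans (ler_normD _ _)); apply: lerD; rewrite !normrM.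
    by rewrite ger0_norm// -[leRHS]mulr1 ler_wpM2l ?mulr_ge0// norm_cos_le1.
  by rewrite -[leRHS]mulr1 ler_wpM2l// norm_sin_le1.
have := @tilt_le (s * b) `|b| t; rewrite real_normK ?num_real//; apply.
by rewrite normrM ger0_norm ?(ltW s0)// ler_piMl// ltW.
Qed.

Lemma integrable_half_gauss c : mu.-integrable setT
  (EFin \o (fun t => c * expR (- (2^-1 * (t - 0) ^+ 2)))).
Proof.
exact: (@integrableZl _ _ _ mu _ measurableT c _ (integrable_gauss 0 _)).
Qed.

Lemma integrable_pv_kernel b y x : mu.-integrable setT (EFin \o pv_kernel b y x).
Proof.
apply: le_integrable (integrable_half_gauss ((2 * `|b| + `|y|) * expR (2 * b ^+ 2))) => //.
  by apply/measurable_EFinP; exact: measurable_pv_kernel.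
move=> t _ /=; rewrite lee_fin -mulrA (le_trans (pv_kernel_bound b y x t))//.
exact: ler_norm.
Qed.

Lemma integral_tilt b y x :
  \int[mu]_t (tilt b t * cos (x - y * t))
  = expR (b ^+ 2) * (gauss_mass 1 * cos (x - y * b) * expR (- (y ^+ 2 / 4))).
Proof.
have := @gauss_fourier R 1 b (x - y * b) y ltr01; rewrite mulr1 => <-.
rewrite -RintegralZl//; last first.
  apply: (@integrable_gauss_cos _ 1 b _ 1) => //.
    apply: (@is_derive_continuous _ (fun t => y * sin (x - y * b - y * (t - b)))) => t.
    by apply: is_derive_eq; rewrite /GRing.scale/=; ring.
  by move=> t; rewrite mul1r (le_trans (norm_cos_le1 _))// lerDl.
apply: eq_Rintegral => t _; rewrite tiltE [RHS]mulrA; congr (_ * cos _); ring.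
Qed.

(** Differentiation in [b] brings down a factor [2 * t] that cancels the denominator and leaves the
    Fourier integral [integral_tilt]. *)
Lemma is_derive_pv_gauss_tilt b y x : is_derive b 1 (fun b => pv_gauss b y x)
  (2 * expR (b ^+ 2) * (gauss_mass 1 * cos (x - y * b) * expR (- (y ^+ 2 / 4)))).
Proof.
(* The quotient by [t] is kept so that [df] is the derivative of the kernel at [t = 0] too, where
   both are 0. *)
pose df (b t : R) := (2 * t * (tilt b t * cos (x - y * t))) / t.
pose M := 2 * expR (2 * (`|b| + 1) ^+ 2).
have ub c t : b - 1 < c < b + 1 -> 2 * tilt c t <= M * expR (- (2^-1 * (t - 0) ^+ 2)).
  move=> /andP[c1 c2]; rewrite /M -mulrA ler_wpM2l//; apply: tilt_le.
  by rewrite ler_norml; have := ler_norm b; have := ler_norm (- b); rewrite normrN; lra.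
have h2 c t : b - 1 < c < b + 1 -> `|2 * (tilt c t * cos (x - y * t))| <= M * expR (- (2^-1 * (t - 0) ^+ 2)).
  move=> hc; apply: le_trans (ub _ _ hc).
  rewrite mulrA normrM -[leRHS]mulr1 ger0_norm ?mulr_ge0 ?tilt_ge0//.
  by rewrite ler_wpM2l ?mulr_ge0 ?tilt_ge0// norm_cos_le1.
have bb : b - 1 < b < b + 1 by rewrite ltrBlDr !ltrDl ltr01.
have mc : measurable_fun setT (fun t => 2 * (tilt b t * cos (x - y * t))).
  by apply: measurable_funM => //; apply: continuous_measurable_fun; exact: continuous_tilt_trig.
have int2 : mu.-integrable setT (EFin \o (fun t => 2 * (tilt b t * cos (x - y * t)))).
  apply: le_integrable (integrable_half_gauss M) => //; first exact/measurable_EFinP.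
  by move=> t _ /=; rewrite lee_fin (le_trans (h2 _ _ bb))// ler_norm.
have intt : mu.-integrable setT (EFin \o (fun t => tilt b t * cos (x - y * t))).
  have := @integrableZl _ _ _ mu _ measurableT 2^-1 _ int2; apply: eq_integrable => // t _ /=.
  by rewrite -EFinM; congr EFin; field.
have -> : 2 * expR (b ^+ 2) * (gauss_mass 1 * cos (x - y * b) * expR (- (y ^+ 2 / 4))) = \int[mu]_t df b t.
  rewrite -mulrA -integral_tilt -RintegralZl//; apply: ae_eq_Rintegral_neq0 => //.
    by apply: measurable_funM; [rewrite /=; under eq_fun do rewrite -mulrA mulrCA; apply: measurable_funM | exact: measurable_inv].
  by move=> t t0; rewrite /df; field.
apply: (@is_derive_under_integral _ (fun b => pv_kernel b y x) df (fun t => M * expR (- (2^-1 * (t - 0) ^+ 2))) b (b - 1) (b + 1)) => //.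
- by move=> c _; exact: integrable_pv_kernel.
- move=> c t; rewrite /pv_kernel /tilt; apply: is_derive_eq.
  by rewrite /df /tilt /GRing.scale/=; ring.
- exact: integrable_half_gauss.
- move=> c t hc; rewrite /df; have [->|t0] := eqVneq t 0.
    by rewrite invr0 mulr0 normr0 mulr_ge0 ?expR_ge0 ?mulr_ge0 ?expR_ge0.
  have -> : 2 * t * (tilt c t * cos (x - y * t)) / t = 2 * (tilt c t * cos (x - y * t)) by field.
  exact: h2.
Qed.

End hilbert_kernel.

(** * Principal values, and their limit at high frequency *)

Section hilbert_limit.
Context {R : realType}.
Local Notation mu := (@lebesgue_measure R).
Implicit Types (a b c t u v x y : R) (f g : R -> R).

Lemma is_derive_ge0_le (F f : R -> R) u v : (forall t, is_derive t 1 F (f t)) ->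
  (forall t, 0 <= f t) -> u <= v -> F u <= F v.
Proof.
move=> dF f0; rewrite le_eqVlt => /predU1P[->//|uv].
have [|c _ E] := @MVT _ F f u v uv (fun t _ => dF t).
  by apply: continuous_subspaceT; exact: is_derive_continuous dF.
by rewrite -subr_ge0 E mulr_ge0// subr_ge0 ltW.
Qed.

Lemma is_derive_pv_gauss_freq y x : is_derive y 1 (fun y => pv_gauss 0 y x)
  (gauss_mass 1 * sin x * expR (- (y ^+ 2 / 4))).
Proof.
pose df (y t : R) := (t * (tilt 0 t * sin (x - y * t))) / t.
have E t z : tilt 0 t * sin (x - z * t) = tilt 0 t * cos (x - pi / 2 - z * t).
  by congr (_ * _); rewrite -cosBpihalf; congr cos; ring.
have tilt0 t : tilt 0 t <= 1 * expR (- (2^-1 * (t - 0) ^+ 2)).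
  by have := @tilt_le R 0 0 t; rewrite normr0 expr0n/= mulr0 expR0; apply.
have h2 z t : `|tilt 0 t * sin (x - z * t)| <= 1 * expR (- (2^-1 * (t - 0) ^+ 2)).
  apply: le_trans (tilt0 t).
  rewrite normrM -[leRHS]mulr1 ger0_norm ?tilt_ge0//.
  by rewrite ler_wpM2l ?tilt_ge0// norm_sin_le1.
have mc : measurable_fun setT (fun t => tilt 0 t * sin (x - y * t)).
  apply: continuous_measurable_fun; under eq_fun do rewrite E.
  exact: continuous_tilt_trig.
have int2 : mu.-integrable setT (EFin \o (fun t => tilt 0 t * sin (x - y * t))).
  apply: le_integrable (integrable_half_gauss 1) => //; first exact/measurable_EFinP.
  by move=> t _ /=; rewrite lee_fin (le_trans (h2 _ _))// ler_norm.
have -> : gauss_mass 1 * sin x * expR (- (y ^+ 2 / 4)) = \int[mu]_t df y t.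
  transitivity (\int[mu]_t (tilt 0 t * sin (x - y * t))).
    under eq_Rintegral do rewrite E.
    by rewrite integral_tilt expr0n/= expR0 mul1r mulr0 subr0 cosBpihalf.
  apply: ae_eq_Rintegral_neq0 => //.
    apply: measurable_funM; last exact: measurable_inv.
    exact: measurable_funM.
  by move=> t t0; rewrite /df; field.
apply: (@is_derive_under_integral _ (fun y => pv_kernel 0 y x) df (fun t => 1 * expR (- (2^-1 * (t - 0) ^+ 2))) y (y - 1) (y + 1)) => //.
- by rewrite ltrBlDr !ltrDl ltr01.
- by move=> c _; exact: integrable_pv_kernel.
- move=> c t; rewrite /pv_kernel /tilt; apply: is_derive_eq.
  by rewrite /df /tilt /GRing.scale/=; ring.
- exact: integrable_half_gauss.
- move=> c t hc; rewrite /df; have [->|t0] := eqVneq t 0.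
    by rewrite invr0 mulr0 normr0 mulr_ge0 ?expR_ge0.
  have -> : t * (tilt 0 t * sin (x - c * t)) / t = tilt 0 t * sin (x - c * t) by field.
  exact: h2.
Qed.

(** The integral of exp (- t^2) sin (y t) / t. Its derivative in y is a Gaussian, so it is an error
    function up to normalisation. *)
Definition gauss_erf y : R := pv_gauss 0 y (pi / 2).

Lemma is_derive_gauss_erf y :
  is_derive y 1 gauss_erf (gauss_mass 1 * expR (- (y ^+ 2 / 4))).
Proof. by have := is_derive_pv_gauss_freq y (pi / 2); rewrite sin_pihalf mulr1. Qed.

Lemma pv_gauss00 x : pv_gauss 0 0 x = 0.
Proof.
rewrite /pv_gauss; under eq_Rintegral do rewrite /pv_kernel mul0r subr0 subrr mul0r.
by rewrite Rintegral_cst// mul0r.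
Qed.

Lemma pv_gauss0E y x : pv_gauss 0 y x = sin x * gauss_erf y.
Proof.
pose D (y : R) := pv_gauss 0 y x - sin x * gauss_erf y.
have dD (z : R) : is_derive z 1 D 0.
  have h1 := is_derive_pv_gauss_freq z x; have h2 := is_derive_gauss_erf z.
  by apply: is_derive_eq; rewrite /GRing.scale/=; ring.
have := is_derive_0_is_cst y 0 dD.
rewrite /D /gauss_erf !pv_gauss00 mulr0 subr0 => /eqP.
by rewrite subr_eq0 => /eqP.
Qed.

Lemma gauss_erf0 : gauss_erf 0 = 0. Proof. exact: pv_gauss00. Qed.

Lemma gauss_erfN y : gauss_erf (- y) = - gauss_erf y.
Proof.
pose D (y : R) := gauss_erf (- y) + gauss_erf y.
have dD (z : R) : is_derive z 1 D 0.
  have h1 := is_derive_gauss_erf z; have h2 := is_derive_gauss_erf (- z).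
  by apply: is_derive_eq; rewrite /GRing.scale/= sqrrN; ring.
have := is_derive_0_is_cst y 0 dD.
by rewrite /D oppr0 gauss_erf0 addr0 => /eqP; rewrite addr_eq0 => /eqP.
Qed.

(** Since [gauss_erf] increases, this is its limit at +oo: the Dirichlet integral of sin t / t over
    the line. *)
Definition pv_const : R := sup (range (fun y => gauss_erf y)).

Lemma gauss_erf_ndecr u v : u <= v -> gauss_erf u <= gauss_erf v.
Proof.
apply: is_derive_ge0_le is_derive_gauss_erf _ => t.
by rewrite mulr_ge0 ?expR_ge0// ltW// gauss_mass_gt0.
Qed.

(** Comparison of derivatives: by [1 + z <= expR z] the Gaussian exp (- y^2 / 4) lies below 1 / (1 +
    (y / 2)^2), the derivative of [2 * atan (y / 2)]. *)
Lemma gauss_erf_le y : gauss_erf y <= gauss_mass 1 * pi.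
Proof.
have K0 : 0 < gauss_mass 1 :> R by exact: gauss_mass_gt0.
have [y0|y0] := leP y 0.
  rewrite (le_trans (gauss_erf_ndecr y0))// gauss_erf0.
  by rewrite mulr_ge0 ?pi_ge0// ltW.
pose D (y : R) := 2 * gauss_mass 1 * atan (y / 2) - gauss_erf y.
have dD (z : R) : is_derive z 1 D (gauss_mass 1 * ((1 + (z / 2) ^+ 2)^-1 - expR (- (z ^+ 2 / 4)))).
  have h1 := is_derive_gauss_erf z.
  by apply: is_derive_eq; rewrite /GRing.scale/=; field; nra.
have h : 0 <= D y.
  have -> : 0 = D 0 by rewrite /D mul0r atan0 mulr0 gauss_erf0 subrr.
  apply: (is_derive_ge0_le dD) (ltW y0) => z; rewrite mulr_ge0 ?(ltW K0)//.
  rewrite subr_ge0 expRN lef_pV2 ?posrE ?expR_gt0//; last first.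
    by rewrite ltr_pwDl// sqr_ge0.
  have -> : (z / 2) ^+ 2 = z ^+ 2 / 4 by field.
  exact: expR_ge1Dx.
move: h; rewrite /D subr_ge0 => /le_trans; apply.
rewrite [2 * _]mulrC -mulrA ler_wpM2l ?(ltW K0)//.
by have := atan_ltpi2 (y / 2); lra.
Qed.

Lemma gauss_erf_ubound : has_ubound (range (fun y => gauss_erf y)).
Proof. by exists (gauss_mass 1 * pi) => _ [y _ <-]; exact: gauss_erf_le. Qed.

Lemma cvg_gauss_erf : gauss_erf y @[y --> +oo] --> pv_const.
Proof.
by apply: nondecreasing_cvgr gauss_erf_ubound => u v; exact: gauss_erf_ndecr.
Qed.

Lemma pv_const_gt0 : 0 < pv_const.
Proof.
apply: (@lt_le_trans _ _ (gauss_erf 1)); last first.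
  by apply: ub_le_sup; [exact: gauss_erf_ubound | exists 1].
have [|c _] := @MVT _ gauss_erf _ 0 1 ltr01 (fun t _ => is_derive_gauss_erf t).
  by apply: continuous_subspaceT; exact: is_derive_continuous is_derive_gauss_erf.
rewrite gauss_erf0 !subr0 mulr1 => ->.
by rewrite mulr_gt0 ?expR_gt0// gauss_mass_gt0.
Qed.

(** Mean value theorem in the tilt, from 0 to [b]. The derivative contains exp (- y^2 / 4), so the
    tilt has no influence in the high frequency limit. *)
Lemma pv_gauss_bound b y x :
  `|pv_gauss b y x - sin x * gauss_erf y| <=
  2 * gauss_mass 1 * (`|b| * expR (b ^+ 2)) * expR (- (y ^+ 2 / 4)).
Proof.
have K0 : 0 <= gauss_mass 1 :> R by rewrite ltW// gauss_mass_gt0.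
pose phi (s : R) := pv_gauss (s * b) y x.
pose dphi (s : R) := b * (2 * expR ((s * b) ^+ 2) * (gauss_mass 1 * cos (x - y * (s * b)) * expR (- (y ^+ 2 / 4)))).
have dphiP (s : R) : is_derive s 1 phi (dphi s).
  have h := is_derive_pv_gauss_tilt (s * b) y x.
  have hb : is_derive s 1 (fun s => s * b) b.
    by apply: is_derive_eq; rewrite /GRing.scale/=; ring.
  by have := @is_derive1_comp _ (fun b => pv_gauss b y x) (fun s => s * b) s _ _ h hb; rewrite mulrC.
rewrite -pv_gauss0E.
have [|s s01] := @MVT _ phi dphi 0 1 ltr01 (fun s _ => dphiP s).
  by apply: continuous_subspaceT; exact: is_derive_continuous dphiP.
rewrite subr0 mulr1 /phi mul1r mul0r => ->.
move: s01; rewrite in_itv/= => /andP[s0 s1].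
rewrite /dphi !normrM !(ger0_norm (expR_ge0 _)) (ger0_norm K0) (ger0_norm (ler0n _ 2)).
have h1 : `|cos (x - y * (s * b))| <= 1 by exact: norm_cos_le1.
have h2 : expR ((s * b) ^+ 2) <= expR (b ^+ 2).
  rewrite ler_expR exprMn -[leRHS]mul1r ler_wpM2r ?sqr_ge0//.
  by rewrite expr_le1 ?ltW.
have -> : 2 * gauss_mass 1 * (`|b| * expR (b ^+ 2)) * expR (- (y ^+ 2 / 4)) =
 `|b| * (2 * expR (b ^+ 2) * (gauss_mass 1 * 1 * expR (- (y ^+ 2 / 4)))) by ring.
apply: ler_wpM2l => //; apply: ler_pM; rewrite ?mulr_ge0 ?expR_ge0//.
  by rewrite ler_wpM2l.
by rewrite ler_wpM2r ?expR_ge0// ler_wpM2l.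
Qed.

Lemma setC_norm_gt c : ~` [set t : R | c < `|t|] = `[- c, c]%classic.
Proof.
by apply/seteqP; split=> t /=; rewrite in_itv/= -ler_norml leNgt => /negP.
Qed.

Lemma measurable_norm_gt c : measurable ([set t | c < `|t|] : set (measurableTypeR R)).
Proof.
rewrite -(setCK [set t : R | c < `|t|]) setC_norm_gt.
by apply: measurableC; exact: measurable_itv.
Qed.

Lemma integrable_tilt0_div c (A : set R) : 0 < c -> measurable A ->
  A `<=` [set t | c <= `|t|] -> mu.-integrable A (EFin \o (fun t => tilt 0 t / t)).
Proof.
move=> c0 mA Ac; apply: (@le_integrable _ _ _ mu A mA _ (EFin \o (fun t => c^-1 * expR (- (2^-1 * (t - 0) ^+ 2))))).
- apply/measurable_EFinP; apply: measurable_funTS; apply: measurable_funM.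
    have := @continuous_tilt_trig R 0 0 0; under eq_fun do rewrite mul0r subr0 cos0 mulr1.
    exact: continuous_measurable_fun.
  exact: measurable_inv.
- move=> t /Ac /= ct; rewrite lee_fin normrM [leRHS]ger0_norm ?mulr_ge0 ?expR_ge0 ?invr_ge0 ?(ltW c0)//.
  rewrite mulrC normfV ler_pM ?invr_ge0//.
    by rewrite lef_pV2 ?posrE// (lt_le_trans c0).
  rewrite ger0_norm ?tilt_ge0//.
  by have := @tilt_le R 0 0 t; rewrite normr0 expr0n/= mulr0 expR0 mul1r; apply.
- by apply: (@integrableS _ _ _ mu setT A _ _ _ (@subsetT _ _) (integrable_half_gauss c^-1)).
Qed.

(** The integrand is odd. The substitution [t -> - t] is applied to its negative, which is
    nonnegative on the left half-line. *)
Lemma integral_tilt0_pv c : 0 < c ->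
  \int[mu]_(t in [set t | c < `|t|]) (tilt 0 t / t) = 0.
Proof.
move=> c0; pose g t := tilt 0 t / t.
have setE : [set t : R | c < `|t|] = `]-oo, - c[%classic `|` `]c, +oo[%classic.
  apply/seteqP; split=> t /=; rewrite !in_itv/= andbT.
    by rewrite lter_normr => /orP[|]; [right|left; rewrite ltrNr].
  by rewrite lter_normr => -[tc|->//]; rewrite [X in _ || X]ltrNr tc orbT.
have intN : mu.-integrable `]-oo, - c]%classic (EFin \o g).
  apply: (integrable_tilt0_div c0) => // t /=; rewrite in_itv/= => tc.
  by rewrite ler_normr lerNr tc orbT.
have intP : mu.-integrable `[c, +oo[%classic (EFin \o g).
  apply: (integrable_tilt0_div c0) => // t /=; rewrite in_itv/= andbT => tc.
  by rewrite ler_normr tc.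
rewrite setE Rintegral_setU//; last 2 first.
- rewrite -setE; apply: (integrable_tilt0_div c0); first exact: measurable_norm_gt.
  by move=> t /= /ltW.
- apply/disj_setPS => t [] /=; rewrite !in_itv/= andbT => h1 h2.
  lra.
rewrite Rintegral_itv_bndo_bndc; last first.
  by apply: integrableS intN => //; apply: subset_itvl; rewrite bnd_simp.
rewrite Rintegral_itv_obnd_cbnd; last first.
  by apply: integrableS intP => //; apply: subset_itvr; rewrite bnd_simp.
apply/eqP; rewrite addrC addr_eq0; apply/eqP.
have h : (\int[mu]_(t in `]-oo, (- c)%R]) (- g t)%:E =
   \int[mu]_(t in `[c, +oo[) (g t)%:E)%E.
  rewrite (@ge0_integration_by_substitutionNy _ (fun t => - g t) c).
  - apply: eq_integral => t _ /=; congr EFin.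
    rewrite /g /tilt sqrrN mulr0 !mul0r invrN; ring.
  - apply: continuous_in_subspaceT => t; rewrite inE/= in_itv/= => tc.
    have t0 : t != 0 by rewrite lt_eqF// (le_lt_trans tc)// oppr_lt0.
    apply: (@cvgN _ R^o); apply: (@cvgM _ R^o).
      have := @continuous_tilt_trig R 0 0 0.
      by under eq_fun do rewrite mul0r subr0 cos0 mulr1; exact.
    exact: inv_continuous.
  - move=> t; rewrite in_itv/= => tc; rewrite oppr_ge0.
    by rewrite /g mulr_ge0_le0 ?tilt_ge0// invr_le0 ltW// (lt_trans tc)// oppr_lt0.
rewrite -mulN1r -RintegralZl// /Rintegral -h; congr fine.
by apply: eq_integral => t _; rewrite mulN1r.
Qed.

(** Off [[- eps, eps]] the integrand differs from [pv_kernel] by an odd function of integral 0. The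
    kernel is bounded by [M], so the piece cut out is at most [M * (2 * eps)]. *)
Lemma pv_gauss_cvg b y x :
  \int[mu]_(t in [set t | eps < `|t|]) (tilt b t * cos (x - y * t) / t)
    @[eps --> 0^'+] --> pv_gauss b y x.
Proof.
pose D (eps : R) : set R := [set t | eps < `|t|].
have DE (eps : R) : ~` D eps = `[- eps, eps]%classic by exact: setC_norm_gt.
have mD (eps : R) : measurable (D eps) by exact: measurable_norm_gt.
have mDC (eps : R) : measurable (~` D eps) by exact: measurableC.
pose k := pv_kernel b y x; pose g t := tilt 0 t / t.
have intk : mu.-integrable setT (EFin \o k) by exact: integrable_pv_kernel.
have intkS A : measurable A -> mu.-integrable A (EFin \o k).
  by move=> mA; apply: integrableS intk.
pose M := (2 * `|b| + `|y|) * expR (2 * b ^+ 2).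
have M0 : 0 <= M by rewrite mulr_ge0 ?expR_ge0// addr_ge0// mulr_ge0.
have kM t : `|k t| <= M.
  rewrite (le_trans (pv_kernel_bound b y x t))// mulrA -[leRHS]mulr1 ler_wpM2l//.
  by rewrite -[leRHS]expR0 ler_expR oppr_le0 mulr_ge0// sqr_ge0.
have intg (eps : R) : 0 < eps -> mu.-integrable (D eps) (EFin \o g).
  by move=> e0; apply: (integrable_tilt0_div e0) => // t /= /ltW.
have E (eps : R) : 0 < eps -> \int[mu]_(t in D eps) (tilt b t * cos (x - y * t) / t) =
    pv_gauss b y x - \int[mu]_(t in ~` D eps) k t.
  move=> e0; transitivity (\int[mu]_(t in D eps) k t).
    transitivity (\int[mu]_(t in D eps) (k t + cos x * g t)).
      by apply: eq_Rintegral => t _; rewrite /k /g /pv_kernel; ring.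
    rewrite RintegralD//.
    - rewrite RintegralZl; [|exact: mD|exact: intg].
      by rewrite [X in cos x * X](integral_tilt0_pv e0) mulr0 addr0.
    - exact: mD.
    - by apply: intkS; exact: mD.
    - exact: (@integrableZl _ _ _ mu _ (mD eps) (cos x) _ (intg _ e0)).
  apply/eqP; rewrite eq_sym subr_eq; apply/eqP.
  rewrite -Rintegral_setU; first by rewrite setUv.
  - exact: mD.
  - exact: mDC.
  - by rewrite setUv.
  - by apply/disj_setPS; rewrite setICr.
have M1 : 0 < 2 * M + 1 by lra.
apply/cvgrPdist_le => /= e e0; near=> eps.
have eps0 : 0 < eps by near: eps; exact: nbhs_right_gt.
rewrite E// subKr.
have epsM : M * (2 * eps) <= e.
  have : eps <= e / (2 * M + 1).
    by near: eps; apply: nbhs_right_ltW; exact: divr_gt0.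
  by rewrite ler_pdivlMr//; nra.
apply: le_trans epsM.
apply: (le_trans (le_normr_Rintegral _ (intkS _ (mDC eps)))) => //.
  exact: mDC.
have muD : mu (~` D eps) = (2 * eps)%:E.
  rewrite DE lebesgue_measure_itv/= lte_fin ifT ?EFinN -?EFinB; first by congr EFin; ring.
  by rewrite gtrN.
rewrite -[leRHS]/(fine (M * (2 * eps))%:E) EFinM -muD -integral_cst; last exact: mDC.
apply: le_Rintegral => //.
- exact: mDC.
- by have := integrable_abse (intkS _ (mDC eps)).
- apply: measurable_bounded_integrable => //; first exact: mDC.
    by apply: (eq_ind_r (fun z => (z < +oo)%E) _ muD); rewrite ltry.
  exact: bounded_cst.
Unshelve. all: end_near. Qed.

End hilbert_limit.

(** * Gaussian means of trigonometric polynomials *)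

Section integral_Rn.
Context {R : realType}.
Local Notation mR := (measurableTypeR R).

Lemma sigma_finite_lebesgue_Rn n : sigma_finite [set: n.-tuple mR] (lebesgue_Rn n).
Proof.
pose A k : set mR := `[- k%:R, k%:R]%classic.
have mA k : measurable (A k) by exact: measurable_itv.
exists (fun k => [set t : n.-tuple mR | forall i, A k (tnth t i)]).
  apply/esym; rewrite -subTset => t _.
  pose M : R := \sum_(i < n) `|tnth t i|.
  exists (Num.truncn M).+1 => // i; rewrite /A /= in_itv/= -ler_norml.
  apply: (@le_trans _ _ M); last by rewrite ltW// truncnS_gt.
  by rewrite /M (bigD1 i)//= lerDl sumr_ge0.
move=> k; split.
  rewrite (_ : [set t | _] = \bigcap_i ((fun t : n.-tuple mR => tnth t i) @^-1` A k)).
    apply: fin_bigcap_measurable => // i _.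
    by rewrite -[X in measurable X]setTI; exact: measurable_tnth.
  by apply/seteqP; split => [t h i _|t h i]; exact: h.
rewrite (lebesgue_Rn_box (fun=> mA k)).
rewrite (_ : (\prod_(i < n) _)%E = (\prod_(i < n) (fine (lebesgue_measure (A k))))%R%:E) ?ltry//.
have fA : lebesgue_measure (A k) \is a fin_num.
  rewrite /A /= lebesgue_measure_itv/=; case: ifP => // _.
by elim/big_ind2: _ => // [x a y b -> ->|i _]; rewrite ?EFinM ?fineK.
Qed.

(* A copy of lebesgue_Rn carrying the sigma-finiteness that Tonelli needs. *)
Definition volume n : set (n.-tuple mR) -> \bar R := lebesgue_Rn n.

Section volume_measure.
Context (n : nat).
Let volume0 : @volume n set0 = 0%E. Proof. exact: measure0. Qed.
Let volume_ge0 A : (0 <= @volume n A)%E. Proof. exact: measure_ge0. Qed.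
Let volume_sigma_additive : semi_sigma_additive (@volume n).
Proof. exact: measure_semi_sigma_additive. Qed.
HB.instance Definition _ := isMeasure.Build _ _ _ (@volume n)
  volume0 volume_ge0 volume_sigma_additive.
HB.instance Definition _ := Measure_isSigmaFinite.Build _ _ _ (@volume n)
  (@sigma_finite_lebesgue_Rn n).
End volume_measure.

Lemma ge0_integral_cons n (f : n.+1.-tuple mR -> \bar R) :
  measurable_fun setT f -> (forall t, 0 <= f t)%E ->
  (\int[lebesgue_Rn n.+1]_t f t
   = \int[lebesgue_Rn n]_t \int[lebesgue_measure]_x f (cons_pair (t, x)))%E.
Proof.
move=> mf f0.
have -> : (\int[lebesgue_Rn n.+1]_t f t =
  \int[pushforward (lebesgue_Rn n \x lebesgue_measure)%E (@cons_pair R n)]_t f t)%E.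
  by [].
rewrite (ge0_integral_pushforward (@measurable_cons_pair R n))//.
rewrite preimage_setT.
pose g := f \o @cons_pair R n.
have mg : measurable_fun setT g by apply: measurableT_comp => //; exact: measurable_cons_pair.
exact: (@fubini_tonelli1 _ _ _ _ _ (@volume n) (@lebesgue_measure R) g mg (fun z => f0 _)).
Qed.

Lemma measurable_sum_tnth n (h : 'I_n -> R) :
  measurable_fun setT (fun t : n.-tuple mR => \sum_(i < n) h i * tnth t i).
Proof. by apply: measurable_sum => i; apply: measurable_funM => //; exact: measurable_tnth. Qed.

Lemma measurable_gauss_Rn n (a : R) :
  measurable_fun setT (fun t : n.-tuple mR => expR (- (a * \sum_(i < n) tnth t i ^+ 2))).
Proof.
apply: measurableT_comp => //; apply: measurable_funN; apply: measurable_funM => //.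
by apply: measurable_sum => i; apply: measurable_funX; exact: measurable_tnth.
Qed.

(* Adding the constant A keeps the integrand nonnegative, as Tonelli requires. *)
Lemma integral_gauss_wave n (a : R) (h : 'I_n -> R) (phi A B : R) :
  0 < a -> 0 <= B -> B <= A ->
  (\int[lebesgue_Rn n]_t (expR (- (a * \sum_(i < n) tnth t i ^+ 2)) *
      (A + B * cos (\sum_(i < n) h i * tnth t i + phi)))%:E
   = (gauss_mass a ^+ n * (A + B * cos phi * \prod_(i < n) expR (- (h i ^+ 2 / (4 * a)))))%:E)%E.
Proof.
move=> a0; elim: n h phi A B => [|n IHn] h phi A B B0 BA.
  rewrite integral_dirac//; last first.
    apply/measurable_EFinP; apply: measurable_funM; first exact: measurable_gauss_Rn.
    apply: measurable_funD => //; apply: measurable_funM => //.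
    apply: measurableT_comp; first exact: continuous_measurable_fun (@continuous_cos R).
    by apply: measurable_funD => //; exact: measurable_sum_tnth.
  by rewrite diracT mul1e !big_ord0 mulr0 oppr0 expR0 add0r mulr1.
have K0 : 0 < gauss_mass a by exact: gauss_mass_gt0.
rewrite ge0_integral_cons; last 2 first.
- apply/measurable_EFinP; apply: measurable_funM; first exact: measurable_gauss_Rn.
  apply: measurable_funD => //; apply: measurable_funM => //.
  apply: measurableT_comp; first exact: continuous_measurable_fun (@continuous_cos R).
  by apply: measurable_funD => //; exact: measurable_sum_tnth.
- move=> t; rewrite lee_fin mulr_ge0 ?expR_ge0//.
  by have := cos_geN1 (\sum_(i < n.+1) h i * tnth t i + phi); nra.
pose h' i := h (lift ord0 i).
pose e := expR (- (h ord0 ^+ 2 / (4 * a))).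
(* Integrating out the head coordinate multiplies [A] by the mass and [B] by the mass times
   [e <= 1]; so [B <= A] persists and the induction closes. *)
have inner (t : n.-tuple mR) : (\int[lebesgue_measure]_x
   (expR (- (a * \sum_(i < n.+1) tnth (cons_pair (t, x)) i ^+ 2)) *
      (A + B * cos (\sum_(i < n.+1) h i * tnth (cons_pair (t, x)) i + phi)))%:E)%E
  = (expR (- (a * \sum_(i < n) tnth t i ^+ 2)) *
     (A * gauss_mass a + B * gauss_mass a * e * cos (\sum_(i < n) h' i * tnth t i + phi)))%:E.
  pose g (x : R) := expR (- (a * (x - 0) ^+ 2)).
  pose al := \sum_(i < n) h' i * tnth t i + phi.
  pose w (x : R) := A + B * cos (al - (- h ord0) * (x - 0)).
  pose W := expR (- (a * \sum_(i < n) tnth t i ^+ 2)).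
  have E x : expR (- (a * \sum_(i < n.+1) tnth (cons_pair (t, x)) i ^+ 2)) *
      (A + B * cos (\sum_(i < n.+1) h i * tnth (cons_pair (t, x)) i + phi)) = W * (A * g x + B * (g x * cos (al - (- h ord0) * (x - 0)))).
    rewrite !big_ord_recl !tnth0 /=.
    under eq_bigr do rewrite tnthS.
    under [X in _ + X + phi]eq_bigr do rewrite tnthS.
    rewrite [a * (_ + _)]mulrDr opprD expRD /= /W /g subr0; rewrite /al /h'.
    have -> : h ord0 * x + \sum_(i < n) h (lift ord0 i) * tnth t i + phi =
      \sum_(i < n) h (lift ord0 i) * tnth t i + phi - - h ord0 * x by ring.
    by ring.
  under eq_integral do rewrite E.
  have intg : lebesgue_measure.-integrable setT (EFin \o g) by exact: integrable_gauss.
  have intc : lebesgue_measure.-integrable setT (EFin \o (fun x => g x * cos (al - (- h ord0) * (x - 0)))).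
    apply: (@integrable_gauss_cos _ a 0 _ 1) => //.
      apply: (@is_derive_continuous _ (fun t => (- h ord0) * sin (al - (- h ord0) * (t - 0)))) => x.
      by apply: is_derive_eq; rewrite /GRing.scale/=; ring.
    by move=> x; rewrite mul1r (le_trans (norm_cos_le1 _))// lerDl.
  have int1 := @integrableZl _ _ _ lebesgue_measure _ measurableT A _ intg.
  have int2 := @integrableZl _ _ _ lebesgue_measure _ measurableT B _ intc.
  have int3 := integrableD measurableT int1 int2.
  have int4 := @integrableZl _ _ _ lebesgue_measure _ measurableT W _ int3.
  rewrite -[LHS]fineK; last exact: (integrable_fin_num _ int4).
  congr EFin; rewrite -[LHS]/(\int[lebesgue_measure]_x (W * (A * g x + B * (g x * cos (al - (- h ord0) * (x - 0))))))%R.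
  rewrite RintegralZl// RintegralD// !RintegralZl// gauss_fourier// /Rintegral integral_gauss//= sqrrN /e.
  by rewrite -/al -/W; ring.
under eq_integral do rewrite inner.
rewrite (IHn h'); last 2 first.
- by rewrite !mulr_ge0 ?expR_ge0 ?(ltW K0).
- have e1 : e <= 1.
    by rewrite -[leRHS]expR0 ler_expR oppr_le0 mulr_ge0 ?sqr_ge0// invr_ge0 mulr_ge0// ltW.
  have : B * gauss_mass a * e <= B * gauss_mass a * 1 by rewrite ler_wpM2l// mulr_ge0// ltW.
  by rewrite mulr1 => /le_trans; apply; rewrite ler_wpM2r// ltW.
by rewrite big_ord_recl exprS /e /h'; congr EFin; ring.
Qed.

End integral_Rn.

(** * Trigonometric polynomials on R^n and their Gaussian means *)

Section gaussian_mean.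
Context {R : realType} {n : nat}.
Local Notation Rn := 'rV[R]_n.
Local Notation mR := (measurableTypeR R).
Implicit Types (x y : Rn) (f g T : Rn -> R) (a phi : R).

Definition dotv x y : R := \sum_(i < n) x 0 i * y 0 i.

Lemma dotvDl x y z : dotv (x + y) z = dotv x z + dotv y z.
Proof. by rewrite -big_split; apply: eq_bigr => i _; rewrite mxE mulrDl. Qed.

Lemma dotvZl (c : R) x y : dotv (c *: x) y = c * dotv x y.
Proof. by rewrite mulr_sumr; apply: eq_bigr => i _; rewrite mxE mulrA. Qed.

Lemma dotvC x y : dotv x y = dotv y x.
Proof. by apply: eq_bigr => i _; rewrite mulrC. Qed.

Lemma dotvNl x y : dotv (- x) y = - dotv x y.
Proof. by rewrite -scaleN1r dotvZl mulN1r. Qed.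

Lemma dotvDr x y z : dotv x (y + z) = dotv x y + dotv x z.
Proof. by rewrite dotvC dotvDl !(dotvC x). Qed.

Lemma dotvZr (c : R) x y : dotv x (c *: y) = c * dotv x y.
Proof. by rewrite dotvC dotvZl dotvC. Qed.

Lemma dotvNr x y : dotv x (- y) = - dotv x y.
Proof. by rewrite dotvC dotvNl dotvC. Qed.

Lemma dotv0l x : dotv 0 x = 0.
Proof. by rewrite -[X in dotv X](scale0r 0) dotvZl mul0r. Qed.

Lemma dotv_ge0 x : 0 <= dotv x x.
Proof. by apply: sumr_ge0 => i _; rewrite -expr2 sqr_ge0. Qed.

Lemma enorm_sqr x : enorm x ^+ 2 = dotv x x.
Proof. by rewrite /enorm sqr_sqrtr ?sumr_ge0//; move=> *; rewrite sqr_ge0. Qed.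

Definition gaussian a x : R := expR (- (a * dotv x x)).

(** With a free phase, sines are waves and a product of two waves is a sum of two waves. *)
Definition wave (h : Rn) phi x : R := cos (dotv h x + phi).

Definition wave_sum (s : seq (R * Rn * R)) x : R :=
  \sum_(w <- s) w.1.1 * wave w.1.2 w.2 x.

Definition trigpoly f := exists s, f =1 wave_sum s.

Lemma trigpoly_ext f g : f =1 g -> trigpoly f -> trigpoly g.
Proof. by move=> fg [s fs]; exists s => x; rewrite -fg. Qed.

Lemma trigpoly_wave h phi : trigpoly (wave h phi).
Proof. by exists [:: (1, h, phi)] => x; rewrite /wave_sum big_seq1/= mul1r. Qed.

Lemma trigpolyD f g : trigpoly f -> trigpoly g -> trigpoly (fun x => f x + g x).
Proof. by move=> [s fs] [r gr]; exists (s ++ r) => x; rewrite /wave_sum big_cat/= fs gr. Qed.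

Lemma trigpolyZ (c : R) f : trigpoly f -> trigpoly (fun x => c * f x).
Proof.
move=> [s fs]; exists [seq (c * w.1.1, w.1.2, w.2) | w <- s] => x.
by rewrite /wave_sum big_map fs mulr_sumr; apply: eq_bigr => w _ /=; rewrite mulrA.
Qed.

Lemma trigpoly_cst (c : R) : trigpoly (fun=> c).
Proof.
apply: (trigpoly_ext (f := fun x => c * wave 0 0 x)) => [x|].
  by rewrite /wave dotv0l addr0 cos0 mulr1.
exact/trigpolyZ/trigpoly_wave.
Qed.

Lemma trigpoly_sum (I : Type) (r : seq I) (P : pred I) (F : I -> Rn -> R) :
  (forall i, P i -> trigpoly (F i)) -> trigpoly (fun x => \sum_(i <- r | P i) F i x).
Proof.
move=> tF; elim: r => [|i r IHr].
  by apply: trigpoly_ext (trigpoly_cst 0) => x; rewrite big_nil.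
case Pi: (P i); last by apply: trigpoly_ext IHr => x; rewrite big_cons Pi.
by apply: trigpoly_ext (trigpolyD (tF i Pi) IHr) => x; rewrite big_cons Pi.
Qed.

Lemma waveM h h' phi phi' x : wave h phi x * wave h' phi' x =
  2^-1 * (wave (h + h') (phi + phi') x + wave (h - h') (phi - phi') x).
Proof.
rewrite /wave !dotvDl dotvNl.
have -> : dotv h x + dotv h' x + (phi + phi') = (dotv h x + phi) + (dotv h' x + phi') by ring.
have -> : dotv h x - dotv h' x + (phi - phi') = (dotv h x + phi) - (dotv h' x + phi') by ring.
by move: (dotv h x + phi) (dotv h' x + phi') => u v; rewrite cosD cosB; field.
Qed.

Lemma trigpoly_ind_wave (P : (Rn -> R) -> Prop) :
  (forall f g, f =1 g -> P f -> P g) -> P (fun=> 0) ->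
  (forall c h phi f, P f -> P (fun x => c * wave h phi x + f x)) ->
  forall f, trigpoly f -> P f.
Proof.
move=> Pext P0 PD f [s fs]; apply: (Pext (wave_sum s)); first by move=> x; rewrite fs.
elim: s {f fs} => [|w s IHs]; first by apply: Pext P0 => x; rewrite /wave_sum big_nil.
by apply: Pext (PD w.1.1 w.1.2 w.2 _ IHs) => x; rewrite /wave_sum big_cons.
Qed.

Lemma trigpolyM f g : trigpoly f -> trigpoly g -> trigpoly (fun x => f x * g x).
Proof.
move=> tf tg; move: f tf.
apply: (@trigpoly_ind_wave (fun f => trigpoly (fun x => f x * g x))).
- by move=> f f' ff' /=; apply: trigpoly_ext => x; rewrite ff'.
- by apply: trigpoly_ext (trigpoly_cst 0) => x; rewrite mul0r.
move=> c h phi f tfg; apply: (trigpoly_ext (f := fun x => c * (wave h phi x * g x) + f x * g x)).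
  by move=> x; rewrite mulrDl mulrA.
apply: trigpolyD => //; apply: trigpolyZ.
move: g tg {tfg}; apply: (@trigpoly_ind_wave (fun g => trigpoly (fun x => wave h phi x * g x))).
- by move=> g g' gg' /=; apply: trigpoly_ext => x; rewrite gg'.
- by apply: trigpoly_ext (trigpoly_cst 0) => x; rewrite mulr0.
move=> c' h' phi' g tg.
apply: (trigpoly_ext (f := fun x => c' * (2^-1 * (wave (h + h') (phi + phi') x + wave (h - h') (phi - phi') x)) + wave h phi x * g x)).
  by move=> x; rewrite -waveM; ring.
by apply: trigpolyD => //; apply/trigpolyZ/trigpolyZ/trigpolyD; exact: trigpoly_wave.
Qed.

Lemma trigpolyB f g : trigpoly f -> trigpoly g -> trigpoly (fun x => f x - g x).
Proof.
move=> tf tg; apply: trigpoly_ext (trigpolyD tf (trigpolyZ (-1) tg)) => x.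
by rewrite mulN1r.
Qed.

Lemma trigpolyX f k : trigpoly f -> trigpoly (fun x => f x ^+ k).
Proof.
move=> tf; elim: k => [|k IHk]; first exact: trigpoly_cst.
by apply: trigpoly_ext (trigpolyM tf IHk) => x; rewrite exprS.
Qed.

Lemma trigpoly_horner (q : {poly R}) f : trigpoly f -> trigpoly (fun x => q.[f x]).
Proof.
move=> tf; elim/poly_ind: q => [|q c IHq].
  by apply: trigpoly_ext (trigpoly_cst 0) => x; rewrite horner0.
apply: trigpoly_ext (trigpolyD (trigpolyM IHq tf) (trigpoly_cst c)) => x.
by rewrite !hornerE.
Qed.

Lemma sin_wave (h : Rn) x : sin (dotv h x) = wave h (- (pi / 2)) x.
Proof. by rewrite /wave cosBpihalf. Qed.

Lemma trigpoly_sin h : trigpoly (fun x => sin (dotv h x)).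
Proof. by apply: trigpoly_ext (trigpoly_wave h (- (pi / 2))) => x; rewrite sin_wave. Qed.

Lemma trigpoly_cos h : trigpoly (fun x => cos (dotv h x)).
Proof. by apply: trigpoly_ext (trigpoly_wave h 0) => x; rewrite /wave addr0. Qed.

Definition row_of_tuple (t : n.-tuple mR) : Rn := \row_i tnth t i.

Definition bmeasurable f := measurable_fun setT (f \o row_of_tuple) /\
  exists M, forall x, `|f x| <= M.

Lemma dotv_row (h : Rn) t : dotv h (row_of_tuple t) = \sum_(i < n) h 0 i * tnth t i.
Proof. by apply: eq_bigr => i _; rewrite mxE. Qed.

Lemma gaussian_row a t : gaussian a (row_of_tuple t) = expR (- (a * \sum_(i < n) tnth t i ^+ 2)).
Proof.
by rewrite /gaussian dotv_row; under eq_bigr do rewrite mxE -expr2.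
Qed.

Lemma bmeasurable_wave h phi : bmeasurable (wave h phi).
Proof.
split; last by exists 1 => x; exact: norm_cos_le1.
rewrite /comp /wave; under eq_fun do rewrite dotv_row.
apply: measurableT_comp; first exact: continuous_measurable_fun (@continuous_cos R).
by apply: measurable_funD => //; exact: measurable_sum_tnth.
Qed.

Lemma bmeasurableD f g : bmeasurable f -> bmeasurable g -> bmeasurable (fun x => f x + g x).
Proof.
move=> [mf [M fM]] [mg [N gN]]; split; first exact: measurable_funD.
by exists (M + N) => x; rewrite (le_trans (ler_normD _ _))// lerD.
Qed.

Lemma bmeasurableZ (c : R) f : bmeasurable f -> bmeasurable (fun x => c * f x).
Proof.
move=> [mf [M fM]]; split; first exact: measurable_funM.
by exists (`|c| * M) => x; rewrite normrM ler_wpM2l.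
Qed.

Lemma bmeasurable_cst (c : R) : bmeasurable (fun=> c).
Proof. by split; [exact: measurable_cst|exists `|c|]. Qed.

Lemma trigpoly_bmeasurable f : trigpoly f -> bmeasurable f.
Proof.
move: f; apply: (@trigpoly_ind_wave bmeasurable).
- by move=> f g fg; rewrite (funext fg).
- exact: bmeasurable_cst.
by move=> c h phi f bf; apply: bmeasurableD => //; apply/bmeasurableZ/bmeasurable_wave.
Qed.

Lemma measurable_gaussian a : measurable_fun setT (gaussian a \o row_of_tuple).
Proof.
rewrite /comp; under eq_fun do rewrite gaussian_row.
exact: measurable_gauss_Rn.
Qed.

Lemma integral_gaussian a : 0 < a ->
  (\int[lebesgue_Rn n]_t (gaussian a (row_of_tuple t))%:E = (gauss_mass a ^+ n)%:E)%E.
Proof.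
move=> a0; have := @integral_gauss_wave R n a (fun=> 0) 0 1 0 a0 (lexx 0) ler01.
rewrite !mul0r addr0 mulr1 => <-; apply: eq_integral => t _.
by rewrite gaussian_row mul0r addr0 mulr1.
Qed.

Lemma integrable_gaussian a f : 0 < a -> bmeasurable f ->
  (lebesgue_Rn n).-integrable setT (EFin \o (fun t => gaussian a (row_of_tuple t) * f (row_of_tuple t))).
Proof.
move=> a0 [mf [M fM]].
have intg : (lebesgue_Rn n).-integrable setT (EFin \o (gaussian a \o row_of_tuple)).
  apply/integrableP; split; first by apply/measurable_EFinP; exact: measurable_gaussian.
  under eq_integral do rewrite /= ger0_norm ?expR_ge0//.
  by rewrite integral_gaussian// ltry.
apply: le_integrable (integrableZl _ M intg) => //.
  by apply/measurable_EFinP; apply: measurable_funM => //; exact: measurable_gaussian.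
move=> t _ /=; rewrite lee_fin normrM mulrC normrM; apply: ler_pM => //.
exact: le_trans (fM _) (ler_norm _).
Qed.

(** Not normalised: the mean of 1 is [gauss_mass a ^+ n]. *)
Definition gmean a f : R :=
  \int[lebesgue_Rn n]_t (gaussian a (row_of_tuple t) * f (row_of_tuple t)).

Lemma eq_gmean a f g : f =1 g -> gmean a f = gmean a g.
Proof. by move=> fg; apply: eq_Rintegral => t _; rewrite fg. Qed.

Lemma gmeanD a f g : 0 < a -> bmeasurable f -> bmeasurable g ->
  gmean a (fun x => f x + g x) = gmean a f + gmean a g.
Proof.
move=> a0 bf bg; rewrite /gmean -RintegralD//; try exact: integrable_gaussian.
by apply: eq_Rintegral => t _; rewrite mulrDr.
Qed.

Lemma gmeanZ a (c : R) f : 0 < a -> bmeasurable f ->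
  gmean a (fun x => c * f x) = c * gmean a f.
Proof.
move=> a0 bf; rewrite /gmean -RintegralZl//; try exact: integrable_gaussian.
by apply: eq_Rintegral => t _; rewrite mulrCA.
Qed.

Lemma gmean_le a f g : 0 < a -> bmeasurable f -> bmeasurable g ->
  (forall x, f x <= g x) -> gmean a f <= gmean a g.
Proof.
move=> a0 bf bg fg; apply: le_Rintegral => //; try exact: integrable_gaussian.
by move=> t _; rewrite ler_wpM2l ?expR_ge0.
Qed.

Lemma gmean1 a : 0 < a -> gmean a (fun=> 1) = gauss_mass a ^+ n.
Proof.
move=> a0; rewrite /gmean; under eq_Rintegral do rewrite mulr1.
by rewrite /Rintegral integral_gaussian.
Qed.

Lemma gmean_cst a (c : R) : 0 < a -> gmean a (fun=> c) = c * gauss_mass a ^+ n.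
Proof.
move=> a0; rewrite -gmean1// -gmeanZ//; last exact: bmeasurable_cst.
by apply: eq_gmean => x; rewrite mulr1.
Qed.

Lemma gmean_sum a (I : Type) (r : seq I) (F : I -> Rn -> R) : 0 < a ->
  (forall i, trigpoly (F i)) ->
  gmean a (fun x => \sum_(i <- r) F i x) = \sum_(i <- r) gmean a (F i).
Proof.
move=> a0 tF; elim: r => [|i r IHr].
  transitivity (gmean a (fun=> 0)); last by rewrite gmean_cst// mul0r big_nil.
  by apply: eq_gmean => x; rewrite big_nil.
rewrite big_cons -IHr -gmeanD//; last 2 first.
- exact: trigpoly_bmeasurable.
- by apply/trigpoly_bmeasurable/trigpoly_sum.
by apply: eq_gmean => x; rewrite big_cons.
Qed.

Lemma gmean_wave a (h : Rn) phi : 0 < a -> gmean a (wave h phi) =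
  gauss_mass a ^+ n * (cos phi * \prod_(i < n) expR (- (h 0 i ^+ 2 / (4 * a)))).
Proof.
(* [integral_gauss_wave] speaks of [A + B * cos] with [B <= A]; the mean of 1 is added on both sides
   to reach [A = B = 1]. *)
move=> a0; apply: (addrI (gmean a (fun=> 1))); rewrite -gmeanD//; last 2 first.
- exact: bmeasurable_cst.
- exact: bmeasurable_wave.
have := @integral_gauss_wave R n a (fun i => h 0 i) phi 1 1 a0 ler01 (lexx 1).
move=> /(congr1 fine) /= E.
have -> : gmean a (fun=> 1) + gauss_mass a ^+ n * (cos phi * \prod_(i < n) expR (- (h 0 i ^+ 2 / (4 * a)))) =
    gauss_mass a ^+ n * (1 + 1 * cos phi * \prod_(i < n) expR (- (h 0 i ^+ 2 / (4 * a)))).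
  by rewrite gmean1//; ring.
rewrite -E; congr fine; apply: eq_integral => t _.
by rewrite gaussian_row /wave dotv_row mul1r.
Qed.

End gaussian_mean.

(** * Gaussian means of rapidly oscillating functions *)

Section riemann_lebesgue.
Context {R : realType} {n : nat}.
Local Notation Rn := 'rV[R]_n.
Implicit Types (x xi : Rn) (T : Rn -> R) (a phi : R).

Lemma cvg_gauss_shift (u c a : R) : c != 0 -> 0 < a ->
  expR (- ((u + l * c) ^+ 2 / (4 * a))) @[l --> +oo] --> (0 : R).
Proof.
move=> c0 a0.
apply: (@cvg_comp _ _ _ (fun l => (u + l * c) ^+ 2 / (4 * a)) (fun z => expR (- z))); last exact: cvgr_expR.
apply/cvgryPge => A; near=> l.
have cc : 0 < `|c| by rewrite normr_gt0.
have l0 : 0 <= l by near: l; exact: nbhs_pinfty_ge.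
have hl : (`|u| + 1 + 4 * a * `|A|) / `|c| <= l.
  by near: l; apply: nbhs_pinfty_ge; exact: num_real.
rewrite ler_pdivlMr ?mulr_gt0//.
have h1 : 1 + 4 * a * `|A| <= `|u + l * c|.
  rewrite ler_pdivrMr// in hl.
  have := ler_normB (u + l * c) u; rewrite addrAC subrr add0r normrM (ger0_norm l0).
  lra.
have h2 : 0 <= 4 * a * `|A| by rewrite !mulr_ge0// ltW.
rewrite -[leRHS]real_normK ?num_real//.
have h3 : A * (4 * a) <= 4 * a * `|A|.
  by rewrite [leRHS]mulrC ler_wpM2r ?ler_norm// mulr_ge0// ltW.
have : (1 + 4 * a * `|A|) * (1 + 4 * a * `|A|) <= `|u + l * c| * `|u + l * c|.
  by apply: ler_pM => //; lra.
rewrite -expr2; nra.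
Unshelve. all: by end_near. Qed.

(** The mean is a product over coordinates of factors at most 1, and the factor of one nonzero
    coordinate of [xi] tends to 0. *)
Lemma gmean_wave_cvg0 a h xi phi : 0 < a -> xi != 0 ->
  gmean a (wave (h + l *: xi) phi) @[l --> +oo] --> (0 : R).
Proof.
move=> a0 xi0.
have [i xii] : exists i, xi 0 i != 0.
  apply: contrapT => /forallNP hxi; move/negP: xi0; apply; apply/eqP/rowP => i.
  by rewrite mxE; apply/eqP; apply: contrapT => /negP/hxi.
have K0 : 0 <= gauss_mass a ^+ n by rewrite exprn_ge0// ltW// gauss_mass_gt0.
apply: norm_cvg0; apply: (@squeeze_cvgr _ _ _ _ (cst 0)
   (fun l => gauss_mass a ^+ n * expR (- ((h 0 i + l * xi 0 i) ^+ 2 / (4 * a))))).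
- apply: nearW => l /=; rewrite normr_ge0/= gmean_wave// !normrM.
  rewrite (ger0_norm K0); apply: ler_wpM2l => //.
  rewrite -[leRHS]mul1r; apply: ler_pM => //; first exact: norm_cos_le1.
  rewrite (bigD1 i)//= !mxE normrM ger0_norm ?expR_ge0// -[leRHS]mulr1.
  apply: ler_wpM2l; rewrite ?expR_ge0// normr_prod; apply: prodr_ile1 => j _.
  rewrite normr_ge0 ger0_norm ?expR_ge0// -[leRHS]expR0 ler_expR oppr_le0.
  by rewrite mulr_ge0 ?sqr_ge0// invr_ge0 mulr_ge0// ltW.
- exact: cvg_cst.
- rewrite -[X in _ --> X](mulr0 (gauss_mass a ^+ n)); apply: cvgM; first exact: cvg_cst.
  exact: cvg_gauss_shift.
Qed.

(** Each wave of [T] times the fast wave splits into waves of frequencies [h + l *: xi] and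
    [h - l *: xi], whose means are explicit and tend to 0. *)
Lemma riemann_lebesgue a xi phi T : 0 < a -> xi != 0 -> trigpoly T ->
  gmean a (fun x => T x * wave (l *: xi) phi x) @[l --> +oo] --> (0 : R).
Proof.
move=> a0 xi0; move: T.
suff h T : trigpoly T -> trigpoly T /\ gmean a (fun x => T x * wave (l *: xi) phi x) @[l --> +oo] --> (0 : R).
  by move=> T /h[].
move: T; apply: (@trigpoly_ind_wave _ _ (fun T => trigpoly T /\ gmean a (fun x => T x * wave (l *: xi) phi x) @[l --> +oo] --> (0 : R))).
- by move=> f g fg; rewrite (funext fg).
- split; first exact: trigpoly_cst.
  rewrite (_ : (fun l => _) = fun=> 0); first exact: cvg_cst.
  apply/funext => l; rewrite -[RHS](mul0r (gauss_mass a ^+ n)) -gmean_cst//.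
  by apply: eq_gmean => x; rewrite mul0r.
move=> c h psi f [tf hf]; split; first by apply: trigpolyD => //; apply/trigpolyZ/trigpoly_wave.
have E l : gmean a (fun x => (c * wave h psi x + f x) * wave (l *: xi) phi x) =
   c / 2 * (gmean a (wave (h + l *: xi) (psi + phi)) + gmean a (wave (h + l *: (- xi)) (psi - phi)))
   + gmean a (fun x => f x * wave (l *: xi) phi x).
  rewrite -gmeanD//; try exact: bmeasurable_wave.
  rewrite -gmeanZ//; last by apply: bmeasurableD; exact: bmeasurable_wave.
  rewrite -gmeanD//.
  - by apply: eq_gmean => x; rewrite mulrDl -mulrA waveM scalerN; ring.
  - by apply: bmeasurableZ; apply: bmeasurableD; exact: bmeasurable_wave.
  - by apply: trigpoly_bmeasurable; apply: trigpolyM => //; exact: trigpoly_wave.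
under eq_fun do rewrite E.
have h1 := gmean_wave_cvg0 h (psi + phi) a0 xi0.
have h2 : gmean a (wave (h + l *: (- xi)) (psi - phi)) @[l --> +oo] --> (0 : R).
  by apply: gmean_wave_cvg0; rewrite ?oppr_eq0.
have := cvgD (cvgM (cvg_cst (c / 2)) (cvgD h1 h2)) hf.
by rewrite !addr0 mulr0; exact.
Qed.

Definition circle_mean (f : R -> R) : R :=
  (2 * pi)^-1 * \int[lebesgue_measure]_(t in `[0, 2 * pi]) f t.

(** Trigonometric polynomials on the circle, with integer frequencies; the class contains all
    polynomials in the sine, and [circle_mean] retains exactly the terms with [j = 0]. *)
Inductive harmonic : (R -> R) -> Prop :=
| harmonic0 : harmonic (fun=> 0)
| harmonicS c j phi f : harmonic f ->
    harmonic (fun t => c * cos (j%:R * t + phi) + f t).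

Lemma harmonic_ext f g : f =1 g -> harmonic f -> harmonic g.
Proof. by move=> fg; rewrite (funext fg). Qed.

Lemma harmonicD f g : harmonic f -> harmonic g -> harmonic (fun t => f t + g t).
Proof.
move=> hf hg; elim: hf => [|c j phi {}f _ IH].
  by apply: harmonic_ext hg => t; rewrite add0r.
by apply: harmonic_ext (harmonicS c j phi IH) => t; rewrite addrA.
Qed.

Lemma harmonic_cos c (j : nat) phi : harmonic (fun t => c * cos (j%:R * t + phi)).
Proof. by apply: harmonic_ext (harmonicS c j phi harmonic0) => t; rewrite addr0. Qed.

Lemma harmonic_mul_sin f : harmonic f -> harmonic (fun t => f t * sin t).
Proof.
elim=> [|c j phi {}f _ IH].
  by apply: harmonic_ext harmonic0 => t; rewrite mul0r.
suff h : harmonic (fun t => c * cos (j%:R * t + phi) * sin t).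
  by apply: harmonic_ext (harmonicD h IH) => t; rewrite mulrDl.
case: j => [|j].
  apply: harmonic_ext (harmonic_cos (c * cos phi) 1 (- (pi / 2))) => t.
  by rewrite mul1r cosBpihalf mul0r add0r.
apply: harmonic_ext (harmonicD (harmonic_cos (c / 2) j.+2 (phi - pi / 2))
  (harmonic_cos (- (c / 2)) j (phi - pi / 2))) => t.
rewrite !addrA !cosBpihalf -[j.+2]addn2 -[j.+1]addn1 !natrD.
have -> : (j%:R + 2) * t + phi = ((j%:R + 1) * t + phi) + t by ring.
have -> : j%:R * t + phi = ((j%:R + 1) * t + phi) - t by ring.
by move: (_ * t + phi) => u; rewrite sinD sinB; field.
Qed.

Lemma harmonic_horner_sin (q : {poly R}) : harmonic (fun t => q.[sin t]).
Proof.
elim/poly_ind: q => [|q c IHq].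
  by apply: harmonic_ext harmonic0 => t; rewrite horner0.
apply: harmonic_ext (harmonicD (harmonic_mul_sin IHq) (harmonic_cos c 0 0)) => t.
by rewrite mul0r addr0 cos0 mulr1 !hornerE.
Qed.

Lemma continuous_harmonic f : harmonic f -> continuous f.
Proof.
elim=> [|c j phi {}f _ IH]; first exact: cst_continuous.
move=> t; apply: (@cvgD _ R^o); last exact: IH.
move: t; apply: (@is_derive_continuous _ (fun t => - c * j%:R * sin (j%:R * t + phi))) => t.
by apply: is_derive_eq; rewrite /GRing.scale/=; ring.
Qed.

Lemma integrable_circle f : continuous f ->
  (@lebesgue_measure R).-integrable `[0, 2 * pi]%classic (EFin \o f).
Proof.
move=> cf; apply: continuous_compact_integrable; first exact: segment_compact.
exact: continuous_subspaceT.
Qed.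

Lemma circle_mean_cos (j : nat) phi :
  circle_mean (fun t => cos (j%:R * t + phi)) = if j == 0%N then cos phi else 0.
Proof.
have pi0 : 0 < 2 * pi :> R by rewrite mulr_gt0// pi_gt0.
rewrite /circle_mean; case: j => [|j] /=.
  under eq_Rintegral do rewrite mul0r add0r.
  have mu2 : fine (lebesgue_measure `[(0 : R), 2 * pi]%classic) = 2 * pi.
    by rewrite lebesgue_measure_itv/= lte_fin pi0 -EFinB subr0.
  rewrite Rintegral_cst// [X in cos phi * X]mu2.
  by rewrite mulrCA mulVf ?mulr1// gt_eqF.
pose F t : R := (j.+1%:R)^-1 * sin (j.+1%:R * t + phi).
have dF (t : R) : is_derive t 1 F (cos (j.+1%:R * t + phi)).
  rewrite /F; have : (j.+1%:R : R) != 0 by rewrite pnatr_eq0.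
  by move: (j.+1%:R : R) => z z0; apply: is_derive_eq; rewrite /GRing.scale/=; field.
have cF := is_derive_continuous dF.
rewrite /Rintegral (@continuous_FTC2 _ _ F _ _ pi0).
- rewrite /F; have -> : j.+1%:R * (2 * pi) + phi = phi + pi *+ 2 *+ j.+1.
    rewrite -mulrnA -(mulr_natr pi) natrM; move: (j.+1%:R : R) => z; ring.
  by rewrite (periodicn (@sinD2pi R)) mulr0 add0r -EFinB subrr/= mulr0.
- apply: continuous_subspaceT.
  apply: (@is_derive_continuous _ (fun t => - j.+1%:R * sin (j.+1%:R * t + phi))) => t.
  by apply: is_derive_eq; rewrite /GRing.scale/=; ring.
- split => [t _||]; first exact: (@ex_derive _ _ _ _ _ _ _ (dF t)).
    by apply: cvg_at_right_filter; exact: cF.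
  by apply: cvg_at_left_filter; exact: cF.
- by move=> t _; rewrite derive1E; apply: derive_val.
Qed.

Lemma circle_meanD f g : continuous f -> continuous g ->
  circle_mean (fun t => f t + g t) = circle_mean f + circle_mean g.
Proof.
move=> cf cg; rewrite /circle_mean RintegralD; first by rewrite mulrDr.
- exact: measurable_itv.
- exact: integrable_circle.
- exact: integrable_circle.
Qed.

Lemma circle_meanZ (c : R) f : continuous f ->
  circle_mean (fun t => c * f t) = c * circle_mean f.
Proof.
move=> cf; rewrite /circle_mean RintegralZl; first by rewrite mulrCA.
- exact: measurable_itv.
- exact: integrable_circle.
Qed.

Lemma circle_mean_le f g : continuous f -> continuous g ->
  (forall t, f t <= g t) -> circle_mean f <= circle_mean g.
Proof.
move=> cf cg fg; rewrite /circle_mean ler_wpM2l ?invr_ge0 ?mulr_ge0 ?pi_ge0//.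
by apply: le_Rintegral => //; exact: integrable_circle.
Qed.

Lemma circle_mean_cst (c : R) : circle_mean (fun=> c) = c.
Proof.
have := circle_mean_cos 0 0; rewrite cos0 eqxx => h.
rewrite -[RHS]mulr1 -h -circle_meanZ.
  by congr circle_mean; apply/funext => t; rewrite mul0r addr0 cos0 mulr1.
by under eq_fun do rewrite mul0r addr0; exact: cst_continuous.
Qed.

(** In the limit the phase [dotv (l *: xi) x] is equidistributed on the circle and independent of
    [T]: the terms of [f] with [j = 0] contribute its circle mean, the others vanish by
    [riemann_lebesgue]. *)
Lemma harmonic_mean_cvg a xi T f : 0 < a -> xi != 0 -> trigpoly T -> harmonic f ->
  gmean a (fun x => T x * f (dotv (l *: xi) x)) @[l --> +oo] --> circle_mean f * gmean a T.
Proof.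
move=> a0 xi0 tT hf.
suff [] : (forall h, trigpoly (fun x => f (dotv h x))) /\
  gmean a (fun x => T x * f (dotv (l *: xi) x)) @[l --> +oo] --> circle_mean f * gmean a T by [].
have cos_wave (j : nat) phi (h x : Rn) : cos (j%:R * dotv h x + phi) = wave (j%:R *: h) phi x.
  by rewrite /wave dotvZl.
elim: hf => [|c j phi {}f hf [tf IH]].
  split=> [h|]; first exact: trigpoly_cst.
  rewrite circle_mean_cst mul0r (_ : (fun l => _) = fun=> 0); first exact: cvg_cst.
  apply/funext => l; rewrite -[RHS](mul0r (gauss_mass a ^+ n)) -gmean_cst//.
  by apply: eq_gmean => x; rewrite mulr0.
split=> [h|].
  apply: trigpolyD => //; apply: trigpolyZ.
  by apply: trigpoly_ext (trigpoly_wave (j%:R *: h) phi) => x; rewrite cos_wave.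
have ccos : continuous (fun t : R => cos (j%:R * t + phi)).
  apply: (@is_derive_continuous _ (fun t => - j%:R * sin (j%:R * t + phi))) => t.
  by apply: is_derive_eq; rewrite /GRing.scale/=; ring.
rewrite circle_meanD; last 2 first.
- by move=> t; apply: (@cvgM _ R^o); [exact: cvg_cst | exact: ccos].
- exact: continuous_harmonic.
rewrite circle_meanZ// mulrDl -mulrA.
have E l : gmean a (fun x => T x * (c * cos (j%:R * dotv (l *: xi) x + phi) + f (dotv (l *: xi) x))) =
   c * gmean a (fun x => T x * wave (l *: (j%:R *: xi)) phi x) + gmean a (fun x => T x * f (dotv (l *: xi) x)).
  have t1 : trigpoly (fun x => T x * wave (l *: (j%:R *: xi)) phi x).
    by apply: trigpolyM => //; exact: trigpoly_wave.
  rewrite -gmeanZ//; last exact: trigpoly_bmeasurable.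
  rewrite -gmeanD//.
  - by apply: eq_gmean => x; rewrite cos_wave !scalerA [j%:R * l]mulrC; ring.
  - by apply/bmeasurableZ/trigpoly_bmeasurable.
  - by apply: trigpoly_bmeasurable; exact: trigpolyM.
under eq_fun do rewrite E.
apply: cvgD => //; apply: cvgM; first exact: cvg_cst.
rewrite circle_mean_cos; case: j {cos_wave ccos E} => [|j] /=.
  rewrite (_ : (fun l => _) = fun=> cos phi * gmean a T); first exact: cvg_cst.
  apply/funext => l; rewrite -gmeanZ//; last exact: trigpoly_bmeasurable.
  by apply: eq_gmean => x; rewrite scale0r scaler0 /wave dotv0l add0r mulrC.
by rewrite mul0r; apply: riemann_lebesgue => //; rewrite scaler_eq0 negb_or pnatr_eq0.
Qed.

End riemann_lebesgue.

(** * Polynomial approximation of the sign of the sine *)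

Section sharp_polynomial.
Context {R : realType}.
Local Notation mu := (@lebesgue_measure R).
Implicit Types (c t : R) (K : nat).

Lemma bernoulli_le (z : R) N : -1 <= z -> 1 + z *+ N <= (1 + z) ^+ N.
Proof.
move=> z1; elim: N => [|N IH]; first by rewrite mulr0n addr0 expr0.
rewrite exprS; apply: (@le_trans _ _ ((1 + z) * (1 + z *+ N))); last first.
  by rewrite ler_wpM2l//; lra.
have zN : 0 <= z * (z *+ N) by rewrite -mulr_natr mulrA -expr2 mulr_ge0 ?sqr_ge0.
by rewrite mulrS; nra.
Qed.

(* The switch happens where ((1 + c) / 2) ^ K = 2 ^ - K, i.e. at c = 0. *)
Definition sharp K : {poly R} := 1 - (1 - (2^-1 *: (1 + 'X)) ^+ K) ^+ (2 ^ K).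

Lemma sharpE K c : (sharp K).[c] = 1 - (1 - ((1 + c) / 2) ^+ K) ^+ (2 ^ K).
Proof. by rewrite /sharp !(hornerE, horner_exp) [2^-1 * _]mulrC. Qed.

Lemma sharp_itv K c : `|c| <= 1 -> 0 <= (sharp K).[c] <= 1.
Proof.
rewrite ler_norml => /andP[c0 c1]; rewrite sharpE.
have z01 : 0 <= 1 - ((1 + c) / 2) ^+ K <= 1.
  rewrite subr_ge0 lerBlDr lerDl exprn_ge0 ?exprn_ile1//; lra.
case/andP: z01 => z0 z1.
by rewrite subr_ge0 lerBlDr lerDl exprn_ge0 ?exprn_ile1.
Qed.

Lemma pow2_half K c : ((1 + c) / 2) ^+ K *+ (2 ^ K) = (1 + c) ^+ K.
Proof.
by rewrite -mulr_natr natrX -exprMn; congr (_ ^+ _); field.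
Qed.

(** Bernoulli's inequality bounds the left side by [(1 + c) ^+ K], and [(1 + c) * (1 - c) <= 1]. *)
Lemma sharp_neg K c : -1 <= c <= 0 -> (sharp K).[c] <= ((1 + `|c|) ^+ K)^-1.
Proof.
move=> /andP[c1 c0]; rewrite sharpE.
have z0 : 0 <= ((1 + c) / 2) ^+ K <= 1.
  by rewrite exprn_ge0 ?exprn_ile1//; lra.
have z1 : -1 <= - ((1 + c) / 2) ^+ K by lra.
have := bernoulli_le (2 ^ K) z1; rewrite mulNrn pow2_half => h.
apply: (@le_trans _ _ ((1 + c) ^+ K)); first by lra.
have p0 : 0 < 1 + `|c| by rewrite ltr_pwDl.
rewrite -[leRHS]mul1r ler_pdivlMr ?exprn_gt0// -exprMn.
by apply: exprn_ile1; rewrite ler0_norm//; nra.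
Qed.

(** With N = 2^K and z = ((1 + c) / 2)^K: (1 - z)^N (1 + z)^N <= 1, while Bernoulli gives (1 + z)^N
    >= N z = (1 + c)^K. *)
Lemma sharp_pos K c : 0 <= c <= 1 -> 1 - (sharp K).[c] <= ((1 + `|c|) ^+ K)^-1.
Proof.
move=> /andP[c0 c1]; rewrite sharpE opprB addrC subrK ger0_norm//.
set z := ((1 + c) / 2) ^+ K.
have /andP[z0 z1] : 0 <= z <= 1 by rewrite exprn_ge0 ?exprn_ile1//; lra.
have p0 : 0 < (1 + c) ^+ K by rewrite exprn_gt0//; lra.
rewrite -[leLHS]mul1r -[leRHS]mul1r ler_pdivlMr// mul1r.
have := @bernoulli_le z (2 ^ K); rewrite pow2_half => h.
apply: (@le_trans _ _ ((1 - z) ^+ (2 ^ K) * (1 + z) ^+ (2 ^ K))).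
  by apply: ler_wpM2l; [rewrite exprn_ge0//; lra | apply: le_trans (h _); lra].
by rewrite -exprMn; apply: exprn_ile1; nra.
Qed.

(** A bound for the distance from [sharp K] to the indicator of c > 0. It is at most 1 and tends to
    0 for [c != 0], so dominated convergence applies to its circle mean. *)
Definition blur K c : R := (1 + K%:R * `|c|)^-1.

Lemma blur_ge K c : ((1 + `|c|) ^+ K)^-1 <= blur K c.
Proof.
have p : 0 < 1 + K%:R * `|c| by rewrite ltr_pwDl// mulr_ge0.
rewrite /blur lef_pV2 ?posrE// ?exprn_gt0 ?ltr_pwDl//.
by rewrite mulr_natl; apply: bernoulli_le; rewrite (le_trans _ (normr_ge0 c))// lerN10.
Qed.

Lemma blur_ge0 K c : 0 <= blur K c.
Proof. by rewrite invr_ge0 addr_ge0// mulr_ge0. Qed.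

Lemma sharp_var K c : `|c| <= 1 ->
  (sharp K).[c] * (1 - (sharp K).[c]) <= blur K c.
Proof.
move=> c1; have /andP[q0 q1] := sharp_itv K c1.
apply: le_trans (blur_ge K c); move: c1; rewrite ler_norml => /andP[cl cr].
have [c0|c0] := leP 0 c.
  have : 1 - (sharp K).[c] <= ((1 + `|c|) ^+ K)^-1 by apply: sharp_pos; rewrite c0.
  nra.
have : (sharp K).[c] <= ((1 + `|c|) ^+ K)^-1 by apply: sharp_neg; rewrite cl ltW.
nra.
Qed.

Lemma norm_mul_blur K c : (0 < K)%N -> `|c| * blur K c <= K%:R^-1.
Proof.
move=> K0; have K1 : 0 < K%:R :> R by rewrite ltr0n.
rewrite /blur ler_pdivrMr; last by rewrite ltr_pwDl// mulr_ge0.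
by rewrite mulrDr mulr1 mulKf ?gt_eqF// lerDr invr_ge0.
Qed.

(** With the exact indicator in place of [sharp K] the right side would be [|c|], at least [c ^+ 2];
    the approximation costs at most [2 * |c| * blur K c]. *)
Lemma sharp_drift K c : (0 < K)%N -> `|c| <= 1 ->
  c ^+ 2 - 2 / K%:R <= c * (2 * (sharp K).[c] - 1).
Proof.
move=> K0 c1; have hb := norm_mul_blur c K0; have hd := blur_ge K c.
have cn := normr_ge0 c.
have c2 : c ^+ 2 <= `|c| by rewrite -[c ^+ 2]real_normK ?num_real//; nra.
move: c1; rewrite ler_norml => /andP[cl cr].
have [c0|c0] := leP 0 c.
  have : 1 - (sharp K).[c] <= blur K c by apply: le_trans hd; apply: sharp_pos; rewrite c0.
  by rewrite ger0_norm// in hb c2 *; nra.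
have : (sharp K).[c] <= blur K c by apply: le_trans hd; apply: sharp_neg; rewrite cl ltW.
by rewrite ltr0_norm// in hb c2 *; nra.
Qed.

Lemma sin_eq0_circle t : 0 <= t <= 2 * pi -> sin t = 0 -> t \in [:: 0; pi; 2 * pi].
Proof.
move=> /andP[t0 t2] st; rewrite !inE.
have [_|tn0] := eqVneq t 0; first by [].
have [_|tnpi] := eqVneq t pi; first by rewrite orbT.
have [_|tn2] := eqVneq t (2 * pi); first by rewrite orbT.
have t0' : 0 < t by rewrite lt_neqAle eq_sym tn0.
have t2' : t < 2 * pi by rewrite lt_neqAle tn2.
have [tp|tp] := ltP t pi.
  by have := @sin_gt0_pi R t; rewrite st ltxx t0' tp => /(_ isT).
have tp' : pi < t by rewrite lt_neqAle eq_sym tnpi.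
have := @sin_gt0_pi R (t - pi); rewrite subr_gt0 tp' ltrBlDr.
rewrite (_ : pi + pi = 2 * pi) ?t2'; last by ring.
by rewrite sinB st mul0r sub0r sinpi mulr0 oppr0 ltxx => /(_ isT).
Qed.

Lemma continuous_blur_sin K : continuous (fun t => blur K (sin t)).
Proof.
move=> t; apply: (@cvgV _ R^o); first by rewrite gt_eqF// ltr_pwDl// mulr_ge0.
apply: (@cvgD _ R^o); first exact: cvg_cst.
apply: (@cvgM _ R^o); first exact: cvg_cst.
by apply: continuous_comp; [exact: continuous_sin | exact: norm_continuous].
Qed.

Lemma circle_mean_blur : circle_mean (fun t => blur K (sin t)) @[K --> \oo] --> (0 : R).
Proof.
pose D : set R := `[0, 2 * pi]%classic.
have mD : measurable D by exact: measurable_itv.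
have mf K : measurable_fun D (EFin \o (fun t => blur K (sin t))).
  apply/measurable_EFinP; apply: measurable_funTS; apply: continuous_measurable_fun.
  exact: continuous_blur_sin.
have fcvg : {ae mu, forall t, D t -> (EFin \o (fun t => blur K (sin t))) t @[K --> \oo] --> (cst 0%:E : R -> \bar R) t}.
  exists ([set 0] `|` [set pi] `|` [set 2 * pi]); split.
  - by apply: measurableU; [apply: measurableU|]; exact: measurable_set1.
  - rewrite null_set_setU ?null_set_setU//; try exact: measurable_set1; try exact: lebesgue_measure_set1.
    by apply: measurableU; exact: measurable_set1.
  move=> t /= h; apply: contrapT => ht; apply: h => Dt.
  have st : sin t != 0.
    apply/eqP => /sin_eq0_circle; move: Dt; rewrite /D/= in_itv/= => -> /(_ isT).
    by rewrite !inE => /or3P[] /eqP tE; apply: ht; [left; left|left; right|right].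
  apply/fine_cvgP; split; first exact: nearW.
  apply: (@squeeze_cvgr _ _ _ _ (cst 0) (fun K => `|sin t|^-1 * K.+1%:R^-1)).
  - apply: nearW => K; rewrite /= blur_ge0 -invfM lef_pV2 ?posrE.
    + by rewrite -natr1; have := norm_sin_le1 t; nra.
    + by rewrite ltr_pwDl// mulr_ge0.
    + by rewrite mulr_gt0 ?normr_gt0.
  - exact: cvg_cst.
  - rewrite -[X in _ --> X](mulr0 `|sin t|^-1); apply: cvgM; first exact: cvg_cst.
    exact: cvg_harmonic.
have fle : {ae mu, forall t K, D t -> (`|(EFin \o (fun t => blur K (sin t))) t| <= (cst 1%:E : R -> \bar R) t)%E}.
  apply: aeW => t K _ /=; rewrite lee_fin ger0_norm ?blur_ge0//.
  by rewrite invf_le1 ?lerDl ?mulr_ge0// ltr_pwDl// mulr_ge0.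
have int1 : mu.-integrable D (cst 1%:E).
  exact: (@integrable_circle R (fun=> 1) (@cst_continuous _ _ _)).
have [_ _] := @dominated_convergence _ _ _ mu D mD _ _ _ mf (measurable_cst _) fcvg int1 fle.
rewrite integral0 => h.
rewrite -[X in _ --> X](mulr0 (2 * pi)^-1); apply: cvgM; first exact: cvg_cst.
exact: (fine_cvg h).
Qed.

Lemma continuous_sin2 : continuous (fun t : R => sin t ^+ 2).
Proof.
apply: (@is_derive_continuous _ (fun t => 2 * sin t * cos t)) => t.
by apply: is_derive_eq; rewrite /GRing.scale/=; ring.
Qed.

Lemma circle_mean_sin2 : circle_mean (fun t : R => sin t ^+ 2) = 2^-1.
Proof.
have E t : sin t ^+ 2 = 2^-1 + (- 2^-1) * cos (2%:R * t + 0).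
  have -> : 2%:R * t + 0 = t + t by ring.
  by rewrite cosD; have := cos2Dsin2 t; lra.
rewrite (_ : (fun t => _) = fun t => 2^-1 + (- 2^-1) * cos (2%:R * t + 0)); last exact/funext.
have cc : continuous (fun t : R => cos (2%:R * t + 0)).
  apply: (@is_derive_continuous _ (fun t => - 2 * sin (2%:R * t + 0))) => t.
  by apply: is_derive_eq; rewrite /GRing.scale/=; ring.
rewrite circle_meanD; last 2 first.
- exact: cst_continuous.
- by move=> t; apply: (@cvgM _ R^o); [exact: cvg_cst | exact: cc].
by rewrite circle_meanZ// circle_mean_cos/= mulr0 addr0 circle_mean_cst.
Qed.

(** When a mass is split as q and 1 - q, the sum of squares drops by 2 q (1 - q) = 1 - q^2 - (1 -
    q)^2, and the two children see the sine with opposite signs, with average sin (2 q - 1). The two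
    circle means are this loss and this gain. *)
Lemma sharp_polynomial (e : R) : 0 < e -> exists q : {poly R},
  [/\ forall c, `|c| <= 1 -> 0 <= q.[c] <= 1,
      circle_mean (fun t => (2 *: q * (1 - q)).[sin t]) <= e &
      4^-1 <= circle_mean (fun t => ('X * (2 *: q - 1)).[sin t])].
Proof.
move=> e0.
have e2 : 0 < e / 2 by rewrite divr_gt0.
have /cvgr0_norm_le/(_ _ e2) [K0 _ hK0] := circle_mean_blur.
(* [K0] makes the loss small; [8 <= K] keeps the gain 1/2 - 2/K, 1/2 being the mean of sin^2, above
   1/4. *)
pose K := maxn K0 8; have K8 : (8 <= K)%N by rewrite leq_maxr.
have Kp : (0 < K)%N by rewrite (leq_trans _ K8).
exists (sharp K); split.
- by move=> c; exact: sharp_itv.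
- have := hK0 K (leq_maxl _ _) => /(le_trans (ler_norm _)) h.
  apply: (@le_trans _ _ (2 * circle_mean (fun t => blur K (sin t)))); last by lra.
  rewrite -circle_meanZ; last exact: continuous_blur_sin.
  apply: circle_mean_le.
  + exact/continuous_harmonic/harmonic_horner_sin.
  + by move=> t; apply: (@cvgM _ R^o); [exact: cvg_cst | exact: continuous_blur_sin].
  + move=> t; have := sharp_var K (norm_sin_le1 t); move: (sharp K) => q hq.
    by rewrite !hornerE -mulrA ler_wpM2l.
- apply: (@le_trans _ _ (circle_mean (fun t => sin t ^+ 2 + - (2 / K%:R)))).
    rewrite circle_meanD; last 2 first.
    - exact: continuous_sin2.
    - exact: cst_continuous.
    rewrite circle_mean_sin2 circle_mean_cst.
    have : K%:R^-1 <= 8^-1 :> R by rewrite lef_pV2 ?posrE ?ltr0n// ler_nat.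
    lra.
  apply: circle_mean_le.
  + move=> t; apply: (@cvgD _ R^o); last exact: cvg_cst.
    exact: continuous_sin2.
  + exact/continuous_harmonic/harmonic_horner_sin.
  + move=> t; have := sharp_drift Kp (norm_sin_le1 t); move: (sharp K) => q hq.
    by rewrite !hornerE.
Qed.

End sharp_polynomial.

(** * Gaussians times trigonometric polynomials are Schwartz *)

Section schwartz_gaussian.
Context {R : realType} {n : nat}.
Local Notation Rn := 'rV[R]_n.
Implicit Types (f g : Rn -> R) (x v : Rn).

Lemma is_derive_line f x v (df : R) :
  is_derive (0 : R) 1 (fun h : R => f (h *: v + x)) df -> is_derive x v f df.
Proof.
move=> H; have D := @ex_derive _ _ _ _ _ _ _ H; have V := @derive_val _ _ _ _ _ _ _ H.
have E : (fun h : R => h^-1 *: ((f \o shift x) (h *: v) - f x)) =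
  (fun h : R => h^-1 *: (((fun h : R => f (h *: v + x)) \o shift 0) (h *: 1) - f (0 *: v + x))).
  by apply/funext => h /=; rewrite scale0r add0r addr0 scaler1.
apply: DeriveDef; first by rewrite /derivable E; exact: D.
by rewrite /derive E; exact: V.
Qed.

(** A class closed under partial derivatives. Differentiating the Gaussian produces a coordinate,
    whence the last constructor. *)
Inductive gaussfun : (Rn -> R) -> Prop :=
| gaussfun_wave h phi : gaussfun (fun x => gaussian 1 x * wave h phi x)
| gaussfunD f g : gaussfun f -> gaussfun g -> gaussfun (fun x => f x + g x)
| gaussfunZ c f : gaussfun f -> gaussfun (fun x => c * f x)
| gaussfun_coord i f : gaussfun f -> gaussfun (fun x => x 0 i * f x).

Lemma gaussfun_ext f g : f =1 g -> gaussfun f -> gaussfun g.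
Proof. by move=> fg; rewrite (funext fg). Qed.

Lemma dotv_delta x i : dotv x (delta_mx 0 i) = x 0 i.
Proof.
rewrite /dotv (bigD1 i)//= mxE !eqxx mulr1 big1 ?addr0// => j ji.
by rewrite mxE eqxx/= (negbTE ji) mulr0.
Qed.

Lemma is_derive_coord x i j :
  is_derive x (delta_mx 0 i) (fun x => x 0 j) ((j == i)%:R : R).
Proof.
apply: is_derive_line; rewrite (_ : (fun h => _) = fun h : R => h * (j == i)%:R + x 0 j).
  by apply: is_derive_eq; rewrite /GRing.scale/=; ring.
by apply/funext => h; rewrite !mxE eqxx.
Qed.

Lemma is_derive_gauss_wave x i h phi :
  is_derive x (delta_mx 0 i) (fun x => gaussian 1 x * wave h phi x)
    (-2 * (x 0 i * (gaussian 1 x * wave h phi x))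
     + - h 0 i * (gaussian 1 x * wave h (phi - pi / 2) x)).
Proof.
apply: is_derive_line.
rewrite (_ : (fun h => _) = fun t : R => expR (- (1 * (t ^+ 2 + 2 * t * x 0 i + dotv x x))) * cos (t * h 0 i + (dotv h x + phi))).
  apply: is_derive_eq; rewrite /GRing.scale/= !mul0r !mulr0 !mul0r expr0n/= !add0r.
  rewrite /gaussian /wave addrA cosBpihalf mul1r; ring.
apply/funext => t; rewrite /gaussian /wave; congr (expR (- (1 * _)) * cos _).
  rewrite dotvDl !dotvDr !dotvZl !dotvZr dotv_delta [dotv (delta_mx _ _) _]dotvC dotv_delta mxE !eqxx /=.
  by ring.
by rewrite dotvDr dotvZr dotv_delta addrA.
Qed.

Lemma gaussfun_derive f : gaussfun f -> forall i, exists2 g, gaussfun g &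
  forall x, is_derive x (delta_mx 0 i) f (g x).
Proof.
elim=> [h phi|{}f g gf IHf gg IHg|c {}f gf IHf|j {}f gf IHf] i.
- exists (fun x => -2 * (x 0 i * (gaussian 1 x * wave h phi x))
     + - h 0 i * (gaussian 1 x * wave h (phi - pi / 2) x)).
    apply: gaussfunD; apply: gaussfunZ; last exact: gaussfun_wave.
    by apply: gaussfun_coord; exact: gaussfun_wave.
  by move=> x; exact: is_derive_gauss_wave.
- have [f' gf' df] := IHf i; have [g' gg' dg] := IHg i.
  by exists (fun x => f' x + g' x) => [|x]; [exact: gaussfunD | exact: is_deriveD].
- have [f' gf' df] := IHf i.
  by exists (fun x => c * f' x) => [|x]; [exact: gaussfunZ | exact: is_deriveZ].
- have [f' gf' df] := IHf i.
  exists (fun x => x 0 j * f' x + (j == i)%:R * f x) => [|x].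
    by apply: gaussfunD; [exact: gaussfun_coord | exact: gaussfunZ].
  have := @is_deriveM _ _ (fun x => x 0 j) f x (delta_mx 0 i) _ _ (is_derive_coord x i j) (df x).
  by rewrite /GRing.scale/= [f x * _]mulrC.
Qed.

Lemma continuous_dotv (h : Rn) : continuous (dotv h).
Proof.
apply: continuous_big => //; first exact: add_continuous.
by move=> i _ x; apply: continuousM; [exact: cst_continuous | exact: coord_continuous].
Qed.

Lemma continuous_gaussian (a : R) : continuous (@gaussian R n a).
Proof.
have cd : continuous (fun x : Rn => dotv x x).
  apply: continuous_big => //; first exact: add_continuous.
  by move=> i _ x; apply: continuousM; exact: coord_continuous.
move=> x; apply: (@continuous_comp _ _ _ (fun x => - (a * dotv x x)) expR); last exact: continuous_expR.
by apply: continuousN; apply: continuousM; [exact: cst_continuous | exact: cd].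
Qed.

Lemma continuous_wave (h : Rn) (phi : R) : continuous (wave h phi).
Proof.
move=> x; apply: (@continuous_comp _ _ _ (fun x => dotv h x + phi) cos); last exact: continuous_cos.
by apply: continuousD; [exact: continuous_dotv | exact: cst_continuous].
Qed.

Lemma gaussfun_continuous f : gaussfun f -> continuous f.
Proof.
elim=> [h phi|{}f g _ IHf _ IHg|c {}f _ IHf|j {}f _ IHf] x.
- by apply: continuousM; [exact: continuous_gaussian | exact: continuous_wave].
- by apply: continuousD; [exact: IHf | exact: IHg].
- by apply: continuousM; [exact: cst_continuous | exact: IHf].
- by apply: continuousM; [exact: coord_continuous | exact: IHf].
Qed.

Lemma enorm_ge0 x : 0 <= enorm x. Proof. exact: sqrtr_ge0. Qed.

Lemma coord_le_enorm x i : `|x 0 i| <= enorm x.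
Proof.
rewrite -sqrtr_sqr ler_wsqrtr// (bigD1 i)//= lerDl.
by apply: sumr_ge0 => j _; rewrite sqr_ge0.
Qed.

Lemma gauss_decay_pow N (y : R) : 0 <= y -> y ^+ N * expR (- (1 * y)) <= 1 + N`!%:R.
Proof.
move=> y0; rewrite mul1r expRN ler_pdivrMr ?expR_gt0//.
case: N => [|N].
  rewrite expr0 fact0; have := expR_ge1Dx y; lra.
have f0 : 0 < N.+1`!%:R :> R by rewrite ltr0n fact_gt0.
have := expR_ge1Dxn N y0 => h.
have : y ^+ N.+1 <= N.+1`!%:R * expR y.
  by rewrite mulrC -ler_pdivrMr//; apply: le_trans h; rewrite lerDr.
have := expR_gt0 y; lra.
Qed.

(** All powers are treated together because a coordinate factor costs one more power of the norm. *)
Lemma gaussfun_decay f : gaussfun f -> forall N, exists M, forall x, enorm x ^+ N * `|f x| <= M.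
Proof.
elim=> [h phi|{}f g _ IHf _ IHg|c {}f _ IHf|j {}f _ IHf] N.
- exists ((1 + 0`!%:R) + (1 + N`!%:R)) => x.
  have e0 := enorm_ge0 x.
  apply: (@le_trans _ _ ((1 + enorm x ^+ 2 ^+ N) * gaussian 1 x)).
    apply: ler_pM => //; first by rewrite exprn_ge0.
      have [e1|e1] := leP (enorm x) 1.
        by apply: (@le_trans _ _ 1); [exact: exprn_ile1 | rewrite lerDl !exprn_ge0].
      by rewrite -exprM ler_wpDl// ler_weXn2l// ?(ltW e1)// mul2n -addnn leq_addr.
    by rewrite normrM ger0_norm ?expR_ge0// -[leRHS]mulr1 ler_wpM2l ?expR_ge0// norm_cos_le1.
  rewrite mulrDl enorm_sqr; apply: lerD; last by apply: gauss_decay_pow; exact: dotv_ge0.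
  by have := @gauss_decay_pow 0 _ (dotv_ge0 x); rewrite expr0.
- have [M hM] := IHf N; have [M' hM'] := IHg N; exists (M + M') => x.
  apply: (le_trans _ (lerD (hM x) (hM' x))).
  by rewrite -mulrDr ler_wpM2l ?exprn_ge0 ?enorm_ge0 ?ler_normD.
- have [M hM] := IHf N; exists (`|c| * M) => x.
  by rewrite normrM mulrCA ler_wpM2l.
- have [M hM] := IHf N.+1; exists M => x; apply: le_trans (hM x).
  rewrite normrM exprSr mulrA ler_wpM2r// ler_wpM2l ?exprn_ge0 ?enorm_ge0//.
  exact: coord_le_enorm.
Qed.

Lemma gaussfun_partials f (s : seq 'I_n) : gaussfun f -> gaussfun (partials s f).
Proof.
move=> gf; elim: s => [//|i s IHs] /=.
have [g gg dg] := gaussfun_derive IHs i.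
apply: gaussfun_ext gg => x; apply/esym.
exact: (@derive_val _ _ _ _ _ _ _ (dg x)).
Qed.

Lemma gaussfun_schwartz f : gaussfun f -> schwartz_real f.
Proof.
move=> gf; split=> [s|N s].
  have gs := gaussfun_partials s gf; split; first exact: gaussfun_continuous.
  move=> i x; have [g _ dg] := gaussfun_derive gs i.
  exact: (@ex_derive _ _ _ _ _ _ _ (dg x)).
exact: (gaussfun_decay (gaussfun_partials s gf)).
Qed.

Lemma trigpoly_gaussfun T : trigpoly T -> gaussfun (fun x => gaussian 1 x * T x).
Proof.
move: T; apply: trigpoly_ind_wave => [f g fg|| c h phi f gf].
- by rewrite (funext fg).
- apply: gaussfun_ext (gaussfunZ 0 (gaussfun_wave 0 0)) => x.
  by rewrite mul0r mulr0.
- apply: gaussfun_ext (gaussfunD (gaussfunZ c (gaussfun_wave h phi)) gf) => x.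
  by ring.
Qed.

Lemma schwartz_gauss_trig T : trigpoly T ->
  schwartz (fun x : Rn => Complex (gaussian 1 x * T x) 0).
Proof.
move=> tT; split; apply: gaussfun_schwartz; first exact: trigpoly_gaussfun.
by apply: gaussfun_ext (gaussfunZ 0 (gaussfun_wave 0 0)) => x; rewrite mul0r.
Qed.

End schwartz_gaussian.

(** * Directional Hilbert transforms of highly modulated functions *)

Section hilbert_gaussian.
Context {R : realType} {n : nat}.
Local Notation Rn := 'rV[R]_n.
Local Notation mu := (@lebesgue_measure R).
Implicit Types (f g T : Rn -> R) (x v xi h : Rn).

(** Integrability of every truncation is recorded along with the limit, since additivity of the
    integral depends on it. *)
Definition has_pv v g x (l : R) :=
  (forall eps : R, 0 < eps -> mu.-integrable [set t | eps < `|t|]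
     (EFin \o (fun t => g (x - t *: v) / t))) /\
  \int[mu]_(t in [set t | eps < `|t|]) (g (x - t *: v) / t) @[eps --> 0^'+] --> l.

Lemma has_pv_hilbert v g x l : has_pv v g x l -> hilbert_real v g x = pi^-1 * l.
Proof. by case=> _ h; congr (_ * _); exact: cvg_lim. Qed.

Lemma has_pv_ext v f g x l : f =1 g -> has_pv v f x l -> has_pv v g x l.
Proof. by move=> fg; rewrite (funext fg). Qed.

Lemma has_pvD v f g x l m : has_pv v f x l -> has_pv v g x m ->
  has_pv v (fun x => f x + g x) x (l + m).
Proof.
move=> [intf cf] [intg cg]; split=> [eps e0|].
  have := integrableD (measurable_norm_gt eps) (intf _ e0) (intg _ e0).
  apply: eq_integrable => //; first exact: measurable_norm_gt.
  by move=> t _ /=; rewrite mulrDl.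
apply: cvg_trans (cvgD cf cg); apply: near_eq_cvg; near=> eps.
have e0 : 0 < eps by near: eps; exact: nbhs_right_gt.
transitivity (\int[mu]_(t in [set t | eps < `|t|]) (f (x - t *: v) / t) +
  \int[mu]_(t in [set t | eps < `|t|]) (g (x - t *: v) / t)); first by [].
rewrite -RintegralD; [|exact: measurable_norm_gt|exact: intf|exact: intg].
by apply: eq_Rintegral => t _; rewrite mulrDl.
Unshelve. all: by end_near. Qed.

Lemma has_pvZ v f x l (c : R) : has_pv v f x l -> has_pv v (fun x => c * f x) x (c * l).
Proof.
move=> [intf cf]; split=> [eps e0|].
  have := integrableZl (measurable_norm_gt eps) c (intf _ e0).
  apply: eq_integrable => //; first exact: measurable_norm_gt.
  by move=> t _ /=; rewrite -mulrA.
apply: cvg_trans (cvgM (cvg_cst c) cf); apply: near_eq_cvg; near=> eps.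
have e0 : 0 < eps by near: eps; exact: nbhs_right_gt.
transitivity (c * \int[mu]_(t in [set t | eps < `|t|]) (f (x - t *: v) / t)); first by [].
rewrite -RintegralZl; [|exact: measurable_norm_gt|exact: intf].
by apply: eq_Rintegral => t _; rewrite mulrA.
Unshelve. all: by end_near. Qed.

Lemma gauss_wave_line v x h phi (t : R) : enorm v = 1 ->
  gaussian 1 (x - t *: v) * wave h phi (x - t *: v) / t =
  gaussian 1 x * (tilt (dotv x v) t * cos (dotv h x + phi - dotv h v * t) / t).
Proof.
move=> v1; have vv : dotv v v = 1 by rewrite -enorm_sqr v1 expr1n.
rewrite !mulrA; congr (_ * _ / _).
  rewrite /gaussian /tilt -expRD; congr expR.
  by rewrite dotvDl !dotvDr !dotvNl !dotvNr !dotvZl !dotvZr vv [dotv v x]dotvC; ring.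
by rewrite /wave dotvDr dotvNr dotvZr; congr cos; ring.
Qed.

Lemma has_pv_wave v x h phi : enorm v = 1 ->
  has_pv v (fun x => gaussian 1 x * wave h phi x) x
    (gaussian 1 x * pv_gauss (dotv x v) (dotv h v) (dotv h x + phi)).
Proof.
move=> v1.
have intk (eps : R) : 0 < eps -> mu.-integrable [set t | eps < `|t|]
  (EFin \o (fun t => tilt (dotv x v) t * cos (dotv h x + phi - dotv h v * t) / t)).
  move=> e0; have mD := measurable_norm_gt eps.
  have i1 : mu.-integrable [set t : R | eps < `|t|] (EFin \o pv_kernel (dotv x v) (dotv h v) (dotv h x + phi)).
    exact: (@integrableS _ _ _ mu setT _ _ measurableT mD (@subsetT _ _) (integrable_pv_kernel _ _ _)).
  have i2 : mu.-integrable [set t : R | eps < `|t|] (EFin \o (fun t => tilt 0 t / t)).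
    by apply: (integrable_tilt0_div e0) => // t /= /ltW.
  have := integrableD mD i1 (integrableZl mD (cos (dotv h x + phi)) i2).
  apply: eq_integrable => // t _ /=; congr EFin.
  by rewrite /pv_kernel; ring.
split=> [eps e0|].
  have := integrableZl (measurable_norm_gt eps) (gaussian 1 x) (intk _ e0).
  apply: eq_integrable => //; first exact: measurable_norm_gt.
  by move=> t _ /=; rewrite gauss_wave_line.
have cf := @pv_gauss_cvg R (dotv x v) (dotv h v) (dotv h x + phi).
apply: cvg_trans (cvgM (cvg_cst (gaussian 1 x)) cf); apply: near_eq_cvg; near=> eps.
have e0 : 0 < eps by near: eps; exact: nbhs_right_gt.
transitivity (gaussian 1 x * \int[mu]_(t in [set t | eps < `|t|])
  (tilt (dotv x v) t * cos (dotv h x + phi - dotv h v * t) / t)); first by [].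
rewrite -RintegralZl; [|exact: measurable_norm_gt|exact: intk].
by apply: eq_Rintegral => t _; rewrite gauss_wave_line.
Unshelve. all: by end_near. Qed.

Lemma has_pv_trig v x T : enorm v = 1 -> trigpoly T ->
  exists l, has_pv v (fun x => gaussian 1 x * T x) x l.
Proof.
move=> v1; move: T; apply: trigpoly_ind_wave => [f g fg|| c h phi f [l pf]].
- by rewrite (funext fg).
- exists (0 * (gaussian 1 x * pv_gauss (dotv x v) (dotv 0 v) (dotv 0 x + 0))).
  apply: has_pv_ext (has_pvZ 0 (has_pv_wave x 0 0 v1)) => y.
  by rewrite mul0r mulr0.
- exists (c * (gaussian 1 x * pv_gauss (dotv x v) (dotv h v) (dotv h x + phi)) + l).
  apply: has_pv_ext (has_pvD (has_pvZ c (has_pv_wave x h phi v1)) pf) => y.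
  by ring.
Qed.

Definition ghilb v T x : R := hilbert_real v (fun x => gaussian 1 x * T x) x.

Lemma ghilbD v f g x : enorm v = 1 -> trigpoly f -> trigpoly g ->
  ghilb v (fun x => f x + g x) x = ghilb v f x + ghilb v g x.
Proof.
move=> v1 tf tg; have [l pf] := has_pv_trig x v1 tf; have [m pg] := has_pv_trig x v1 tg.
rewrite /ghilb (has_pv_hilbert pf) (has_pv_hilbert pg) -mulrDr.
apply: has_pv_hilbert; apply: has_pv_ext (has_pvD pf pg) => y.
by rewrite mulrDr.
Qed.

Lemma ghilbZ v f x (c : R) : enorm v = 1 -> trigpoly f ->
  ghilb v (fun x => c * f x) x = c * ghilb v f x.
Proof.
move=> v1 tf; have [l pf] := has_pv_trig x v1 tf.
rewrite /ghilb (has_pv_hilbert pf) mulrCA.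
apply: has_pv_hilbert; apply: has_pv_ext (has_pvZ c pf) => y.
by rewrite mulrCA.
Qed.

Lemma ghilb_sum v (I : Type) (r : seq I) (F : I -> Rn -> R) x : enorm v = 1 ->
  (forall i, trigpoly (F i)) ->
  ghilb v (fun x => \sum_(i <- r) F i x) x = \sum_(i <- r) ghilb v (F i) x.
Proof.
move=> v1 tF; elim: r => [|i r IHr].
  have -> : (fun x => \sum_(i <- [::]) F i x) = (fun x => 0 * (fun=> 0) x).
    by apply/funext => y; rewrite big_nil mul0r.
  by rewrite (ghilbZ x 0 v1 (trigpoly_cst 0)) mul0r big_nil.
rewrite big_cons -IHr -ghilbD//; last exact: trigpoly_sum.
by congr (ghilb v _ x); apply/funext => y; rewrite big_cons.
Qed.

Lemma dotv_le_enorm x v : enorm v = 1 -> dotv x v ^+ 2 <= enorm x ^+ 2.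
Proof.
move=> v1; have vv : dotv v v = 1 by rewrite -enorm_sqr v1 expr1n.
have := dotv_ge0 (x - dotv x v *: v); rewrite enorm_sqr.
rewrite dotvDl !dotvDr !dotvNl !dotvNr !dotvZl !dotvZr vv [dotv v x]dotvC.
by lra.
Qed.

(** The first term measures how far [gauss_erf] is from its limit, the second is the effect of the
    tilt. *)
Definition wave_error (c y : R) : R :=
  pi^-1 * (`|gauss_erf y - c| + 2 * gauss_mass 1 * expR (- (y ^+ 2 / 4))).

(** The tilt b = x.v is unbounded, but b^2 <= |x|^2, so [gaussian 1 x] absorbs exp (b^2). The
    remaining factor |b| is the origin of [1 + enorm x]. *)
Lemma ghilb_wave v x h phi (c : R) : enorm v = 1 ->
  `|ghilb v (wave h phi) x - pi^-1 * gaussian 1 x * c * sin (dotv h x + phi)| <=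
  (1 + enorm x) * wave_error c (dotv h v).
Proof.
move=> v1; rewrite /ghilb (has_pv_hilbert (has_pv_wave x h phi v1)).
set b := dotv x v; set y := dotv h v; set al := dotv h x + phi.
have pi0 : 0 <= pi^-1 :> R by rewrite invr_ge0 pi_ge0.
have b2 : b ^+ 2 <= enorm x ^+ 2 by exact: dotv_le_enorm.
have g1 : gaussian 1 x * expR (b ^+ 2) <= 1.
  rewrite /gaussian -expRD -[leRHS]expR0 ler_expR mul1r -enorm_sqr; lra.
have gle1 : gaussian 1 x <= 1.
  by rewrite /gaussian -[leRHS]expR0 ler_expR mul1r oppr_le0 dotv_ge0.
have bx : `|b| <= enorm x.
  by rewrite -(@ler_pXn2r _ 2)// ?nnegrE ?enorm_ge0// real_normK ?num_real.
have g0 : 0 <= gaussian 1 x by exact: expR_ge0.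
have -> : pi^-1 * (gaussian 1 x * pv_gauss b y al) - pi^-1 * gaussian 1 x * c * sin al
  = pi^-1 * (gaussian 1 x * (pv_gauss b y al - sin al * gauss_erf y) + gaussian 1 x * (sin al * (gauss_erf y - c))) by ring.
rewrite normrM (ger0_norm pi0) /wave_error [leRHS]mulrCA; apply: ler_wpM2l => //.
apply: (le_trans (ler_normD _ _)); rewrite addrC [leRHS]mulrDr !normrM (ger0_norm g0).
have K0 : 0 <= gauss_mass 1 :> R by rewrite ltW// gauss_mass_gt0.
apply: lerD.
  rewrite mulrA; apply: ler_wpM2r => //; apply: (@le_trans _ _ 1).
    by rewrite -[leRHS]mulr1; apply: ler_pM => //; exact: norm_sin_le1.
  by rewrite lerDl enorm_ge0.
apply: (le_trans (ler_wpM2l g0 (pv_gauss_bound b y al))).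
have -> : gaussian 1 x * (2 * gauss_mass 1 * (`|b| * expR (b ^+ 2)) * expR (- (y ^+ 2 / 4))) =
  (gaussian 1 x * expR (b ^+ 2)) * `|b| * (2 * gauss_mass 1 * expR (- (y ^+ 2 / 4))) by ring.
apply: ler_wpM2r; first by rewrite !mulr_ge0 ?expR_ge0.
rewrite -[leRHS]mul1r; apply: ler_pM => //; first by rewrite mulr_ge0 ?expR_ge0.
by apply: (le_trans bx); rewrite lerDr.
Qed.

Lemma cvg_affine_pinfty (u c : R) : 0 < c -> u + l * c @[l --> +oo] --> +oo.
Proof.
move=> c0; apply/cvgryPge => A; near=> l.
have : (A - u) / c <= l by near: l; apply: nbhs_pinfty_ge; exact: num_real.
rewrite ler_pdivrMr//; lra.
Unshelve. all: by end_near. Qed.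

Lemma wave_error_cvg (u c : R) : c != 0 ->
  wave_error (Num.sg c * pv_const) (u + l * c) @[l --> +oo] --> (0 : R).
Proof.
move=> c0; rewrite -[X in _ --> X](mulr0 pi^-1); apply: cvgM; first exact: cvg_cst.
rewrite -[X in _ --> X](addr0 (0 : R)); apply: cvgD.
  suff : gauss_erf (u + l * c) @[l --> +oo] --> Num.sg c * pv_const.
    move=> /cvgB/(_ (cvg_cst (Num.sg c * pv_const))); rewrite subrr.
    by move=> /cvg_norm; rewrite normr0.
  case: (ltgtP c 0) c0 => // [cn|cp] _.
    rewrite ltr0_sg// mulN1r.
    have -> : (fun l => gauss_erf (u + l * c)) = (fun l => - gauss_erf (- u + l * (- c))).
      by apply/funext => l; rewrite -gauss_erfN; congr gauss_erf; ring.
    apply: cvgN; apply: cvg_comp cvg_gauss_erf.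
    by apply: cvg_affine_pinfty; rewrite oppr_gt0.
  rewrite gtr0_sg// mul1r; apply: cvg_comp cvg_gauss_erf.
  exact: cvg_affine_pinfty.
rewrite -[X in _ --> X](mulr0 (2 * gauss_mass 1)); apply: cvgM; first exact: cvg_cst.
by have := @cvg_gauss_shift R u c 1 c0 ltr01; rewrite mulr1.
Qed.

Let modulated_algebra (c gp gm gf s k p G w f sn sp sm : R) :
  w * sn = 2^-1 * (sp - sm) ->
  c / 2 * (gp + gm) + gf - s * (k * p) * (G * ((c * w + f) * sn)) =
  c / 2 * ((gp - k * G * (s * p) * sp) + (gm - k * G * (- s * p) * sm))
    + (gf - s * (k * p) * (G * (f * sn))).
Proof. by move=> h; rewrite mulrDl -[c * w * sn]mulrA h; field. Qed.

(** The cosine splits each wave of [T] into frequencies [h + l *: xi] and [h - l *: xi]. Their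
    products with [v] tend to infinities of opposite signs, so the two transforms carry opposite
    constants and recombine into the sine. *)
Lemma ghilb_modulated v xi T : enorm v = 1 -> dotv xi v != 0 -> trigpoly T ->
  forall e : R, 0 < e -> \forall l \near +oo, forall x,
  `|ghilb v (fun x => T x * cos (dotv (l *: xi) x)) x -
    Num.sg (dotv xi v) * (pi^-1 * pv_const) * (gaussian 1 x * (T x * sin (dotv (l *: xi) x)))|
  <= e * (1 + enorm x).
Proof.
move=> v1 xv tT; move: T tT.
pose P T := trigpoly T /\ forall e : R, 0 < e -> \forall l \near +oo, forall x,
  `|ghilb v (fun x => T x * cos (dotv (l *: xi) x)) x -
    Num.sg (dotv xi v) * (pi^-1 * pv_const) * (gaussian 1 x * (T x * sin (dotv (l *: xi) x)))|
  <= e * (1 + enorm x).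
suff H T : trigpoly T -> P T by move=> T /H[].
move: T; apply: trigpoly_ind_wave => [f g fg|| c h phi f [tf hf]].
- by rewrite (funext fg).
- split; first exact: trigpoly_cst.
  move=> e e0; apply: nearW => l x.
  have -> : ghilb v (fun x => 0 * cos (dotv (l *: xi) x)) x = 0.
    by rewrite ghilbZ ?mul0r//; exact: trigpoly_cos.
  by rewrite mul0r !mulr0 subrr normr0 mulr_ge0 ?(ltW e0)// addr_ge0// enorm_ge0.
split; first by apply: trigpolyD => //; apply/trigpolyZ/trigpoly_wave.
move=> e e0.
pose s := Num.sg (dotv xi v).
have e20 : 0 < e / 2 by rewrite divr_gt0.
(* The coefficient [c / 2] meets two errors of size [d], which together stay below [e / 2]; the 1
   covers [c = 0]. *)
pose d := e / 2 / (`|c| + 1).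
have d0 : 0 < d by rewrite divr_gt0// ltr_pwDr.
have W1 := @wave_error_cvg (dotv h v) _ xv.
have W2 := @wave_error_cvg (dotv h v) (- dotv xi v).
have {}W2 := W2 (eq_ind_r (fun b => ~~ b) xv (oppr_eq0 _)).
move/cvgr0_norm_le: W1 => /(_ _ d0) W1.
move/cvgr0_norm_le: W2 => /(_ _ d0) W2.
near=> l => x.
have w1 : wave_error (s * pv_const) (dotv h v + l * dotv xi v) <= d.
  by apply: (le_trans (ler_norm _)); near: l.
have w2 : wave_error (- s * pv_const) (dotv h v + l * - dotv xi v) <= d.
  rewrite /s -sgrN; apply: (le_trans (ler_norm _)); near: l; exact: W2.
have hfl : `|ghilb v (fun x => f x * cos (dotv (l *: xi) x)) x -
    s * (pi^-1 * pv_const) * (gaussian 1 x * (f x * sin (dotv (l *: xi) x)))| <= e / 2 * (1 + enorm x).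
  by move: x; near: l; exact: hf.
pose wp := wave (h + l *: xi) phi; pose wm := wave (h - l *: xi) phi.
have E y : (c * wave h phi y + f y) * cos (dotv (l *: xi) y) =
   c / 2 * (wp y + wm y) + f y * cos (dotv (l *: xi) y).
  have := waveM h (l *: xi) phi 0 y; rewrite addr0 subr0 {2}/wave addr0 => wE.
  by rewrite mulrDl -mulrA wE /wp /wm; ring.
rewrite (_ : (fun y => _ * cos _) = fun y => c / 2 * (wp y + wm y) + f y * cos (dotv (l *: xi) y)); last exact/funext.
have tp : trigpoly wp by exact: trigpoly_wave.
have tm : trigpoly wm by exact: trigpoly_wave.
rewrite ghilbD//; last 2 first.
- by apply: trigpolyZ; exact: trigpolyD.
- by apply: trigpolyM => //; exact: trigpoly_cos.
rewrite ghilbZ//; last exact: trigpolyD.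
rewrite ghilbD//.
have Hp := ghilb_wave x (h + l *: xi) phi (s * pv_const) v1.
have Hm := ghilb_wave x (h - l *: xi) phi (- s * pv_const) v1.
rewrite -/wp in Hp; rewrite -/wm in Hm.
move: Hp Hm; rewrite !dotvDl !dotvNl !dotvZl -[- (l * dotv xi x)]mulrN -[- (l * dotv xi v)]mulrN => Hp Hm.
have S : wave h phi x * sin (l * dotv xi x) =
  2^-1 * (sin (dotv h x + l * dotv xi x + phi) - sin (dotv h x + l * - dotv xi x + phi)).
  rewrite /wave (_ : dotv h x + l * dotv xi x + phi = (dotv h x + phi) + l * dotv xi x); last by ring.
  rewrite (_ : dotv h x + l * - dotv xi x + phi = (dotv h x + phi) - l * dotv xi x); last by ring.
  by move: (dotv h x + phi) (l * dotv xi x) => u w; rewrite sinD sinB; field.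
rewrite dotvZl in hfl *.
set k := pi^-1 in Hp Hm hfl *; set G := gaussian 1 x in Hp Hm hfl *.
have ex0 : 0 <= 1 + enorm x by rewrite addr_ge0// enorm_ge0.
have {}Hp := le_trans Hp (ler_wpM2l ex0 w1).
have {}Hm := le_trans Hm (ler_wpM2l ex0 w2).
set X := ghilb v wp x - _ in Hp; set Y := ghilb v wm x - _ in Hm; set Z := ghilb v _ x - _ in hfl.
have -> : c / 2 * (ghilb v wp x + ghilb v wm x) + ghilb v (fun y => f y * cos (dotv (l *: xi) y)) x -
    s * (k * pv_const) * (G * ((c * wave h phi x + f x) * sin (l * dotv xi x)))
    = c / 2 * (X + Y) + Z.
  exact: modulated_algebra.
have cd : `|c| * d <= e / 2.
  rewrite /d mulrCA -[leRHS]mulr1 ler_wpM2l ?(ltW e20)//.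
  by rewrite ler_pdivrMr ?mul1r ?lerDl// ltr_pwDr.
apply: (le_trans (ler_normD _ _)); rewrite normrM normf_div (ger0_norm (ler0n _ 2)).
have XY : `|X + Y| <= (1 + enorm x) * d + (1 + enorm x) * d.
  by apply: (le_trans (ler_normD _ _)); exact: lerD.
have c2 : 0 <= `|c| / 2 by rewrite divr_ge0.
have := ler_wpM2l c2 XY; have := ler_wpM2l ex0 cd.
by move: hfl; lra.
Unshelve. all: by end_near. Qed.

End hilbert_gaussian.

(** * The test function on a binary tree *)

Section moment_step.
Context {R : realType}.

(** Multiplying 1 + r b + C b^2 by 1 + b gives the quadratic terms (r + C) b^2 and the cubic one C
    b^3 <= 3 C b^2, hence r + 4 C. *)
Fixpoint taylor_const r : R := if r is r'.+1 then r'%:R + 4 * taylor_const r' else 0.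

Lemma taylor_const_ge0 r : 0 <= taylor_const r.
Proof. by elim: r => //= r IH; rewrite addr_ge0 ?mulr_ge0. Qed.

Lemma exp1Dx_le r (b : R) : -1 <= b <= 3 ->
  (1 + b) ^+ r <= 1 + r%:R * b + taylor_const r * b ^+ 2.
Proof.
move=> /andP[b1 b3]; elim: r => [|r IH]; first by rewrite expr0 /= !mul0r !addr0.
rewrite exprS /=; apply: (@le_trans _ _ ((1 + b) * (1 + r%:R * b + taylor_const r * b ^+ 2))).
  by apply: ler_wpM2l => //; lra.
have c0 := taylor_const_ge0 r; rewrite -natr1.
have h : taylor_const r * b ^+ 2 * b <= taylor_const r * b ^+ 2 * 3.
  by apply: ler_wpM2l => //; rewrite mulr_ge0 ?sqr_ge0.
by move: h; set c := taylor_const r; set N := r%:R; lra.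
Qed.

Definition moment_const r : R := r%:R + 8 * taylor_const r.

Lemma moment_const_ge0 r : 0 <= moment_const r.
Proof. by rewrite addr_ge0// mulr_ge0// taylor_const_ge0. Qed.

(** The term linear in [D] is kept exact, as its mean will vanish. With A = M + F^2, relative
    increment b and A b^2 <= 8, the rest is of order A^r, that is a relative 1/M. *)
Lemma moment_step r (M F D : R) : 1 <= M -> `|D| <= 1 ->
  (M + (F + D) ^+ 2) ^+ r.+1 <=
  (1 + moment_const r.+1 / M) * (M + F ^+ 2) ^+ r.+1
  + 2 * r.+1%:R * (M + F ^+ 2) ^+ r * F * D.
Proof.
move=> M1 D1; set A := M + F ^+ 2.
have MA : M <= A by rewrite lerDl sqr_ge0.
have A1 : 1 <= A := le_trans M1 MA.
have A0 : 0 < A := lt_le_trans ltr01 A1.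
have M0 : 0 < M := lt_le_trans ltr01 M1.
pose B := 2 * F * D + D ^+ 2; pose b := B / A.
have D2 : D ^+ 2 <= 1 by rewrite -real_normK ?num_real// expr_le1.
have FDle : `|F * D| <= `|F| by rewrite normrM -[leRHS]mulr1 ler_wpM2l.
have F1 : 2 * `|F| <= F ^+ 2 + 1.
  by rewrite -[F ^+ 2]real_normK ?num_real//; have := sqr_ge0 (`|F| - 1); lra.
have /andP[FD1 FD2] : - `|F| <= F * D <= `|F| by rewrite -ler_norml.
have D20 := sqr_ge0 D.
have F20 := sqr_ge0 F.
have E : M + (F + D) ^+ 2 = A * (1 + b).
  by rewrite mulrDr mulr1 /b mulrC divfK ?gt_eqF// /A /B; ring.
have b_itv : -1 <= b <= 3.
  rewrite /b ler_pdivlMr// ler_pdivrMr// /B /A; apply/andP; split; lra.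
have Ab2 : A * b ^+ 2 <= 8.
  have -> : A * b ^+ 2 = B ^+ 2 / A by rewrite /b; field; rewrite gt_eqF.
  rewrite ler_pdivrMr//.
  have B1 : `|B| <= 2 * `|F| + 1.
    by rewrite ler_norml /B; apply/andP; split; lra.
  rewrite -real_normK ?num_real//.
  apply: (@le_trans _ _ ((2 * `|F| + 1) ^+ 2)).
    by rewrite lerXn2r ?nnegrE// addr_ge0// mulr_ge0.
  have h : `|F| ^+ 2 = F ^+ 2 by rewrite real_normK ?num_real.
  have := sqr_ge0 (2 * `|F| - 1); rewrite /A; nra.
have Ar0 : 0 <= A ^+ r by rewrite exprn_ge0// ltW.
have Ar1 : A ^+ r <= A ^+ r.+1 / M.
  by rewrite ler_pdivlMr// exprSr ler_wpM2l.
rewrite E exprMn; apply: (le_trans (ler_wpM2l _ (exp1Dx_le r.+1 b_itv))).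
  by rewrite exprn_ge0// ltW.
have AbE : A * b = B by rewrite /b mulrC divfK// gt_eqF.
have -> : A ^+ r.+1 * (1 + r.+1%:R * b + taylor_const r.+1 * b ^+ 2)
  = A ^+ r.+1 + r.+1%:R * A ^+ r * (A * b) + taylor_const r.+1 * A ^+ r * (A * b ^+ 2).
  by rewrite exprS; ring.
have c0 := taylor_const_ge0 r.+1.
have t1 : taylor_const r.+1 * A ^+ r * (A * b ^+ 2) <= 8 * taylor_const r.+1 * (A ^+ r.+1 / M).
  apply: (@le_trans _ _ (taylor_const r.+1 * A ^+ r * 8)).
    by rewrite ler_wpM2l// mulr_ge0.
  have -> : taylor_const r.+1 * A ^+ r * 8 = 8 * taylor_const r.+1 * A ^+ r by ring.
  by apply: ler_wpM2l => //; rewrite mulr_ge0.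
have n0 : 0 <= r.+1%:R :> R by [].
have t2 : r.+1%:R * (A ^+ r * D ^+ 2) <= r.+1%:R * (A ^+ r.+1 / M).
  rewrite ler_wpM2l//; apply: le_trans Ar1; rewrite -[leRHS]mulr1 ler_wpM2l//.
rewrite AbE /B /moment_const.
have -> : (1 + (r.+1%:R + 8 * taylor_const r.+1) / M) * A ^+ r.+1 =
  A ^+ r.+1 + r.+1%:R * (A ^+ r.+1 / M) + 8 * taylor_const r.+1 * (A ^+ r.+1 / M) by ring.
have -> : r.+1%:R * A ^+ r * (2 * F * D + D ^+ 2) =
  2 * r.+1%:R * A ^+ r * F * D + r.+1%:R * (A ^+ r * D ^+ 2) by ring.
move: t1 t2; move: (A ^+ r.+1) (A ^+ r) => X Y.
move: (taylor_const r.+1) (r.+1%:R) => c N.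
lra.
Qed.

End moment_step.

(** * Growing the tree by one level *)

Section tree_construction.
Context {R : realType} {n : nat}.
Local Notation Rn := 'rV[R]_n.
Implicit Types (x : Rn) (F : Rn -> R) (w A : nat -> Rn -> R).

Lemma sum_expS k (f : nat -> R) :
  \sum_(b < 2 ^ k.+1) f b = \sum_(i < 2 ^ k) (f i.*2 + f i.*2.+1).
Proof.
rewrite expnS mul2n; elim: (2 ^ k)%N => [|N IH]; first by rewrite !big_ord0.
by rewrite doubleS !big_ord_recr/= IH addrA.
Qed.

Lemma cvg_sum_fun (I : Type) (s : seq I) (u : I -> R -> R) (l : I -> R) :
  (forall i, u i z @[z --> +oo] --> l i) ->
  \sum_(i <- s) u i z @[z --> +oo] --> \sum_(i <- s) l i.
Proof. by move=> h; apply: cvg_big => //; exact: add_continuous. Qed.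

Context (a : R) (a0 : 0 < a) (m r : nat) (m0 : (0 < m)%N) (q : {poly R}) (e : R) (e0 : 0 < e)
  (L : nat -> Rn) (Xi : nat -> nat -> Rn).
Context (q01 : forall c, `|c| <= 1 -> 0 <= q.[c] <= 1).
Context (q_var : circle_mean (fun t => (2 *: q * (1 - q)).[sin t]) <= (4 * m%:R)^-1).
Context (q_drift : 4^-1 <= circle_mean (fun t => ('X * (2 *: q - 1)).[sin t])).
Context (L1 : forall l, (l < 2 ^ m)%N -> enorm (L l) = 1).

(* The cut of node i separates its children 2 i and 2 i + 1; of the nodes b of
   the next level, those up to 2 i are on the positive side. *)
Definition side (b i : nat) : R := if (b < i.*2.+1)%N then 1 else -1.

(** [l %/ 2 ^ (m - k.+1)] is the ancestor of the leaf [l] at level [k.+1]. The sign is prescribed at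
    all leaves, also those not below node [i], because every node of the level contributes to the
    Hilbert transform along every leaf. *)
Context (XiL : forall k i l, (k < m)%N -> (i < 2 ^ k)%N -> (l < 2 ^ m)%N ->
  dotv (Xi k i) (L l) != 0 /\
  Num.sg (dotv (Xi k i) (L l)) = side (l %/ 2 ^ (m - k.+1)) i).

Let I1 : R := gmean a (fun _ : Rn => 1).
Let M : R := m%:R.
Let kap : R := pi^-1 * pv_const.

(* kap * gaussian * A i approximates the Hilbert transform of gaussian * F along
   every leaf below node i. *)
Record tree_state (k : nat) F w A : Prop := TreeState {
  ts_F : trigpoly F;
  ts_w : forall i, trigpoly (w i);
  ts_A : forall i, trigpoly (A i);
  ts_w0 : forall i x, 0 <= w i x;
  ts_w1 : forall x, \sum_(i < 2 ^ k) w i x = 1;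
  ts_mom : gmean a (fun x => (M + F x ^+ 2) ^+ r.+1)
    <= (1 + (moment_const r.+1 + 1) / M) ^+ k * (M ^+ r.+1 * I1);
  ts_conc : (1 - k%:R / (2 * M)) * I1 <= gmean a (fun x => \sum_(i < 2 ^ k) w i x ^+ 2);
  ts_hilb : forall l x, (l < 2 ^ m)%N ->
    `|ghilb (L l) F x - kap * (gaussian 1 x * A (l %/ 2 ^ (m - k))%N x)|
    <= k%:R * e * (1 + enorm x);
  ts_corr : k%:R / 16 * I1 <= gmean a (fun x => \sum_(i < 2 ^ k) w i x * A i x) }.

Lemma I1_gt0 : 0 < I1.
Proof. by rewrite /I1 gmean1// exprn_gt0// gauss_mass_gt0. Qed.

Lemma M_ge1 : 1 <= M. Proof. by rewrite ler1n. Qed.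

Lemma tree_state0 : tree_state 0 (fun=> 0) (fun i _ => (i == 0%N)%:R) (fun _ _ => 0).
Proof.
have I0 := I1_gt0.
split=> //; try by move=> *; exact: trigpoly_cst.
- by move=> x; rewrite expn0 big_ord_recl big_ord0 addr0.
- rewrite expr0 mul1r -gmeanZ//; last exact: bmeasurable_cst.
  rewrite (_ : (fun x => _) = (fun=> M ^+ r.+1 * 1)) ?lexx//.
  by apply/funext => x; rewrite expr0n/= addr0 mulr1.
- rewrite mul0r subr0 mul1r (_ : (fun x => _) = (fun _ : Rn => 1 : R))//.
  by apply/funext => x; rewrite expn0 big_ord_recl big_ord0 addr0 expr1n.
- move=> l x hl; rewrite mulr0 mulr0 subr0 !mul0r.
  have -> : (fun _ : Rn => 0 : R) = (fun x => 0 * (fun=> 0) x).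
    by apply/funext => y; rewrite mul0r.
  by rewrite (ghilbZ x 0 (L1 hl) (trigpoly_cst 0)) mul0r normr0.
- rewrite !mul0r (_ : (fun x => _) = (fun _ : Rn => 0 : R)); first by rewrite gmean_cst// mul0r.
  by apply/funext => x; rewrite big1// => i _; rewrite mulr0.
Qed.

Lemma q_sin_itv (t : R) : 0 <= q.[sin t] <= 1.
Proof. exact/q01/norm_sin_le1. Qed.

Section step.
Context (k : nat) (km : (k < m)%N) (F : Rn -> R) (w A : nat -> Rn -> R).
Context (st : tree_state k F w A).

Definition node_cos (l : R) i x : R := cos (dotv (l *: Xi k i) x).
Definition node_sin (l : R) i x : R := sin (dotv (l *: Xi k i) x).
Definition next_F l x : R := F x + \sum_(i < 2 ^ k) w i x * node_cos l i x.
Definition next_w l b x : R := w b./2 x *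
  (if odd b then 1 - q.[node_sin l b./2 x] else q.[node_sin l b./2 x]).
(** By [ghilb_modulated] the new level turns its cosines into sines along a leaf below [b], with the
    sign of the cut there, namely [side b i]. *)
Definition next_A l b x : R :=
  A b./2 x + \sum_(i < 2 ^ k) side b i * (w i x * node_sin l i x).

Lemma Xi_neq0 i : (i < 2 ^ k)%N -> Xi k i != 0.
Proof.
move=> ik; have l0 : (0 < 2 ^ m)%N by rewrite expn_gt0.
have [h _] := XiL km ik l0; apply: contraNneq h => ->.
by rewrite dotv0l.
Qed.

Lemma trigpoly_next_F l : trigpoly (next_F l).
Proof.
apply: trigpolyD; first exact: (ts_F st).
apply: trigpoly_sum => i _; apply: trigpolyM; first exact: (ts_w st).
exact: trigpoly_cos.
Qed.

Lemma trigpoly_next_w l b : trigpoly (next_w l b).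
Proof.
apply: trigpolyM; first exact: (ts_w st).
have h : trigpoly (fun x => q.[node_sin l b./2 x]).
  exact/trigpoly_horner/trigpoly_sin.
case: (odd b) => //.
by apply: trigpolyB => //; exact: trigpoly_cst.
Qed.

Lemma trigpoly_next_A l b : trigpoly (next_A l b).
Proof.
apply: trigpolyD; first exact: (ts_A st).
apply: trigpoly_sum => i _; apply/trigpolyZ/trigpolyM; first exact: (ts_w st).
exact: trigpoly_sin.
Qed.

Lemma next_w_even l i x : next_w l i.*2 x = w i x * q.[node_sin l i x].
Proof. by rewrite /next_w odd_double doubleK. Qed.

Lemma next_w_odd l i x : next_w l i.*2.+1 x = w i x * (1 - q.[node_sin l i x]).
Proof. by rewrite /next_w /= odd_double /= uphalf_double. Qed.

Lemma next_w_ge0 l b x : 0 <= next_w l b x.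
Proof.
apply: mulr_ge0; first exact: (ts_w0 st).
have /andP[q0 q1] := q_sin_itv (dotv (l *: Xi k b./2) x).
by case: (odd b) => //; rewrite subr_ge0.
Qed.

Lemma next_w_sum l x : \sum_(b < 2 ^ k.+1) next_w l b x = 1.
Proof.
rewrite (sum_expS k (fun b => next_w l b x)) -(ts_w1 st x).
by apply: eq_bigr => i _; rewrite next_w_even next_w_odd -mulrDr addrC subrK mulr1.
Qed.

Lemma w_le1 i x : (i < 2 ^ k)%N -> w i x <= 1.
Proof.
move=> ik; rewrite -(ts_w1 st x) (bigD1 (Ordinal ik))//= lerDl.
by apply: sumr_ge0 => j _; exact: (ts_w0 st).
Qed.

Lemma level_le1 l x : `|\sum_(i < 2 ^ k) w i x * node_cos l i x| <= 1.
Proof.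
rewrite -[leRHS](ts_w1 st x); apply: (le_trans (ler_norm_sum _ _ _)).
apply: ler_sum => i _; rewrite normrM (ger0_norm (ts_w0 st i x)).
by rewrite -[leRHS]mulr1 ler_wpM2l ?(ts_w0 st)// norm_cos_le1.
Qed.

Lemma sum_sqr_le1 x : \sum_(i < 2 ^ k) w i x ^+ 2 <= 1.
Proof.
rewrite -(ts_w1 st x); apply: ler_sum => i _.
rewrite expr2 -[leRHS]mulr1 ler_wpM2l ?(ts_w0 st)//; exact: w_le1.
Qed.

Lemma trigpoly_sum_sqr : trigpoly (fun x => \sum_(i < 2 ^ k) w i x ^+ 2).
Proof. by apply: trigpoly_sum => i _; apply: trigpolyX; exact: (ts_w st). Qed.

Lemma sum_sqr_horner_cvg (P : {poly R}) :
  gmean a (fun x => \sum_(i < 2 ^ k) w i x ^+ 2 * P.[node_sin l i x]) @[l --> +oo]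
  --> circle_mean (fun t => P.[sin t]) * gmean a (fun x => \sum_(i < 2 ^ k) w i x ^+ 2).
Proof.
have tw (i : 'I_(2 ^ k)) : trigpoly (fun x => w i x ^+ 2) by apply: trigpolyX; exact: (ts_w st).
have E l : gmean a (fun x => \sum_(i < 2 ^ k) w i x ^+ 2 * P.[node_sin l i x]) =
   \sum_(i < 2 ^ k) gmean a (fun x => w i x ^+ 2 * P.[node_sin l i x]).
  rewrite (@gmean_sum _ _ a _ _ (fun (i : 'I_(2 ^ k)) x => w i x ^+ 2 * P.[node_sin l i x]))// => i.
  by apply: trigpolyM => //; exact/trigpoly_horner/trigpoly_sin.
rewrite (funext E) (@gmean_sum _ _ a _ _ (fun (i : 'I_(2 ^ k)) x => w i x ^+ 2))// mulr_sumr.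
apply: cvg_sum_fun => i; apply: (harmonic_mean_cvg a0 _ (tw i) (harmonic_horner_sin P)).
exact: Xi_neq0.
Qed.

(** By [q_var] the limiting loss in the sum of squares is at most [I1 / (4 * M)], half of what one
    level may lose; the strict gap makes the bound hold at all large scales. *)
Lemma next_conc : \forall l \near +oo,
  (1 - k.+1%:R / (2 * M)) * I1 <= gmean a (fun x => \sum_(b < 2 ^ k.+1) next_w l b x ^+ 2).
Proof.
have I0 := I1_gt0; have M1 := M_ge1.
pose S x := \sum_(i < 2 ^ k) w i x ^+ 2.
pose V l x := \sum_(i < 2 ^ k) w i x ^+ 2 * (2 *: q * (1 - q)).[node_sin l i x].
have E l x : \sum_(b < 2 ^ k.+1) next_w l b x ^+ 2 = S x - V l x.
  rewrite (sum_expS k (fun b => next_w l b x ^+ 2)) -sumrB; apply: eq_bigr => i _.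
  by rewrite next_w_even next_w_odd !hornerE /=; ring.
have tV l : trigpoly (V l).
  apply: trigpoly_sum => i _; apply: trigpolyM; first by apply: trigpolyX; exact: (ts_w st).
  exact/trigpoly_horner/trigpoly_sin.
have SI : gmean a S <= I1.
  apply: gmean_le => //; last exact: sum_sqr_le1.
  - exact/trigpoly_bmeasurable/trigpoly_sum_sqr.
  - exact: bmeasurable_cst.
have lim_lt : circle_mean (fun t => (2 *: q * (1 - q)).[sin t]) * gmean a S < I1 / (2 * M).
  apply: (@le_lt_trans _ _ ((4 * M)^-1 * I1)).
    have S0 : 0 <= gmean a S.
      rewrite -[leLHS](mul0r (gauss_mass a ^+ n)) -gmean_cst//; apply: gmean_le => //.
      - exact: bmeasurable_cst.
      - exact/trigpoly_bmeasurable/trigpoly_sum_sqr.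
      - by move=> x; apply: sumr_ge0 => i _; rewrite sqr_ge0.
    apply: (@le_trans _ _ ((4 * M)^-1 * gmean a S)); first by rewrite ler_wpM2r.
    by rewrite ler_wpM2l// invr_ge0 mulr_ge0//; lra.
  rewrite mulrC ltr_pM2l// ltf_pV2 ?posrE; lra.
have /cvgr_lt/(_ _ lim_lt) H := sum_sqr_horner_cvg (P := 2 *: q * (1 - q)).
near=> l; have Hl : gmean a (V l) < I1 / (2 * M) by near: l; exact: H.
rewrite (eq_gmean a (E l)).
have -> : gmean a (fun x => S x - V l x) = gmean a S - gmean a (V l).
  have bS := trigpoly_bmeasurable trigpoly_sum_sqr; have bV := trigpoly_bmeasurable (tV l).
  rewrite -[- gmean a (V l)]mulN1r -gmeanZ// -gmeanD//; last exact: bmeasurableZ.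
  by apply: eq_gmean => x; rewrite mulN1r.
have := ts_conc st; rewrite -/S -[k.+1%:R]natr1.
have -> : (1 - (k%:R + 1) / (2 * M)) * I1 = (1 - k%:R / (2 * M)) * I1 - I1 / (2 * M).
  by field; lra.
lra.
Unshelve. all: by end_near. Qed.

Definition cross_sign (i j : nat) : R :=
  if j == i then 0 else if (i < j)%N then 1 else -1.

(** Both children of [i] lie on the same side of the cut of any other node [j], where the shares q
    and 1 - q add up to 1. Only the cut of [i] itself separates them and leaves 2 q - 1. *)
Lemma next_corrE l x : \sum_(b < 2 ^ k.+1) next_w l b x * next_A l b x =
  \sum_(i < 2 ^ k) w i x * A i x
  + \sum_(i < 2 ^ k) w i x ^+ 2 * ('X * (2 *: q - 1)).[node_sin l i x]
  + \sum_(i < 2 ^ k) \sum_(j < 2 ^ k) (cross_sign i j * (w i x * w j x)) * node_sin l j x.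
Proof.
rewrite (sum_expS k (fun b => next_w l b x * next_A l b x)) -!big_split; apply: eq_bigr => i _.
rewrite next_w_even next_w_odd /next_A doubleK [(i.*2.+1)./2]/= uphalf_double.
rewrite !hornerE /=; set s := node_sin l i x; set Q := q.[s].
set X0 := \sum_(j < 2 ^ k) side i.*2 j * _; set X1 := \sum_(j < 2 ^ k) side i.*2.+1 j * _.
have -> : w i x * Q * (A i x + X0) + w i x * (1 - Q) * (A i x + X1) =
  w i x * A i x + w i x * (Q * X0 + (1 - Q) * X1) by ring.
have -> : Q * X0 + (1 - Q) * X1 =
   \sum_(j < 2 ^ k) ((if j == i then w i x * (s * (2 * Q - 1)) else 0) + cross_sign i j * w j x * node_sin l j x).
  rewrite /X0 /X1 !mulr_sumr -big_split; apply: eq_bigr => j _ /=.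
  rewrite /cross_sign /side ltnS leq_double ltnS ltn_double -val_eqE/=.
  by case: (ltngtP j i) => [ji|ij|/val_inj ->]; rewrite /s; ring.
rewrite big_split /= -big_mkcond big_pred1_eq mulrDr mulr_sumr -addrA.
congr (_ + (_ + _)); first by ring.
by apply: eq_bigr => j _; ring.
Qed.

(* The frequency of node j oscillates against weights built before it. *)
Lemma cross_cvg0 :
  gmean a (fun x => \sum_(i < 2 ^ k) \sum_(j < 2 ^ k) (cross_sign i j * (w i x * w j x)) * node_sin l j x)
    @[l --> +oo] --> (0 : R).
Proof.
have tT (i j : nat) : trigpoly (fun x => cross_sign i j * (w i x * w j x)).
  by apply/trigpolyZ/trigpolyM; exact: (ts_w st).
have tTs l (i j : nat) : trigpoly (fun x => (cross_sign i j * (w i x * w j x)) * node_sin l j x).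
  by apply: trigpolyM; [exact: tT | exact: trigpoly_sin].
have E l : gmean a (fun x => \sum_(i < 2 ^ k) \sum_(j < 2 ^ k) (cross_sign i j * (w i x * w j x)) * node_sin l j x)
  = \sum_(i < 2 ^ k) \sum_(j < 2 ^ k) gmean a (fun x => (cross_sign i j * (w i x * w j x)) * node_sin l j x).
  rewrite (@gmean_sum _ _ a _ _ (fun (i : 'I_(2 ^ k)) x => \sum_(j < 2 ^ k) (cross_sign i j * (w i x * w j x)) * node_sin l j x))//; last first.
    by move=> i; apply: trigpoly_sum => j _; exact: tTs.
  apply: eq_bigr => i _.
  by rewrite (@gmean_sum _ _ a _ _ (fun (j : 'I_(2 ^ k)) x => (cross_sign i j * (w i x * w j x)) * node_sin l j x)).
rewrite (funext E).
have h0 : \sum_(i < 2 ^ k) \sum_(j < 2 ^ k) (0 : R) = 0 by rewrite big1// => i _; rewrite big1.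
rewrite -[X in _ --> X]h0.
apply: cvg_sum_fun => i; apply: cvg_sum_fun => j.
have := riemann_lebesgue (- (pi / 2)) a0 (Xi_neq0 (ltn_ord j)) (tT i j).
by under eq_fun do under eq_gmean do rewrite -sin_wave.
Qed.

Lemma next_corr : \forall l \near +oo,
  k.+1%:R / 16 * I1 <= gmean a (fun x => \sum_(b < 2 ^ k.+1) next_w l b x * next_A l b x).
Proof.
have I0 := I1_gt0; have M1 := M_ge1.
pose S x := \sum_(i < 2 ^ k) w i x ^+ 2.
pose P : {poly R} := 'X * (2 *: q - 1).
pose B x := \sum_(i < 2 ^ k) w i x * A i x.
pose V l x := \sum_(i < 2 ^ k) w i x ^+ 2 * P.[node_sin l i x].
pose X l x := \sum_(i < 2 ^ k) \sum_(j < 2 ^ k) (cross_sign i j * (w i x * w j x)) * node_sin l j x.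
have S2 : I1 / 2 <= gmean a S.
  apply: le_trans (ts_conc st).
  have h : k%:R / (2 * M) <= 2^-1.
    rewrite ler_pdivrMr; last by lra.
    by rewrite mulrA mulVf// mul1r /M ler_nat ltnW.
  have := ler_wpM2r (ltW I0) h; lra.
(* The limit is at least [I1 / 8], from the drift 1/4 and the concentration 1/2. Giving up something
   for finite scales, 1/10 - 1/100 still exceeds the required 1/16. *)
have lim_gt : I1 / 10 < circle_mean (fun t => P.[sin t]) * gmean a S.
  have : 4^-1 * gmean a S <= circle_mean (fun t => P.[sin t]) * gmean a S.
    by rewrite ler_wpM2r// (le_trans _ S2)//; lra.
  lra.
have /cvgr_gt/(_ _ lim_gt) HV := sum_sqr_horner_cvg (P := P).
have I80 : - (I1 / 100) < 0 by lra.
have /cvgr_gt/(_ _ I80) HX := cross_cvg0.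
have tB : trigpoly B by apply: trigpoly_sum => i _; apply: trigpolyM; [exact: (ts_w st)|exact: (ts_A st)].
have tV l : trigpoly (V l).
  apply: trigpoly_sum => i _; apply: trigpolyM; first by apply: trigpolyX; exact: (ts_w st).
  exact/trigpoly_horner/trigpoly_sin.
have tX l : trigpoly (X l).
  apply: trigpoly_sum => i _; apply: trigpoly_sum => j _; apply: trigpolyM; last exact: trigpoly_sin.
  by apply/trigpolyZ/trigpolyM; exact: (ts_w st).
near=> l.
have HVl : I1 / 10 < gmean a (V l) by near: l; exact: HV.
have HXl : - (I1 / 100) < gmean a (X l) by near: l; exact: HX.
rewrite (eq_gmean a (next_corrE l)).
have -> : gmean a (fun x => B x + V l x + X l x) = gmean a B + gmean a (V l) + gmean a (X l).
  rewrite -!gmeanD//; try exact: trigpoly_bmeasurable.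
  by apply: trigpoly_bmeasurable; exact: trigpolyD.
have := ts_corr st; rewrite -/B -[k.+1%:R]natr1.
have -> : (k%:R + 1) / 16 * I1 = k%:R / 16 * I1 + I1 / 16 by field.
lra.
Unshelve. all: by end_near. Qed.

Lemma moment_cross_cvg0 :
  gmean a (fun x => \sum_(i < 2 ^ k)
     (2 * r.+1%:R * ((M + F x ^+ 2) ^+ r * F x * w i x)) * node_cos l i x) @[l --> +oo] --> (0 : R).
Proof.
have tF := ts_F st.
have tT (i : nat) : trigpoly (fun x => 2 * r.+1%:R * ((M + F x ^+ 2) ^+ r * F x * w i x)).
  apply: trigpolyZ; apply: trigpolyM; last exact: (ts_w st).
  apply: trigpolyM => //; apply: trigpolyX; apply: trigpolyD; first exact: trigpoly_cst.
  exact: trigpolyX.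
have E l : gmean a (fun x => \sum_(i < 2 ^ k)
     (2 * r.+1%:R * ((M + F x ^+ 2) ^+ r * F x * w i x)) * node_cos l i x) =
  \sum_(i < 2 ^ k) gmean a (fun x => (2 * r.+1%:R * ((M + F x ^+ 2) ^+ r * F x * w i x)) * node_cos l i x).
  rewrite (@gmean_sum _ _ a _ _ (fun (i : 'I_(2 ^ k)) x =>
    (2 * r.+1%:R * ((M + F x ^+ 2) ^+ r * F x * w i x)) * node_cos l i x))// => i.
  by apply: trigpolyM; [exact: tT | exact: trigpoly_cos].
rewrite (funext E).
have h0 : \sum_(i < 2 ^ k) (0 : R) = 0 by rewrite big1.
rewrite -[X in _ --> X]h0; apply: cvg_sum_fun => i.
have := riemann_lebesgue 0 a0 (Xi_neq0 (ltn_ord i)) (tT i).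
by under eq_fun do under eq_gmean do rewrite /wave addr0.
Qed.

(** The 1 added to [moment_const r.+1] pays for the cross term, which is small but not zero at a
    finite scale: it is made smaller than 1/M times a lower bound of the moment. *)
Lemma next_mom : \forall l \near +oo, gmean a (fun x => (M + next_F l x ^+ 2) ^+ r.+1)
    <= (1 + (moment_const r.+1 + 1) / M) ^+ k.+1 * (M ^+ r.+1 * I1).
Proof.
have I0 := I1_gt0; have M1 := M_ge1; have tF := ts_F st.
have M0 : 0 < M by lra.
have tP G : trigpoly G -> trigpoly (fun x => (M + G x ^+ 2) ^+ r.+1).
  by move=> tG; apply: trigpolyX; apply: trigpolyD; [exact: trigpoly_cst | exact: trigpolyX].
pose Z l x := \sum_(i < 2 ^ k)
     (2 * r.+1%:R * ((M + F x ^+ 2) ^+ r * F x * w i x)) * node_cos l i x.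
have tZ l : trigpoly (Z l).
  apply: trigpoly_sum => i _; apply: trigpolyM; last exact: trigpoly_cos.
  apply: trigpolyZ; apply: trigpolyM; last exact: (ts_w st).
  apply: trigpolyM => //; apply: trigpolyX; apply: trigpolyD; first exact: trigpoly_cst.
  exact: trigpolyX.
have pos : 0 < M ^+ r.+1 * I1 / M by rewrite divr_gt0// mulr_gt0// exprn_gt0.
have /cvgr_lt/(_ _ pos) HZ := moment_cross_cvg0.
near=> l.
have HZl : gmean a (Z l) < M ^+ r.+1 * I1 / M by near: l; exact: HZ.
pose X := gmean a (fun x => (M + F x ^+ 2) ^+ r.+1).
have X0 : M ^+ r.+1 * I1 <= X.
  rewrite /I1 -gmeanZ//; last exact: bmeasurable_cst.
  apply: gmean_le => //.
  - exact/bmeasurableZ/bmeasurable_cst.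
  - exact/trigpoly_bmeasurable/tP.
  - by move=> x; rewrite mulr1 lerXn2r ?nnegrE ?(ltW M0)// ?addr_ge0 ?sqr_ge0 ?(ltW M0)// lerDl sqr_ge0.
have C0 := @moment_const_ge0 R r.+1.
apply: (@le_trans _ _ ((1 + moment_const r.+1 / M) * X + gmean a (Z l))).
  rewrite /X -gmeanZ//; last exact/trigpoly_bmeasurable/tP.
  rewrite -gmeanD//; last 2 first.
  - exact/bmeasurableZ/trigpoly_bmeasurable/tP.
  - exact/trigpoly_bmeasurable.
  apply: gmean_le => //.
  - exact/trigpoly_bmeasurable/tP/trigpoly_next_F.
  - apply: bmeasurableD; last exact/trigpoly_bmeasurable.
    exact/bmeasurableZ/trigpoly_bmeasurable/tP.
  move=> x; have := moment_step r (F x) M1 (level_le1 l x); rewrite -/(next_F l x).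
  move/le_trans; apply; rewrite lerD2l /Z mulr_sumr le_eqVlt; apply/orP; left.
  by apply/eqP; apply: eq_bigr => i _; ring.
have h2 : M ^+ r.+1 * I1 / M <= X / M by rewrite ler_wpM2r// invr_ge0 ltW.
apply: (@le_trans _ _ ((1 + (moment_const r.+1 + 1) / M) * X)).
  have -> : (1 + (moment_const r.+1 + 1) / M) * X = (1 + moment_const r.+1 / M) * X + X / M by ring.
  lra.
rewrite exprS -mulrA; apply: ler_wpM2l; last exact: (ts_mom st).
by rewrite addr_ge0// divr_ge0 ?(ltW M0)// addr_ge0.
Unshelve. all: by end_near. Qed.

Lemma next_hilb : \forall l \near +oo, forall j x, (j < 2 ^ m)%N ->
    `|ghilb (L j) (next_F l) x - kap * (gaussian 1 x * next_A l (j %/ 2 ^ (m - k.+1))%N x)|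
    <= k.+1%:R * e * (1 + enorm x).
Proof.
have K0 : 0 < (2 ^ k)%:R :> R by rewrite ltr0n expn_gt0.
(* The error [e] allowed to the level is shared equally by its nodes. *)
have eK : 0 < e / (2 ^ k)%:R by rewrite divr_gt0.
have H (i : 'I_(2 ^ k)) (j : 'I_(2 ^ m)) := ghilb_modulated (L1 (ltn_ord j))
  (XiL km (ltn_ord i) (ltn_ord j)).1 (ts_w st i) eK.
have HH := filter_forall _ (fun i => filter_forall _ (H i)).
near=> l => j x jm.
have Hl : forall (i : 'I_(2 ^ k)) (j : 'I_(2 ^ m)) x, `|ghilb (L j) (fun x => w i x * cos (dotv (l *: Xi k i) x)) x
   - Num.sg (dotv (Xi k i) (L j)) * (pi^-1 * pv_const) *
   (gaussian 1 x * (w i x * sin (dotv (l *: Xi k i) x)))| <= e / (2 ^ k)%:R * (1 + enorm x).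
  by near: l; exact: HH.
have tw i : trigpoly (fun x => w i x * node_cos l i x).
  by apply: trigpolyM; [exact: (ts_w st) | exact: trigpoly_cos].
rewrite ghilbD//; last 3 first.
- exact: L1.
- exact: (ts_F st).
- by apply: trigpoly_sum => i _; exact: tw.
rewrite (@ghilb_sum _ _ _ _ _ (fun (i : 'I_(2 ^ k)) x => w i x * node_cos l i x))//; last exact: L1.
rewrite /next_A; set b := (j %/ _)%N.
have -> : b./2 = (j %/ 2 ^ (m - k))%N.
  by rewrite -divn2 /b -divnMA -expnSr subnSK.
set T := A _ x.
have -> : ghilb (L j) F x + \sum_(i < 2 ^ k) ghilb (L j) (fun x => w i x * node_cos l i x) x -
   kap * (gaussian 1 x * (T + \sum_(i < 2 ^ k) side b i * (w i x * node_sin l i x))) =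
   (ghilb (L j) F x - kap * (gaussian 1 x * T)) +
   \sum_(i < 2 ^ k) (ghilb (L j) (fun x => w i x * node_cos l i x) x -
     side b i * kap * (gaussian 1 x * (w i x * node_sin l i x))).
  rewrite sumrB [gaussian 1 x * (T + _)]mulrDr mulrDr !mulr_sumr.
  rewrite opprD addrACA; congr (_ + (_ - _)).
  by apply: eq_bigr => i _; ring.
apply: (le_trans (ler_normD _ _)).
have -> : k.+1%:R * e * (1 + enorm x) = k%:R * e * (1 + enorm x) + \sum_(i < 2 ^ k) (e / (2 ^ k)%:R * (1 + enorm x)).
  rewrite sumr_const card_ord -mulr_natl -natr1; field.
  by rewrite gt_eqF.
apply: lerD; first exact: (ts_hilb st).
apply: (le_trans (ler_norm_sum _ _ _)); apply: ler_sum => i _.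
have [_ sgE] := XiL km (ltn_ord i) jm.
by have := Hl i (Ordinal jm) x; rewrite /= sgE.
Unshelve. all: by end_near. Qed.

Lemma tree_step : exists F' w' A', tree_state k.+1 F' w' A'.
Proof.
suff [l [h1 [h2 [h3 h4]]]] : exists l, 
  (gmean a (fun x => (M + next_F l x ^+ 2) ^+ r.+1)
    <= (1 + (moment_const r.+1 + 1) / M) ^+ k.+1 * (M ^+ r.+1 * I1)) /\
  ((1 - k.+1%:R / (2 * M)) * I1 <= gmean a (fun x => \sum_(b < 2 ^ k.+1) next_w l b x ^+ 2)) /\
  (forall j x, (j < 2 ^ m)%N ->
    `|ghilb (L j) (next_F l) x - kap * (gaussian 1 x * next_A l (j %/ 2 ^ (m - k.+1))%N x)|
    <= k.+1%:R * e * (1 + enorm x)) /\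
  (k.+1%:R / 16 * I1 <= gmean a (fun x => \sum_(b < 2 ^ k.+1) next_w l b x * next_A l b x)).
  exists (next_F l), (next_w l), (next_A l); split=> //.
  - exact: trigpoly_next_F.
  - exact: trigpoly_next_w.
  - exact: trigpoly_next_A.
  - exact: next_w_ge0.
  - exact: next_w_sum.
have h1 := next_mom; have h2 := next_conc; have h3 := next_hilb; have h4 := next_corr.
near (+oo : set_system R) => l.
exists l; split; [|split; [|split]]; near: l; [exact: h1|exact: h2|exact: h3|exact: h4].
Unshelve. all: by end_near. Qed.

End step.

Lemma tree_exists : exists F w A, tree_state m F w A.
Proof.
suff H k : (k <= m)%N -> exists F w A, tree_state k F w A by exact: H.
elim: k => [_|k IH km]; first by do 3!eexists; exact: tree_state0.
have [F [w [A st]]] := IH (ltnW km).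
exact: (tree_step km st).
Qed.

End tree_construction.

(** * Frequencies separating the directions *)

Section separating_frequencies.
Context {R : realType} {n : nat}.
Local Notation Rn := 'rV[R]_n.
Implicit Types (v b : Rn) (s : seq Rn).

Lemma dotv_eq0 v : (dotv v v == 0) = (v == 0).
Proof.
apply/idP/idP => [|/eqP->]; last by rewrite dotv0l.
rewrite /dotv psumr_eq0; last by move=> i _; rewrite -expr2 sqr_ge0.
move=> /allP h; apply/eqP/rowP => i; rewrite mxE.
by have := h i (mem_index_enum i); rewrite /= -expr2 sqrf_eq0 => /eqP.
Qed.

(** If [b] is orthogonal to the new vector [v], it is moved along [v] by a [t] beyond every value at
    which an older vector could become orthogonal. *)
Lemma exists_generic s : (forall v, v \in s -> v != 0) ->
  exists b, forall v, v \in s -> dotv v b != 0.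
Proof.
elim: s => [_|v s IH hs]; first by exists 0.
have [|b hb] := IH; first by move=> u us; apply: hs; rewrite inE us orbT.
have v0 : dotv v v != 0 by rewrite dotv_eq0 hs// inE eqxx.
have [vb|vb] := eqVneq (dotv v b) 0; last first.
  by exists b => u; rewrite inE => /predU1P[->|/hb].
pose t : R := 1 + \sum_(u <- s) `|dotv u b / dotv u v|.
have t0 : 0 < t by rewrite ltr_wpDr//; apply: sumr_ge0.
exists (b + t *: v) => u; rewrite inE dotvDr dotvZr => /predU1P[->|us].
  by rewrite vb add0r mulf_neq0// gt_eqF.
have [->|uv] := eqVneq (dotv u v) 0; first by rewrite mulr0 addr0 hb.
apply/negP => /eqP h.
have tE : t = - (dotv u b / dotv u v).
  by apply: (mulIf uv); rewrite mulNr divfK//; apply/eqP; rewrite -addr_eq0 addrC h.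
have : t < t; last by rewrite ltxx.
rewrite {1}tE; apply: (le_lt_trans (ler_norm _)); rewrite normrN /t.
apply: (@le_lt_trans _ _ (\sum_(u <- s) `|dotv u b / dotv u v|)); last by rewrite ltrDr.
by rewrite (big_rem u us)/= lerDl; apply: sumr_ge0.
Qed.

Lemma exists_half_space s : (forall v, v \in s -> v != 0) ->
  exists b, (forall v, v \in s -> dotv v b != 0) /\
    (size s <= 2 * count (fun v => 0 < dotv v b)%R s)%N.
Proof.
move=> /exists_generic[b hb].
have E : (count (fun v => 0 < dotv v b)%R s + count (fun v => 0 < dotv v (- b))%R s)%N = size s.
  rewrite -(count_predC (fun v => 0 < dotv v b)%R s); congr addn.
  apply: eq_in_count => v /hb vb /=; rewrite dotvNr oppr_gt0.
  by rewrite lt_neqAle vb/= leNgt.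
have [h|h] := leqP (size s) (2 * count (fun v => 0 < dotv v b)%R s).
  by exists b.
exists (- b); split => [v /hb|]; first by rewrite dotvNr oppr_eq0.
lia.
Qed.

(** The directions with v.b > 0 are ordered by the slope f v = v.a / v.b, and (sigma b - a).v =
    (v.b) (sigma - f v) changes sign exactly at the slope sigma. At least half of [s] can be kept,
    hence [m.+2]. *)
Lemma exists_separating_frequencies s : uniq s -> s != [::] ->
  (forall v, v \in s -> enorm v = 1) ->
  exists m (L xi : nat -> Rn), [/\ (0 < m)%N, (size s <= 2 ^ m.+2)%N,
    forall l, (l < 2 ^ m)%N -> L l \in s \/ - L l \in s &
    forall j l, (0 < j < 2 ^ m)%N -> (l < 2 ^ m)%N ->
      if (l < j)%N then 0 < dotv (xi j) (L l) else dotv (xi j) (L l) < 0].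
Proof.
move=> us s0 s1.
have sn0 v : v \in s -> v != 0.
  move=> /s1 v1; apply: contra_eq_neq v1 => ->.
  by rewrite eq_sym -(@eqrXn2 _ 2)// ?enorm_ge0// expr1n enorm_sqr dotv0l oner_eq0.
have [b [hb hs]] := exists_half_space sn0.
pose P := [seq v <- s | 0 < dotv v b].
have Ps v : v \in P -> v \in s by rewrite mem_filter => /andP[].
have Pb v : v \in P -> 0 < dotv v b by rewrite mem_filter => /andP[].
(* Equal slopes mean that [a] is orthogonal to such a difference; a difference that is 0 forces
   equality of the two unit vectors. So an [a] generic for [D] makes the slopes distinct. *)
pose D := [seq d <- [seq dotv v' b *: v - dotv v b *: v' | v <- P, v' <- P] | d != 0].
have [|a ha] := @exists_generic D; first by move=> d; rewrite mem_filter => /andP[].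
pose f v := dotv v a / dotv v b.
have f_inj : {in P &, injective f}.
  move=> v v' vP v'P ff; apply/eqP.
  have bv := Pb _ vP; have bv' := Pb _ v'P.
  have da : dotv (dotv v' b *: v - dotv v b *: v') a = 0.
    rewrite dotvDl dotvNl !dotvZl.
    move: ff; rewrite /f => /(congr1 (fun z => z * (dotv v b * dotv v' b))).
    rewrite mulrA divfK ?gt_eqF// [dotv v b * _]mulrC mulrA divfK ?gt_eqF// => ff.
    by rewrite [dotv v' b * _]mulrC ff mulrC subrr.
  have d0 : dotv v' b *: v - dotv v b *: v' = 0.
    apply/eqP; apply: contraT => dn.
    have : dotv (dotv v' b *: v - dotv v b *: v') a != 0.
      by apply: ha; rewrite mem_filter dn/=; exact: allpairs_f.
    by rewrite da eqxx.
  have vv : dotv v v = 1 by rewrite -enorm_sqr s1 ?expr1n// Ps.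
  have vv' : dotv v' v' = 1 by rewrite -enorm_sqr s1 ?expr1n// Ps.
  move/eqP: d0; rewrite subr_eq0 => /eqP d0.
  have eb : dotv v' b = dotv v b.
    have := congr1 (fun u => dotv u u) d0; rewrite !dotvZl !dotvZr vv vv' !mulr1 -!expr2.
    by move/eqP; rewrite eqrXn2// ?ltW// => /eqP.
  by move: d0; rewrite eb => /scalerI -> //; rewrite gt_eqF.
pose le_f := relpre f <=%R.
have le_f_tr : transitive le_f by move=> x y z; exact: le_trans.
have le_f_tot : total le_f by move=> x y; exact: le_total.
have le_f_refl : reflexive le_f by move=> x; exact: lexx.
pose Q := sort le_f P; pose N := size Q.
have QP v : (v \in Q) = (v \in P) by rewrite mem_sort.
have uQ : uniq Q by rewrite sort_uniq filter_uniq.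
have NE : N = count (fun v => 0 < dotv v b) s by rewrite /N size_sort size_filter.
have N0 : (0 < N)%N.
  have : (0 < size s)%N by rewrite lt0n size_eq0.
  lia.
pose S l := f (nth 0 Q l).
have nthP l : (l < N)%N -> nth 0 Q l \in P by move=> lN; rewrite -QP mem_nth.
have S_le i j : (i <= j)%N -> (j < N)%N -> S i <= S j.
  move=> ij jN.
  apply: (sorted_leq_nth le_f_tr le_f_refl 0 (sort_sorted le_f_tot P)) => //.
  by rewrite inE (leq_ltn_trans ij).
have S_lt i j : (i < j)%N -> (j < N)%N -> S i < S j.
  move=> ij jN; have iN := ltn_trans ij jN.
  rewrite lt_neqAle S_le ?(ltnW ij)// andbT; apply/eqP => /f_inj.
  move=> /(_ (nthP _ iN) (nthP _ jN)) /eqP; rewrite nth_uniq// => /eqP E.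
  by rewrite E ltnn in ij.
(* The midpoint of consecutive slopes; beyond the last slope any larger number will do. *)
pose sig j := if (j < N)%N then (S j.-1 + S j) / 2 else S j.-1 + 1.
(* The opposite of the first direction is a further leaf at the end: for [0 < j] the frequency is
   positive on the first direction, so negative on its opposite. This gives two leaves, and [0 < m],
   even when [N = 1]. *)
pose L l := if (l < N)%N then nth 0 Q l else - nth 0 Q 0.
have m2 : (2 ^ trunc_log 2 N.+1 <= N.+1)%N by rewrite trunc_logP.
exists (trunc_log 2 N.+1), L, (fun j => sig j *: b - a); split.
- by rewrite trunc_log_gt0.
- have : (N.+1 < 2 ^ (trunc_log 2 N.+1).+1)%N by rewrite trunc_log_ltn.
  by rewrite [(2 ^ _.+2)%N]expnS; move: hs; rewrite -NE; lia.
- move=> l /leq_trans/(_ m2) lN; rewrite /L; case: ifP => lN'.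
    by left; exact/Ps/nthP.
  by right; rewrite opprK; exact/Ps/nthP.
move=> j l /andP[j0 /leq_trans/(_ m2) jN] /leq_trans/(_ m2) lN.
have jN1 : (j.-1 < N)%N by lia.
have sig_gt i : (i < j)%N -> S i < sig j.
  move=> ij; have h : S i <= S j.-1 by apply: S_le => //; lia.
  apply: (le_lt_trans h); rewrite /sig; case: ifP => jN'; last by rewrite ltrDl.
  have := @S_lt j.-1 j; rewrite prednK// leqnn jN' => /(_ isT isT); lra.
have sig_lt i : (j <= i)%N -> (i < N)%N -> sig j < S i.
  move=> ji iN; apply: (@lt_le_trans _ _ (S j)); last exact: S_le.
  rewrite /sig (leq_ltn_trans ji iN).
  have := @S_lt j.-1 j; rewrite prednK// leqnn (leq_ltn_trans ji iN) => /(_ isT isT); lra.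
have xiE i : (i < N)%N -> dotv (sig j *: b - a) (nth 0 Q i) = dotv (nth 0 Q i) b * (sig j - S i).
  move=> iN; rewrite dotvC dotvDr dotvNr dotvZr mulrBr /S /f mulrCA divff ?mulr1; last first.
    by rewrite gt_eqF// Pb// nthP.
  by rewrite mulrC.
rewrite /L; case: ltnP => lj.
  have lN' : (l < N)%N by lia.
  by rewrite lN' xiE// mulr_gt0 ?Pb ?nthP// subr_gt0 sig_gt.
case: ifP => lN'.
  by rewrite xiE// pmulr_rlt0 ?Pb ?nthP// subr_lt0 sig_lt.
by rewrite dotvNr xiE// oppr_lt0 mulr_gt0 ?Pb ?nthP// subr_gt0 sig_gt.
Qed.

(** Node [(k, i)] takes the cut at the middle of its block of leaves, which begins at
    [i * 2 ^ (m - k)]. *)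
Lemma exists_binary_frequencies s : uniq s -> s != [::] ->
  (forall v, v \in s -> enorm v = 1) ->
  exists m (L : nat -> Rn) (Xi : nat -> nat -> Rn), [/\ (0 < m)%N, (size s <= 2 ^ m.+2)%N,
    forall l, (l < 2 ^ m)%N -> L l \in s \/ - L l \in s &
    forall k i l, (k < m)%N -> (i < 2 ^ k)%N -> (l < 2 ^ m)%N ->
      dotv (Xi k i) (L l) != 0 /\
      Num.sg (dotv (Xi k i) (L l)) = side (l %/ 2 ^ (m - k.+1)) i].
Proof.
move=> us s0 s1.
have [m [L [xi [m0 hm hL hxi]]]] := exists_separating_frequencies us s0 s1.
exists m, L, (fun k i => xi (i.*2.+1 * 2 ^ (m - k.+1))%N); split=> // k i l km ik lm.
have j0 : (0 < i.*2.+1 * 2 ^ (m - k.+1) < 2 ^ m)%N.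
  rewrite muln_gt0 expn_gt0/= -{2}(subnKC km) expnD ltn_pmul2r ?expn_gt0//.
  rewrite expnS; lia.
have := hxi _ _ j0 lm; rewrite /side ltn_divLR ?expn_gt0//.
case: ifP => _ h; first by rewrite gt_eqF// gtr0_sg.
by rewrite lt_eqF// ltr0_sg.
Qed.

End separating_frequencies.

(** * Reversing a direction *)

Section reflection.
Context {R : realType} {n : nat}.
Local Notation Rn := 'rV[R]_n.
Implicit Types (v x : Rn) (T : Rn -> R).

(** The derivatives in [b] of the two sides agree, and at [b = 0] the claim is the oddness of
    [gauss_erf]. *)
Lemma pv_gaussN (b y x : R) : pv_gauss (- b) (- y) x = - pv_gauss b y x.
Proof.
pose D (b : R) := pv_gauss (- b) (- y) x + pv_gauss b y x.
have dD (z : R) : is_derive z 1 D 0.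
  have h1 := is_derive_pv_gauss_tilt z y x.
  have h2 := is_derive_pv_gauss_tilt (- z) (- y) x.
  have hN : is_derive z 1 (fun z : R => - z) (-1).
    by apply: is_derive_eq.
  have h3 := @is_derive1_comp _ (fun b => pv_gauss b (- y) x) (fun z => - z) z _ _ h2 hN.
  have h4 : is_derive z 1 (fun b => pv_gauss (- b) (- y) x) _ := h3.
  by apply: is_derive_eq; rewrite !sqrrN mulrNN mulrN1 addNr.
have := is_derive_0_is_cst b 0 dD; rewrite /D oppr0 !pv_gauss0E gauss_erfN.
by rewrite mulrN addNr => /eqP; rewrite addr_eq0 => /eqP.
Qed.

Lemma enormN v : enorm (- v) = enorm v.
Proof. by rewrite /enorm; congr Num.sqrt; apply: eq_bigr => i _; rewrite mxE sqrrN. Qed.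

(** A leaf may be the opposite of an element of [U]; the absolute value in the maximal function
    hides the sign. *)
Lemma ghilbN v T x : enorm v = 1 -> trigpoly T -> ghilb (- v) T x = - ghilb v T x.
Proof.
move=> v1 tT; have v1' : enorm (- v) = 1 by rewrite enormN.
pose P T := trigpoly T /\ ghilb (- v) T x = - ghilb v T x.
suff [] : P T by [].
move: tT; apply: trigpoly_ind_wave => [f g fg|| c h phi f [tf hf]].
- by rewrite (funext fg).
- split; first exact: trigpoly_cst.
  have h0 u : enorm u = 1 -> ghilb u (fun _ : Rn => 0 : R) x = 0.
    move=> u1; have E (c : R) : c = 0 -> ghilb u (fun _ : Rn => c) x = ghilb u (fun _ : Rn => 0) x by move->.
    rewrite -(E _ (mul0r 0)) (ghilbZ x 0 u1 (trigpoly_cst 0)).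
    exact: mul0r.
  rewrite (h0 _ v1) (h0 _ v1').
  by rewrite oppr0.
have tw := trigpoly_wave h phi; have tcw := trigpolyZ c tw.
split; first exact: trigpolyD.
rewrite !ghilbD// !ghilbZ// hf opprD; congr (_ + _).
rewrite /ghilb (has_pv_hilbert (has_pv_wave x h phi v1')) (has_pv_hilbert (has_pv_wave x h phi v1)).
by rewrite !dotvNr pv_gaussN; ring.
Qed.

End reflection.

(** * Norm bounds *)

Section Lp_bounds.
Context {R : realType}.

(* No measurability is needed, as the positive and negative parts are
   integrated by a supremum over simple functions. *)
Lemma le_integral_ext d (T : measurableType d) (mu : {measure set T -> \bar R}) (f g : T -> \bar R) :
  (forall x, (f x <= g x)%E) -> (\int[mu]_x f x <= \int[mu]_x g x)%E.
Proof.
move=> fg; rewrite /integral /=; apply: leeB.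
  apply: le_ereal_sup => _ [h hf <-]; exists h => // x; apply: (le_trans (hf x)).
  by rewrite !funeposE !patchT ?in_setT// ge_max !le_max fg lexx orbT.
apply: le_ereal_sup => _ [h hf <-]; exists h => // x; apply: (le_trans (hf x)).
by rewrite !funenegE !patchT ?in_setT// ge_max !le_max leeN2 fg lexx orbT.
Qed.

Context {n : nat}.
Local Notation Rn := 'rV[R]_n.
Local Notation mu := (lebesgue_Rn n).

(** The maximal function enters only through an explicit integrable minorant [Phi] of its power,
    which may be negative in places. *)
Lemma Lp_norm_ge (p c : R) (g Phi : Rn -> R) : 0 < p -> 0 <= c ->
  mu.-integrable setT (EFin \o (Phi \o row_of_tuple)) ->
  (forall x, Phi x <= `|g x| `^ p) ->
  c `^ p <= \int[mu]_t (Phi (row_of_tuple t)) ->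
  (c%:E <= Lp_norm p g)%E.
Proof.
move=> p0 c0 iPhi hPhi hc; rewrite /Lp_norm unlock /=.
have cE : c%:E = ((c `^ p)%:E `^ p^-1)%E by rewrite poweR_EFin -powRrM mulfV ?gt_eqF// powRr1.
rewrite cE; apply: gt0_ler_poweR.
- by rewrite invr_ge0 ltW.
- by rewrite in_itv/= leey lee_fin powR_ge0.
- by rewrite in_itv/= leey integral_ge0.
apply: (@le_trans _ _ (\int[mu]_t (Phi (row_of_tuple t))%:E)%E).
  have hi : (\int[mu]_t (Phi (row_of_tuple t))%:E)%E = (\int[mu]_t (Phi (row_of_tuple t)))%:E.
    by rewrite fineK//; exact: integrable_fin_num iPhi.
  by rewrite hi lee_fin.
apply: le_integral_ext => t.
by rewrite lee_fin; exact: hPhi.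
Qed.

Lemma Lp_norm_le (p c : R) (g Phi : Rn -> R) : 0 < p -> 0 <= c ->
  mu.-integrable setT (EFin \o (Phi \o row_of_tuple)) ->
  (forall x, `|g x| `^ p <= Phi x) ->
  \int[mu]_t (Phi (row_of_tuple t)) <= c `^ p ->
  (Lp_norm p g <= c%:E)%E.
Proof.
move=> p0 c0 iPhi hPhi hc; rewrite /Lp_norm unlock /=.
have cE : c%:E = ((c `^ p)%:E `^ p^-1)%E by rewrite poweR_EFin -powRrM mulfV ?gt_eqF// powRr1.
rewrite cE; apply: gt0_ler_poweR.
- by rewrite invr_ge0 ltW.
- by rewrite in_itv/= leey integral_ge0.
- by rewrite in_itv/= leey lee_fin powR_ge0.
apply: (@le_trans _ _ (\int[mu]_t (Phi (row_of_tuple t))%:E)%E); last first.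
  have hi : (\int[mu]_t (Phi (row_of_tuple t))%:E)%E = (\int[mu]_t (Phi (row_of_tuple t)))%:E.
    by rewrite fineK//; exact: integrable_fin_num iPhi.
  by rewrite hi lee_fin.
apply: le_integral_ext => t.
by rewrite lee_fin; exact: hPhi.
Qed.

Lemma le_1DpowR (y p : R) : 0 <= y -> 1 <= p -> y <= 1 + y `^ p.
Proof.
move=> y0 p1; have [y1|/ltW y1] := leP y 1.
  by apply: (le_trans y1); rewrite lerDl powR_ge0.
by have := ler_powR y1 p1; rewrite powRr1//; lra.
Qed.

Lemma gaussianD (a b : R) (x : Rn) : gaussian (a + b) x = gaussian a x * gaussian b x.
Proof. by rewrite /gaussian -expRD; congr expR; ring. Qed.

Lemma gaussian_ge0 (a : R) (x : Rn) : 0 <= gaussian a x.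
Proof. exact: expR_ge0. Qed.

Lemma gaussian_le1 (a : R) (x : Rn) : 0 <= a -> gaussian a x <= 1.
Proof. by move=> a0; rewrite -expR0 ler_expR oppr_le0 mulr_ge0// dotv_ge0. Qed.

Lemma gaussian_enorm (d : R) (x : Rn) : 0 < d ->
  gaussian d x * (1 + enorm x) <= 2 + d^-1.
Proof.
move=> d0; set s := enorm x; have s0 : 0 <= s := enorm_ge0 x.
have h : 1 + d * s ^+ 2 <= expR (d * s ^+ 2) := expR_ge1Dx _.
have -> : gaussian d x = (expR (d * s ^+ 2))^-1 by rewrite /gaussian -enorm_sqr expRN.
rewrite mulrC ler_pdivrMr ?expR_gt0//.
apply: (@le_trans _ _ ((2 + d^-1) * (1 + d * s ^+ 2))); last first.
  by rewrite ler_wpM2l// addr_ge0// invr_ge0 ltW.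
have -> : (2 + d^-1) * (1 + d * s ^+ 2) = 2 + d^-1 + 2 * (d * s ^+ 2) + s ^+ 2.
  by field; rewrite gt_eqF.
have h1 : 0 < d^-1 by rewrite invr_gt0.
have h2 : 0 <= d * s ^+ 2 by rewrite mulr_ge0 ?sqr_ge0// ltW.
have := sqr_ge0 (s - 1); lra.
Qed.

(** For y = H / lam, y - 1 <= y^p is multiplied by [gaussian (p - 1) x], which is at most 1. This
    completes [gaussian 1] to [gaussian p] in the main term, and half of its exponent, [d], absorbs
    [1 + enorm x] in the error. *)
Lemma Lp_norm_lower (p kap M e b : R) (H B : Rn -> R) : 1 < p -> 0 < M -> 0 < b -> 0 <= e ->
  bmeasurable B -> (forall x, 0 <= H x) ->
  (forall x, kap * (gaussian 1 x * B x) - M * e * (1 + enorm x) <= H x) ->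
  M * b <= kap * gmean p B ->
  e * (2 + ((p - 1) / 2)^-1) * gmean ((p - 1) / 2) (fun _ : Rn => 1) <= b / 2 ->
  ((M * (b / (4 * gmean (p - 1) (fun _ : Rn => 1))) * gmean (p - 1) (fun _ : Rn => 1) `^ p^-1)%:E
    <= Lp_norm p H)%E.
Proof.
move=> p1 M0 b0 e0 bB H0 hH hB he; set J := gmean (p - 1) _; set d := (p - 1) / 2 in he.
have dd : d + d = p - 1 by rewrite /d -splitr.
have d0 : 0 < d by rewrite divr_gt0// subr_gt0.
have b1 := @bmeasurable_cst R n 1.
have J0 : 0 < J by rewrite /J gmean1 ?subr_gt0// exprn_gt0// gauss_mass_gt0// subr_gt0.
(* With this [lam] the main term is at least [4 * J], the error at most [2 * J] and the constant 1
   costs [J]; the remaining [J] is what is claimed. *)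
set C := 2 + d^-1 in he; set lam := M * (b / (4 * J)).
have lam0 : 0 < lam by rewrite mulr_gt0// divr_gt0// mulr_gt0.
pose Phi x := lam `^ p * (kap / lam * (gaussian p x * B x) - M * e * C / lam * (gaussian d x * 1)
  - gaussian (p - 1) x * 1).
have p10 : 0 < p - 1 by rewrite subr_gt0.
have p0 : 0 < p by lra.
have i1 := integrable_gaussian p0 bB.
have i2 := integrable_gaussian d0 b1.
have i3 := integrable_gaussian p10 b1.
have i1' := integrableZl measurableT (kap / lam) i1.
have i2' := integrableZl measurableT (M * e * C / lam) i2.
have i12 := integrableB measurableT i1' i2'.
have i123 := integrableB measurableT i12 i3.
have i4 := integrableZl measurableT (lam `^ p) i123.
apply: (@Lp_norm_ge p _ _ Phi) => //.
- by rewrite mulr_ge0 ?powR_ge0// ltW.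
- move=> x; rewrite ger0_norm//.
  have -> : H x = lam * (H x / lam) by rewrite mulrC divfK// gt_eqF.
  rewrite powRM ?(ltW lam0)//; last by rewrite divr_ge0// ltW.
  rewrite /Phi ler_wpM2l ?powR_ge0//.
  set y := H x / lam; have y0 : 0 <= y by rewrite divr_ge0// ltW.
  have hy := le_1DpowR y0 (ltW p1).
  have w0 := gaussian_ge0 (p - 1) x; have w1 := gaussian_le1 x (ltW p10).
  apply: (@le_trans _ _ (gaussian (p - 1) x * y `^ p)); last first.
    by rewrite -[leRHS]mul1r ler_wpM2r// powR_ge0.
  apply: (@le_trans _ _ (gaussian (p - 1) x * (y - 1))); last first.
    by rewrite ler_wpM2l//; lra.
  apply: (@le_trans _ _ (gaussian (p - 1) x * ((kap * (gaussian 1 x * B x) - M * e * (1 + enorm x)) / lam - 1))); last first.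
    by rewrite ler_wpM2l// lerB// ler_wpM2r// invr_ge0 ltW.
  have -> : gaussian p x = gaussian (p - 1) x * gaussian 1 x by rewrite -gaussianD subrK.
  have E : gaussian (p - 1) x = gaussian d x * gaussian d x.
    by rewrite -gaussianD dd.
  have h := gaussian_enorm x d0.
  have h' : M * e / lam * (gaussian d x * (gaussian d x * (1 + enorm x))) <= M * e / lam * (gaussian d x * C).
    apply: ler_wpM2l; first exact: (divr_ge0 (mulr_ge0 (ltW M0) e0) (ltW lam0)).
    by apply: ler_wpM2l => //; exact: gaussian_ge0.
  have -> : gaussian (p - 1) x * ((kap * (gaussian 1 x * B x) - M * e * (1 + enorm x)) / lam - 1) =
    kap / lam * (gaussian (p - 1) x * gaussian 1 x * B x) -
    M * e / lam * (gaussian (p - 1) x * (1 + enorm x)) - gaussian (p - 1) x by ring.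
  rewrite mulr1 [X in _ - _ * (X * (1 + _)) - _]E -[gaussian d x * _ * (1 + _)]mulrA.
  lra.
rewrite powRM ?powR_ge0 ?(ltW lam0)// -powRrM mulVf ?gt_eqF// powRr1 ?(ltW J0)//.
have -> : \int[mu]_t Phi (row_of_tuple t) =
   lam `^ p * (kap / lam * gmean p B - M * e * C / lam * gmean d (fun _ : Rn => 1) - J).
  rewrite /Phi RintegralZl//; congr (_ * _).
  rewrite RintegralB//; congr (_ - _).
  by rewrite RintegralB// !RintegralZl.
rewrite ler_wpM2l ?powR_ge0//.
have h1 : 2 * (M * b / lam) <= 2 * (kap / lam * gmean p B).
  by rewrite ler_wpM2l// [leRHS]mulrAC ler_wpM2r// invr_ge0 ltW.
have h2 : M * e * C / lam * gmean d (fun _ : Rn => 1) <= M * (b / 2) / lam.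
  have -> : M * e * C / lam * gmean d (fun _ : Rn => 1) = M * (e * C * gmean d (fun _ : Rn => 1)) / lam by ring.
  by rewrite ler_wpM2r ?invr_ge0 ?(ltW lam0)// ler_wpM2l// ltW.
have h3 : M * b / lam = 4 * J.
  by rewrite /lam; field; rewrite !gt_eqF.
have h4 : M * (b / 2) / lam = 2 * J by rewrite -[RHS](mulfK (x := 2))//; move: h3; lra.
lra.
Qed.

End Lp_bounds.

(** * Both norms of the test function, and the logarithm *)

Section maximal_function.
Context {R : realType} {n : nat}.
Local Notation Rn := 'rV[R]_n.
Implicit Types (x v : Rn) (F : Rn -> R) (U : {fset Rn}).

Definition gauss_test F x : R[i] := Complex (gaussian 1 x * F x) 0.

Lemma cabs_ge0 (z : R[i]) : 0 <= cabs z.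
Proof. exact: sqrtr_ge0. Qed.

Lemma max_hilbert_ge0 U (f : Rn -> R[i]) x : 0 <= max_hilbert U f x.
Proof. exact: bigmax_ge_id. Qed.

Lemma ghilb_le_max_hilbert U v F x : v \in U ->
  `|ghilb v F x| <= max_hilbert U (gauss_test F) x.
Proof.
move=> vU; apply: (@le_trans _ _ (cabs (hilbert v (gauss_test F) x))).
  by rewrite -sqrtr_sqr ler_wsqrtr// /hilbert /= lerDl sqr_ge0.
exact: (order.Order.TotalTheory.le_bigmax_seq 0 v xpredT (fun v => cabs (hilbert v (gauss_test F) x)) vU isT).
Qed.

Lemma max_hilbert0 U x : max_hilbert U (fun _ : Rn => 0 : R[i]) x = 0.
Proof.
have h0 v : hilbert_real v (fun _ : Rn => 0 : R) x = 0.
  rewrite /hilbert_real (_ : (fun eps : R => _) = fun=> 0).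
    by rewrite lim_cst// mulr0.
  by apply/funext => eps; under eq_Rintegral do rewrite mul0r; rewrite /Rintegral integral0.
rewrite /max_hilbert; apply: (big_ind (fun y => y = 0)) => // [y z -> ->|v _].
  exact: maxxx.
by rewrite /hilbert /= !h0 /cabs /= expr0n addr0 sqrtr0.
Qed.

(** That [f] is not 0 follows from the positive lower bound [a], since the maximal function of 0 is
    0. *)
Lemma opnorm_ge U (p a b : R) (f : Rn -> R[i]) : 0 < p -> 0 < a -> 0 < b -> schwartz f ->
  (a%:E <= Lp_norm p (max_hilbert U f))%E -> (Lp_norm p (fun x => cabs (f x)) <= b%:E)%E ->
  ((a / b)%:E <= max_hilbert_opnorm p U)%E.
Proof.
move=> p0 a0 b0 sf ha hb; have Y0 : (0 <= Lp_norm p (fun x => cabs (f x)))%E by exact: Lnorm_ge0.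
apply: (@le_trans _ _ (Lp_norm p (max_hilbert U f) / Lp_norm p (fun x => cabs (f x)))%E); last first.
  apply: ereal_sup_ubound; exists f; split => // f0.
  move: ha; rewrite f0 leNgt => /negP; apply.
  rewrite /Lp_norm unlock /=; under eq_integral do rewrite max_hilbert0 normr0 powR0 ?gt_eqF//.
  by rewrite integral0 poweR0r ?invr_eq0 ?gt_eqF// lte_fin.
have -> : (a / b)%:E = (a%:E * b%:E^-1)%E by rewrite inver gt_eqF.
apply: lee_pmul => //.
- by rewrite lee_fin ltW.
- by rewrite inve_ge0 lee_fin ltW.
- by rewrite lee_pV2// inE// lee_fin ltW.
Qed.

Lemma tree_max_hilbert (a : R) m r (e : R) (L : nat -> Rn) F w A U x :
  tree_state a m r e L m F w A ->
  (forall l, (l < 2 ^ m)%N -> enorm (L l) = 1) ->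
  (forall l, (l < 2 ^ m)%N -> L l \in U \/ - L l \in U) ->
  pi^-1 * pv_const * (gaussian 1 x * \sum_(i < 2 ^ m) w i x * A i x)
    - m%:R * e * (1 + enorm x) <= max_hilbert U (gauss_test F) x.
Proof.
move=> st L1 LU; set H := max_hilbert _ _ x; set k := pi^-1 * _; set g := gaussian 1 x.
set c := _ * (1 + _).
have -> : k * (g * \sum_(i < 2 ^ m) w i x * A i x) - c =
    \sum_(i < 2 ^ m) w i x * (k * (g * A i x) - c).
  rewrite -[X in _ - X]mul1r -(ts_w1 st x) mulr_suml !mulr_sumr -sumrB.
  by apply: eq_bigr => i _; ring.
rewrite -[leRHS]mul1r -(ts_w1 st x) mulr_suml; apply: ler_sum => i _.
apply: ler_wpM2l; first exact: (ts_w0 st).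
have hl := ltn_ord i.
have := ts_hilb st x hl; rewrite subnn expn0 divn1 -/k -/g -/c => h.
apply: (@le_trans _ _ (ghilb (L i) F x)).
  by move: h; rewrite ler_norml => /andP[h _]; rewrite -subr_ge0; move: h; lra.
apply: (le_trans (ler_norm _)).
case: (LU _ hl) => hU; first exact: ghilb_le_max_hilbert.
have := ghilb_le_max_hilbert F x hU.
by rewrite (ghilbN x (L1 _ hl) (ts_F st)) normrN.
Qed.

(** With u = F^2 / M, |F|^p = M^(p/2) u^(p/2) <= M^(p/2) (1 + u)^(r+1), because p / 2 <= r + 1 and 1
    + u >= 1. *)
Lemma Lp_norm_upper (p M Q : R) r F : 0 < p -> 0 < M -> 0 <= Q -> p <= 2 * r.+1%:R ->
  bmeasurable (fun x => (M + F x ^+ 2) ^+ r.+1) ->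
  gmean p (fun x => (M + F x ^+ 2) ^+ r.+1) <= M ^+ r.+1 * Q ->
  (Lp_norm p (fun x => cabs (gauss_test F x)) <= (M `^ 2^-1 * Q `^ p^-1)%:E)%E.
Proof.
move=> p0 M0 Q0 pr bF hF.
have i1 := integrable_gaussian p0 bF.
pose C := M `^ (p / 2) / M ^+ r.+1.
have C0 : 0 <= C by rewrite divr_ge0 ?powR_ge0// exprn_ge0// ltW.
have i2 := integrableZl measurableT C i1.
pose Phi x := C * (gaussian p x * (M + F x ^+ 2) ^+ r.+1).
apply: (@Lp_norm_le R n p _ _ Phi) => //.
- by rewrite mulr_ge0 ?powR_ge0.
- move=> x; rewrite (ger0_norm (cabs_ge0 _)).
  have -> : cabs (gauss_test F x) = gaussian 1 x * `|F x|.
    rewrite /cabs /= expr0n addr0 sqrtr_sqr normrM ger0_norm//; exact: gaussian_ge0.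
  rewrite powRM ?gaussian_ge0//.
  have -> : gaussian 1 x `^ p = gaussian p x.
    by rewrite /gaussian -expRM; congr expR; ring.
  rewrite /Phi [leRHS]mulrCA ler_wpM2l ?gaussian_ge0//.
  set u := F x ^+ 2 / M; have u0 : 0 <= u by rewrite divr_ge0 ?sqr_ge0// ltW.
  have -> : `|F x| = (M * u) `^ 2^-1.
    by rewrite mulrC divfK ?gt_eqF// powR12_sqrt ?sqr_ge0// sqrtr_sqr.
  rewrite -powRrM [_^-1 * _]mulrC powRM ?(ltW M0)// /C -mulrA ler_wpM2l ?powR_ge0//.
  have -> : (M ^+ r.+1)^-1 * (M + F x ^+ 2) ^+ r.+1 = (1 + u) `^ r.+1%:R.
    rewrite powR_mulrn ?addr_ge0// mulrC -expr_div_n; congr (_ ^+ _).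
    by rewrite mulrDl divff// gt_eqF.
  apply: (@le_trans _ _ ((1 + u) `^ (p / 2))).
    apply: ge0_ler_powR; rewrite ?nnegrE ?addr_ge0// ?lerDr//.
    by rewrite divr_ge0// ltW.
  by apply: ler_powR; rewrite ?lerDl// ler_pdivrMr// mulrC.
rewrite powRM ?powR_ge0// -!powRrM [_^-1 * p]mulrC mulVf ?gt_eqF// powRr1//.
have -> : \int[lebesgue_Rn n]_t Phi (row_of_tuple t) = C * gmean p (fun x => (M + F x ^+ 2) ^+ r.+1).
  by rewrite /Phi RintegralZl.
apply: (le_trans (ler_wpM2l C0 hF)).
by rewrite /C mulrA divfK// gt_eqF// exprn_gt0.
Qed.

(** The factor 2 is the root of 4, from m + 2 <= 4 m. *)
Lemma sqrt_log2_le (k m : nat) : (0 < k)%N -> (0 < m)%N -> (k <= 2 ^ m.+2)%N ->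
  Num.sqrt (log2 (k%:R : R)) <= 2 * (m%:R : R) `^ 2^-1.
Proof.
move=> k0 m0 km; have ln2 : 0 < ln 2 :> R by rewrite ln_gt0// ltr1n.
have h : log2 (k%:R : R) <= m.+2%:R.
  rewrite /log2 ler_pdivrMr// mulrC mulr_natr -lnXn// ler_ln ?posrE ?ltr0n ?exprn_gt0//.
  by rewrite -natrX ler_nat.
rewrite powR12_sqrt//.
have -> : 2 * Num.sqrt (m%:R : R) = Num.sqrt (4 * m%:R).
  by rewrite sqrtrM// (_ : 4 = 2 ^+ 2) ?sqrtr_sqr ?ger0_norm//; ring.
rewrite ler_wsqrtr//; apply: (le_trans h).
by rewrite -natrM ler_nat; lia.
Qed.

End maximal_function.

Theorem theorem1p1 (R : realType) (n : nat) (p : R)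
    (hn : (2 <= n)%N) (hp : 1 < p) :
  exists2 C : R, 0 < C &
    forall U : {fset 'rV[R]_n}, U != fset0 ->
      (forall v, v \in U -> enorm v = 1) ->
      ((C * Num.sqrt (log2 (#|` U|%:R : R)))%:E <= max_hilbert_opnorm p U)%E.
Proof.
have p0 : 0 < p by lra.
have p10 : 0 < p - 1 by lra.
pose one := fun _ : 'rV[R]_n => 1 : R.
have gm0 (a : R) : 0 < a -> 0 < gmean a one.
  by move=> a0; rewrite /one gmean1// exprn_gt0// gauss_mass_gt0.
pose J := gmean (p - 1) one; have J0 : 0 < J := gm0 _ p10.
pose I1 := gmean p one; have I0 : 0 < I1 := gm0 _ p0.
pose r := Num.bound p.
have pr : p <= 2 * r.+1%:R.
  have : p < r%:R by apply: archi_boundP; exact: ltW.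
  rewrite -natr1 => h; have : 0 <= r%:R :> R by []. lra.
(* The moment grows by [1 + K / m] per level, hence by at most [expR K] over [m] levels. *)
pose K : R := moment_const r.+1 + 1.
have K0 : 0 <= K by rewrite addr_ge0// moment_const_ge0.
pose kap : R := pi^-1 * pv_const.
have kap0 : 0 < kap by rewrite mulr_gt0 ?invr_gt0 ?pi_gt0// pv_const_gt0.
(* The gain of one level in [ts_corr], times the constant of the Hilbert transform. *)
pose b := kap * I1 / 16; have b0 : 0 < b by rewrite divr_gt0// mulr_gt0.
pose d := (p - 1) / 2; have d0 : 0 < d by rewrite divr_gt0.
pose G := (2 + d^-1) * gmean d one.
have G0 : 0 < G by rewrite mulr_gt0 ?gm0// addr_gt0// invr_gt0.
(* With e G = b / 2, the accumulated error m e takes at most half of the total gain m b, whatever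
   [m] is. *)
pose e := b / 2 / G; have e0 : 0 < e by exact: (divr_gt0 (divr_gt0 b0 _) G0).
pose Q := expR K * I1; have Q0 : 0 < Q by rewrite mulr_gt0// expR_gt0.
pose c := b / (4 * J) * J `^ p^-1 / Q `^ p^-1.
have Jp : 0 < J `^ p^-1 by exact: powR_gt0.
have Qp : 0 < Q `^ p^-1 by exact: powR_gt0.
have bJ : 0 < b / (4 * J) by exact: (divr_gt0 b0 (mulr_gt0 _ J0)).
have c0 : 0 < c by exact: (divr_gt0 (mulr_gt0 bJ Jp) Qp).
exists (c / 2) => [|U U0 U1]; first by rewrite divr_gt0.
have sU0 : (U : seq 'rV[R]_n) != [::].
  by rewrite -size_eq0; have := U0; rewrite -cardfs_eq0.
have [m [L [Xi [m0 Um LU XiL]]]] := exists_binary_frequencies (fset_uniq U) sU0 U1.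
have L1 l : (l < 2 ^ m)%N -> enorm (L l) = 1.
  by move=> /LU[/U1//|/U1]; rewrite enormN.
have M0 : 0 < m%:R :> R by rewrite ltr0n.
have [|q [q01 q_var q_drift]] := @sharp_polynomial R (4 * m%:R)^-1.
  by rewrite invr_gt0 mulr_gt0.
(* The means of the tree use the Gaussian of parameter [p], the p-th power of [gaussian 1]. *)
have [F [w [A st]]] := @tree_exists R n p p0 m r m0 q e e0 L Xi q01 q_var q_drift L1 XiL.
have tB : trigpoly (fun x => \sum_(i < 2 ^ m) w i x * A i x).
  by apply: trigpoly_sum => i _; apply: trigpolyM; [exact: (ts_w st)|exact: (ts_A st)].
have tM : trigpoly (fun x => (m%:R + F x ^+ 2) ^+ r.+1).
  apply: trigpolyX; apply: trigpolyD; first exact: trigpoly_cst.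
  exact/trigpolyX/(ts_F st).
have lower : ((m%:R * (b / (4 * J)) * J `^ p^-1)%:E <= Lp_norm p (max_hilbert U (gauss_test F)))%E.
  apply: (@Lp_norm_lower R n p kap m%:R e b _ (fun x => \sum_(i < 2 ^ m) w i x * A i x)) => //.
  - exact: ltW.
  - exact: trigpoly_bmeasurable.
  - move=> x; exact: max_hilbert_ge0.
  - by move=> x; exact: (tree_max_hilbert _ st L1 LU).
  - have := ler_wpM2l (ltW kap0) (ts_corr st); apply: le_trans.
    by rewrite le_eqVlt; apply/orP; left; apply/eqP; rewrite /b /I1 /one; ring.
  - by rewrite -mulrA -/d -/one -/G /e divfK// gt_eqF.
have upper : (Lp_norm p (fun x => cabs (gauss_test F x)) <= (m%:R `^ 2^-1 * Q `^ p^-1)%:E)%E.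
  apply: (@Lp_norm_upper R n p m%:R Q r F) => //.
  - exact: ltW.
  - exact: trigpoly_bmeasurable.
  apply: (le_trans (ts_mom st)).
  rewrite /Q [leRHS]mulrCA; apply: ler_wpM2r.
    by rewrite mulr_ge0 ?(ltW I0)// exprn_ge0.
  have -> : expR K = expR (K / m%:R) ^+ m.
    by rewrite -expRM_natr divfK// gt_eqF.
  apply: lerXn2r; rewrite ?nnegrE ?expR_ge0// ?expR_ge1Dx//.
  by rewrite addr_ge0// divr_ge0.
have sf : schwartz (gauss_test F) by exact/schwartz_gauss_trig/(ts_F st).
have sM0 : 0 < (m%:R : R) `^ 2^-1 by rewrite powR_gt0.
apply: le_trans (opnorm_ge p0 _ _ sf lower upper); last 2 first.
- exact: (mulr_gt0 (mulr_gt0 M0 bJ) Jp).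
- exact: mulr_gt0.
rewrite lee_fin.
have -> : m%:R * (b / (4 * J)) * J `^ p^-1 / (m%:R `^ 2^-1 * Q `^ p^-1) = c * m%:R `^ 2^-1.
  have E : (m%:R : R) = m%:R `^ 2^-1 * m%:R `^ 2^-1.
    by rewrite powR12_sqrt// -expr2 sqr_sqrtr.
  rewrite {1}E /c; set s := m%:R `^ 2^-1 in sM0 *; set X := b / (4 * J); set Y := J `^ _.
  set Z := Q `^ _ in Qp *.
  by field; rewrite (gt_eqF Qp) (gt_eqF sM0).
rewrite -mulrA ler_wpM2l ?(ltW c0)// mulrC ler_pdivrMr// mulrC.
by apply: sqrt_log2_le => //; rewrite cardfs_gt0.
Qed.
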